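(* Let $k$ be an algebraically closed field of characteristic $0$. (i) Let $P_C$ be the set of $(r,k_0,p,q)\in\mathbb Z^4$ with $r\ge1$, $k_0\ge0$, $p\in\{0,1,2\}$, $q\ge0$ and such that, if $r\in\{1,2\}$, then $(k_0,p)\notin\{(0,0),(0,1),(1,0)\}$. For such a tuple let $(\mathcal A_{k_0,p,q},-)=(\mathcal Q(-1),\natural)^{\otimes k_0}\otimes(\mathcal B_p,-)\otimes(R_q,1)$, where $(\mathcal B_0,-)=(k,1)$, $(\mathcal B_1,-)=(R_1,\natural)$, $(\mathcal B_2,-)=(\mathcal Q(-1),* )$. Then the map sending $(r,k_0,p,q)$ to the isomorphism class of $\mathfrak{ssp}_{2r}(\mathcal A_{k_0,p,q},-)$ is a bijection from $P_C$ onto the set of isomorphism classes of special symplectic Lie tori. Moreover, two special symplectic Lie tori are isomorphic if and only if they have the same root-grading type, the same nullity and the same root-space rank vector. (ii) Let $P_D=\{(r,n)\in\mathbb Z^2:r\ge4,\ n\ge0\}$. Then the map sending $(r,n)$ to the isomorphism class of $\mathfrak o_{2r}(R_n)$ is a bijection from $P_D$ onto the set of isomorphism classes of orthogonal Lie tori. Moreover, two orthogonal Lie tori are isomorphic if and only if they have the same root-grading type and the same nullity.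
   Context: Isomorphism means isomorphism of (ungraded) Lie algebras over $k$. Associative tori: for a finitely generated free abelian group $\Lambda$, an associative $\Lambda$-torus is a $\Lambda$-graded unital associative algebra with every homogeneous component spanned by an invertible element; an associative torus with involution additionally carries a graded involution (grading-preserving anti-automorphism of period 2). $R_n=k[t_1^{\pm1},\dots,t_n^{\pm1}]$ ($\mathbb Z^n$-graded), $1$ the trivial involution, $\natural$ on $R_1$ given by $t_1\mapsto-t_1$. $\mathcal Q(-1)$ is the $\mathbb Z^2$-graded algebra generated by $x_1^{\pm1},x_2^{\pm1}$ with $x_1x_2=-x_2x_1$; $\natural$ is the involution with $x_i\mapsto -x_i$, $*$ the involution with $x_i\mapsto x_i$ ($i=1,2$). Tensor products are graded by direct sums of grading groups. $J_r\in\mathrm{Mat}_r(k)$ has ones on the anti-diagonal and zeros elsewhere. For $r\ge1$ and an associative $\Lambda$-torus with involution $(\mathcal A,-)$ such that, when $r\in\{1,2\}$, $(\mathcal A,-)$ is not isomorphic to $(R_q,1)$, $(R_1,\natural)\otimes(R_q,1)$ or $(\mathcal Q(-1),\natural)\otimes(R_q,1)$ for any $q\ge0$: let $G=\begin{pmatrix}0&J_r\\-J_r&0\end{pmatrix}$ and let $\mathfrak{ssp}_{2r}(\mathcal A,-)$ be the derived algebra of the Lie algebra $\{X\in\mathrm{Mat}_{2r}(\mathcal A):G^{-1}\bar X^tG=-X\}$ (commutator product; $\bar X$ applies the involution entrywise). Such Lie algebras are the special symplectic Lie tori. For $r\ge4$, $n\ge0$, $\mathfrak o_{2r}(R_n)=\{X\in\mathrm{Mat}_{2r}(R_n):J_{2r}^{-1}X^tJ_{2r}=-X\}$;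 these are the orthogonal Lie tori. Each is given the structure of an fgc centreless Lie torus: with $\mathfrak h=\sum_{i=1}^r k(e_{ii}-e_{2r+1-i,2r+1-i})$, the root grading is the root-space decomposition relative to $\mathfrak h$ (root system of type $C_r$, resp. $D_r$; here $C_1$ means $A_1$, $C_2$ means $B_2$), and the $\Lambda$-grading is induced entrywise from the grading of $\mathcal A$ (resp. $R_n$). Lie torus of type $(\Delta,\Lambda)$: a Lie algebra with a $Q\times\Lambda$-grading ($Q=\mathrm{span}_{\mathbb Z}\Delta$, $\mathcal L_\alpha=\bigoplus_\lambda\mathcal L_\alpha^\lambda$, $\mathcal L^\lambda=\bigoplus_\alpha\mathcal L^\lambda_\alpha$) with $\{\alpha:\mathcal L_\alpha\ne0\}=\Delta$, $\mathcal L_\alpha^0\ne0$ for $\alpha\in\Delta^\times\setminus2\Delta^\times$, each nonzero $\mathcal L_\alpha^\lambda$ ($\alpha\ne0$) one-dimensional spanned by $e$ with some $f$ spanning $\mathcal L_{-\alpha}^{-\lambda}$ and $[[e,f],x]=\langle\beta,\alpha^\vee\rangle x$ for $x\in\mathcal L_\beta$, generated by the $\mathcal L_\alpha$ ($\alpha\ne0$), and $\Lambda$ generated by $\{\lambda:\mathcal L^\lambda\ne0\}$. Root-grading type = type of $\Delta$; nullity = $\mathrm{rank}\Lambda$. With $C$ the centroid $\{c\in\mathrm{End}_k\mathcal L: c[x,y]=[cx,y]=[x,cy]\}$, each root space $\mathcal L_\alpha$ is a free $C$-module of finite rank depending only on the length of $\alpha$; short roots = minimal length in $\Delta^\times$,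 extra-long = $\Delta^\times\cap2\Delta^\times$, long = others; the root-space rank vector is $(\mathrm{rk_{sh}})$ if $\Delta$ is reduced simply laced, $(\mathrm{rk_{sh}},\mathrm{rk_{lg}})$ if reduced not simply laced, $(\mathrm{rk_{sh}},\mathrm{rk_{ex}})$ for $BC_1$, $(\mathrm{rk_{sh}},\mathrm{rk_{lg}},\mathrm{rk_{ex}})$ for $BC_\ell,\ell\ge2$, where each entry is $\mathrm{rank}_C\mathcal L_\alpha$ for $\alpha$ of the indicated length. These invariants do not depend on the chosen Lie torus structure. *)

(* Defs.v *)
From HB Require Import structures.
From mathcomp Require Import all_boot all_order all_algebra.
Set Implicit Arguments. Unset Strict Implicit. Unset Printing Implicit Defensive.
Import Order.TTheory GRing.Theory Num.Theory.
Local Open Scope ring_scope.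

Section Tori.
Variable k : fieldType.

(* Associative Z^n-torus: A = (+)_l A_l with A_l = k x_l, x_l invertible,
   A_l A_m <= A_(l+m).                                                       *)
Definition is_assoc_torus (A : algType k) (n : nat) (x : 'rV[int]_n -> A) : Prop :=
  [/\ (forall l, exists y : A, x l * y = 1 /\ y * x l = 1),
      (forall l m, exists c : k, x l * x m = c *: x (l + m)),
      (forall a : A, exists (s : seq 'rV[int]_n) (c : 'rV[int]_n -> k),
          a = \sum_(l <- s) c l *: x l) &
      (forall (s : seq 'rV[int]_n) (c : 'rV[int]_n -> k), uniq s ->
          \sum_(l <- s) c l *: x l = 0 -> forall l, l \in s -> c l = 0)].

Definition is_graded_involution (A : algType k) (n : nat) (x : 'rV[int]_n -> A)
    (inv : A -> A) : Prop :=
  [/\ (forall (c : k) (a b : A), inv (c *: a + b) = c *: inv a + inv b),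
      (forall a b : A, inv (a * b) = inv b * inv a),
      (forall a : A, inv (inv a) = a) &
      (forall l, exists c : k, inv (x l) = c *: x l)].

Definition is_torus_inv (A : algType k) (n : nat) (x : 'rV[int]_n -> A)
    (inv : A -> A) : Prop :=
  is_assoc_torus x /\ is_graded_involution x inv.

(* The model (Q(-1),nat)^(x k0) (x) (B_p,-) (x) (R_q,1), presented by
   generators t_0..t_(n-1), n = 2k0+p+q: generators 2a,2a+1 (a<k0) are the
   generators of the a-th factor Q(-1); then the p generators of B_p; then
   the q generators of R_q.  Generators of different tensor factors commute. *)
Definition model_comm (k0 p : nat) (i j : nat) : k :=
  if [&& i != j, i./2 == j./2 & i < 2 * k0 + (if p == 2 then 2 else 0)]%N
  then -1 else 1.

Definition model_sign (k0 p : nat) (i : nat) : k :=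
  if (i < 2 * k0)%N || ((p == 1%N) && (i == 2 * k0)%N) then -1 else 1.

(* (A,-) is isograded-isomorphic (as torus with involution) to the model:
   there are homogeneous invertible generators t_i whose degrees form a
   Z-basis of Z^n, satisfying the defining relations of the model.          *)
Definition is_model (A : algType k) (n : nat) (x : 'rV[int]_n -> A)
    (inv : A -> A) (k0 p q : nat) : Prop :=
  n = (2 * k0 + p + q)%N /\
  exists (t : 'I_n -> A) (D : 'M[int]_n),
    [/\ D \in unitmx,
        (forall i, exists c : k, c != 0 /\ t i = c *: x (row i D)),
        (forall i j : 'I_n, t i * t j = model_comm k0 p i j *: (t j * t i)) &
        (forall i, inv (t i) = model_sign k0 p i *: t i)].

Definition is_laurent (A : algType k) (n : nat) (x : 'rV[int]_n -> A) : Prop :=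
  is_torus_inv x id /\ is_model x id 0 0 n.

Definition mxscale (A : algType k) m (c : k) (X : 'M[A]_m) : 'M[A]_m :=
  map_mx (fun a => c *: a) X.

Definition lie_br (A : algType k) m (X Y : 'M[A]_m) : 'M[A]_m := X *m Y - Y *m X.

Definition Jmx (A : algType k) (r : nat) : 'M[A]_r :=
  \matrix_(i < r, j < r) ((i + j == r.-1)%N)%:R.

Definition Gmx (A : algType k) (r : nat) : 'M[A]_(r + r) :=
  block_mx 0 (Jmx A r) (- Jmx A r) 0.

(* G^{-1} = -G  (since G * G = -1) *)
Definition Ginvmx (A : algType k) (r : nat) : 'M[A]_(r + r) := - Gmx A r.

Definition skew_sympl (A : algType k) (r : nat) (inv : A -> A) (X : 'M[A]_(r + r)) : Prop :=
  Ginvmx A r *m (map_mx inv X)^T *m Gmx A r = - X.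

Definition derived (A : algType k) m (S : 'M[A]_m -> Prop) (Z : 'M[A]_m) : Prop :=
  exists s : seq (k * 'M[A]_m * 'M[A]_m),
    (forall u, u \in s -> S u.1.2 /\ S u.2) /\
    Z = \sum_(u <- s) mxscale u.1.1 (lie_br u.1.2 u.2).

Definition ssp (A : algType k) (r : nat) (inv : A -> A) : 'M[A]_(r + r) -> Prop :=
  derived (@skew_sympl A r inv).

(* J_{2r}^{-1} = J_{2r} *)
Definition orth (A : algType k) (r : nat) (X : 'M[A]_(r + r)) : Prop :=
  Jmx A (r + r) *m X^T *m Jmx A (r + r) = - X.

Definition lie_iso (A B : algType k) m1 m2 (L1 : 'M[A]_m1 -> Prop)
    (L2 : 'M[B]_m2 -> Prop) : Prop :=
  exists f : 'M[A]_m1 -> 'M[B]_m2,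
    [/\ (forall X, L1 X -> L2 (f X)),
        (forall Y, L2 Y -> exists X, L1 X /\ f X = Y),
        (forall X Y, L1 X -> L1 Y -> f X = f Y -> X = Y),
        (forall c X Y, L1 X -> L1 Y -> f (mxscale c X + Y) = mxscale c (f X) + f Y) &
        (forall X Y, L1 X -> L1 Y -> f (lie_br X Y) = lie_br (f X) (f Y))].

Definition ssp_admissible (r : nat) (A : algType k) (n : nat)
    (x : 'rV[int]_n -> A) (inv : A -> A) : Prop :=
  [/\ (1 <= r)%N, is_torus_inv x inv &
      ((r <= 2)%N -> forall q : nat,
         [/\ ~ is_model x inv 0 0 q, ~ is_model x inv 0 1 q & ~ is_model x inv 1 0 q])].

Definition in_PC (r k0 p q : nat) : Prop :=
  [/\ (1 <= r)%N, (p <= 2)%N &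
      ((r <= 2)%N -> ~ ((k0 == 0%N) && (p == 0%N) \/ (k0 == 0%N) && (p == 1%N)
                        \/ (k0 == 1%N) && (p == 0%N)))].

Definition centroid (A : algType k) m (L : 'M[A]_m -> Prop) (c : 'M[A]_m -> 'M[A]_m) : Prop :=
  [/\ (forall X, L X -> L (c X)),
      (forall a X Y, L X -> L Y -> c (mxscale a X + Y) = mxscale a (c X) + c Y) &
      (forall X Y, L X -> L Y ->
         c (lie_br X Y) = lie_br (c X) Y /\ c (lie_br X Y) = lie_br X (c Y))].

Definition free_rank (A : algType k) m (L V : 'M[A]_m -> Prop) (d : nat) : Prop :=
  exists v : 'I_d -> 'M[A]_m,
    [/\ (forall i, V (v i)),
        (forall X, V X -> exists c : 'I_d -> ('M[A]_m -> 'M[A]_m),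
            (forall i, centroid L (c i)) /\ X = \sum_i c i (v i)) &
        (forall c : 'I_d -> ('M[A]_m -> 'M[A]_m), (forall i, centroid L (c i)) ->
            \sum_i c i (v i) = 0 -> forall i X, L X -> c i X = 0)].

(* h_i = e_ii - e_{2r+1-i,2r+1-i} (1-based) *)
Definition hmx (A : algType k) (r : nat) (i : 'I_r) : 'M[A]_(r + r) :=
  delta_mx (lshift r i) (lshift r i) - delta_mx (rshift r (rev_ord i)) (rshift r (rev_ord i)).

Definition rootspace (A : algType k) (r : nat) (L : 'M[A]_(r + r) -> Prop)
    (alpha : 'I_r -> int) (X : 'M[A]_(r + r)) : Prop :=
  L X /\ forall i, lie_br (hmx A i) X = mxscale (alpha i)%:~R X.

(* 2 eps_1 (long root; the unique root length for A_1) *)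
Definition alpha_2e1 (r : nat) (i : 'I_r) : int := if val i == 0%N then 2 else 0.
Definition alpha_e1e2 (r : nat) (i : 'I_r) : int :=
  if val i == 0%N then 1 else if val i == 1%N then -1 else 0.

(* root-space rank vector of ssp_{2r} / L with its C_r grading:
   r = 1 (A_1): (rk_sh); r >= 2 (B_2 = C_2, C_r): (rk_sh, rk_lg) *)
Definition ssp_rkvec (A : algType k) (r : nat) (L : 'M[A]_(r + r) -> Prop)
    (s : seq nat) : Prop :=
  if r == 1%N then exists a, s = [:: a] /\ free_rank L (rootspace L (@alpha_2e1 r)) a
  else exists a b, s = [:: a; b] /\ free_rank L (rootspace L (@alpha_e1e2 r)) a
                   /\ free_rank L (rootspace L (@alpha_2e1 r)) b.

End Tori.

Inductive root_type := RT_A of nat | RT_B of nat | RT_C of nat | RT_D of nat.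

(* root-grading type of ssp_{2r}: C_r, with C_1 = A_1, C_2 = B_2 *)
Definition ssp_type (r : nat) : root_type :=
  if r == 1%N then RT_A 1 else if r == 2%N then RT_B 2 else RT_C r.
Definition orth_type (r : nat) : root_type := RT_D r.

(* Main.v *)
(* A torus with involution is governed by a quadratic form over [F_2]: if
   [inv (x_l) = (-1)^(q l) x_l], then [x_l] and [x_m] commute up to the sign of the polar form
   [b l m = q l + q m + q (l + m)].  Splitting off hyperbolic planes over the integers puts [q]
   in the normal form given by [k0], [p] and [q]: two planes of type [*] are two planes of type
   [natural], and a plane of type [*] next to a radical vector on which the form is 1 can be made
   of type [natural].

   Conversely, [r] is read off the Lie algebra from the largest nilpotency order of [ad e] for [e]
   in a pair with [[h, e] = 2 e]: [4 r - 2] is attained by a regular nilpotent, and [4 r - 1] never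
   is, because a nilpotent square matrix of size [2 r] over a torus has vanishing [2 r]-th power.
   The centroid is the part [Z] of the centre of the torus that is fixed by the involution, a
   Laurent polynomial ring in [n] variables;
   [n] is the dimension of the space of point derivations, and the rank of the algebra over [Z] is
   [d] with [d + [p = 1] = 2 r^2 C + r S], where [C = 2^(2 k0 + p)] counts the classes modulo the
   support of [Z] and [S] is the sum of the signs of the involution on them.  As [S] is 0
   for odd [p] and a square root of [C] otherwise, [d] and admissibility determine [(k0, p)]. *)

(* The rank formula has a classical origin: over an algebraic closure of the fraction field of [Z],
   the symplectic algebra becomes [sp_{2y}], [so_{2y}] or, for [p = 1], [sl_{2y}], where
   [y = r 2^level] and [level] is [k0], plus one if [p = 2]; the sign [(-1)^k0] separates the first
   two. The dimensions [2y^2 + y], [2y^2 - y], [4y^2 - 1] differ for [y >= 2], and one more level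
   outweighs any change of type. In rank one the exclusions avoid [y = 1], where [sl_2 = sp_2], and
   [so_4], which is not simple and has a larger centroid.

   The obstacle is that isomorphisms ignore the grading and the torus is not commutative, so that
   neither degrees nor determinants help. Linear dependence over the torus is obtained from its
   polynomial growth, by counting monomials in boxes. The centroid is pinned down on one extremal
   element and then propagated along the roots. The augmentation sending every basis monomial to 1
   is a character of [Z]; it turns ranks over [Z] into ranks of matrices over [k].

   For the orthogonal algebras the rank over the centroid is [r (2r - 1)], and it gives [r]
   directly. *)
Require Import Defs.
From HB Require Import structures.
From Stdlib Require Import Classical IndefiniteDescription FunctionalExtensionality PropExtensionality.
From mathcomp Require Import all_boot all_order all_algebra finmap zify ring.
From mathcomp.multinomials Require Import monalg.
Set Implicit Arguments. Unset Strict Implicit. Unset Printing Implicit Defensive.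
Import Order.TTheory GRing.Theory Num.Theory.
Local Open Scope ring_scope.

(** * Quantum tori *)

Section LinearExtension.
Variables (k : fieldType) (K : choiceType).

Lemma malg_ind (P : {malg k[K]} -> Prop) :
  P 0 -> (forall f g, P f -> P g -> P (f + g)) ->
  (forall c l, P << c *g l >>) -> forall f, P f.
Proof.
move=> P0 PD PU f; rewrite (monalgE f).
by apply: big_ind => // l _; apply: PU.
Qed.

Lemma malgUE (c : k) (l : K) : << c *g l >> = c *: << 1 *g l >> :> {malg k[K]}.
Proof. by apply/malgP => m; rewrite mcoeffZ !mcoeffU mulrnAr mulr1. Qed.

Lemma mcoeff_comb (s : seq K) (c : K -> k) (f : K -> {malg k[K]}) l :
  (\sum_(i <- s) c i *: f i)@_l = \sum_(i <- s) c i * (f i)@_l.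
Proof. by rewrite (raddf_sum (mcoeff l)); apply: eq_bigr => i _ /=; rewrite mcoeffZ. Qed.

Variable V : lmodType k.
Implicit Types (h : K -> V) (f g : {malg k[K]}).

Definition lext h f : V := \sum_(l <- msupp f) f@_l *: h l.

Lemma lextEw h f (d : {fset K}) : (msupp f `<=` d)%fset ->
  lext h f = \sum_(l <- d) f@_l *: h l.
Proof.
move=> le; rewrite /lext (big_fset_incl _ le) //= => l _ /mcoeff_outdom ->.
by rewrite scale0r.
Qed.

Lemma lext_linear h : linear (lext h).
Proof.
move=> c f g.
pose d := (msupp f `|` msupp g)%fset.
have le1 : (msupp (c *: f + g) `<=` d)%fset.
  apply: fsubset_trans (msuppD_le _ _) _.
  by apply: fsetUSS => //; apply: msuppZ_le.
rewrite (lextEw h le1) (lextEw h (fsubsetUl _ _ : _ `<=` d)%fset).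
rewrite (lextEw h (fsubsetUr _ _ : _ `<=` d)%fset).
rewrite scaler_sumr -big_split /=; apply: eq_bigr => l _.
by rewrite mcoeffD mcoeffZ scalerDl scalerA.
Qed.

HB.instance Definition _ h :=
  GRing.isLinear.Build k {malg k[K]} V _ (lext h) (lext_linear h).

Lemma lextU h c l : lext h << c *g l >> = c *: h l.
Proof. by rewrite (lextEw _ msuppU_le) big_seq_fset1 mcoeffUU. Qed.

Lemma eq_lext h1 h2 f : (forall l, h1 l = h2 l) -> lext h1 f = lext h2 f.
Proof. by move=> e; apply: eq_bigr => l _; rewrite e. Qed.

Lemma lextZ a h f : lext (fun l => a *: h l) f = a *: lext h f.
Proof.
by rewrite /lext scaler_sumr; apply: eq_bigr => l _; rewrite !scalerA mulrC.
Qed.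

Lemma lextD h1 h2 f : lext (fun l => h1 l + h2 l) f = lext h1 f + lext h2 f.
Proof.
by rewrite /lext -big_split; apply: eq_bigr => l _; rewrite scalerDr.
Qed.

End LinearExtension.

Section Parity.
Variable k : fieldType.

Definition sg (z : int) : k := (-1) ^ z.

Lemma sgD a b : sg (a + b) = sg a * sg b.
Proof. by rewrite /sg expfzDr // oppr_eq0 oner_eq0. Qed.

Lemma sg0 : sg 0 = 1. Proof. by []. Qed.

Lemma sgN a : sg (- a) = sg a.
Proof. by rewrite /sg -exprz_inv invrN invr1. Qed.

Lemma sg_odd a : sg a = (-1) ^+ odd `|a|%N.
Proof.
by rewrite signr_odd; case: a => m //; rewrite NegzE sgN.
Qed.

Lemma sgMn2 a : sg (a *+ 2) = 1.
Proof. by rewrite mulr2n sgD -expr2 sg_odd sqrr_sign. Qed.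

Lemma sgsg a : sg a * sg a = 1.
Proof. by rewrite -sgD -mulr2n sgMn2. Qed.

Lemma sg_neq0 a : sg a != 0.
Proof. by rewrite sg_odd signr_eq0. Qed.

Lemma sg_cases a : sg a = 1 \/ sg a = -1.
Proof. by rewrite sg_odd; case: (odd _); [right|left]. Qed.

End Parity.

Section Entries.
Variable n : nat.
Implicit Types l m : 'rV[int]_n.

(* [ent l i] is the [i]-th coordinate, and [0] beyond the dimension. *)
Definition ent l (i : nat) : int := oapp (l 0) 0 (insub i : option 'I_n).

Lemma entD l m i : ent (l + m) i = ent l i + ent m i.
Proof. by rewrite /ent; case: insubP => [j _ _|_] /=; rewrite ?mxE ?addr0. Qed.

Lemma entN l i : ent (- l) i = - ent l i.
Proof. by rewrite /ent; case: insubP => [j _ _|_] /=; rewrite ?mxE ?oppr0. Qed.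

Lemma ent0 i : ent 0 i = 0.
Proof. by rewrite /ent; case: insubP => [j _ _|_] //=; rewrite ?mxE. Qed.

Lemma entE l (i : 'I_n) : ent l i = l 0 i.
Proof. by rewrite /ent valK. Qed.

(** Exponent of the sign that arises when an ordered monomial of degree [l] is multiplied by one of
    degree [m]: in each anticommuting pair the second generator, from [l], moves past the first one,
    from [m]. The form is bilinear but not symmetric; modulo 2, its symmetrization is the
    commutation form. *)
Definition qf (k1 : nat) l m : int :=
  \sum_(a < k1) ent l (2 * a).+1 * ent m (2 * a)%N.

Lemma qfDl k1 l1 l2 m : qf k1 (l1 + l2) m = qf k1 l1 m + qf k1 l2 m.
Proof. by rewrite /qf -big_split; apply: eq_bigr => a _; rewrite entD mulrDl. Qed.

Lemma qfDr k1 l m1 m2 : qf k1 l (m1 + m2) = qf k1 l m1 + qf k1 l m2.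
Proof. by rewrite /qf -big_split; apply: eq_bigr => a _; rewrite entD mulrDr. Qed.

Lemma qf0l k1 m : qf k1 0 m = 0.
Proof. by rewrite /qf big1 // => a _; rewrite ent0 mul0r. Qed.

Lemma qf0r k1 m : qf k1 m 0 = 0.
Proof. by rewrite /qf big1 // => a _; rewrite ent0 mulr0. Qed.

Lemma qfNl k1 l m : qf k1 (- l) m = - qf k1 l m.
Proof. by rewrite /qf -sumrN; apply: eq_bigr => a _; rewrite entN mulNr. Qed.

Lemma qfNr k1 l m : qf k1 l (- m) = - qf k1 l m.
Proof. by rewrite /qf -sumrN; apply: eq_bigr => a _; rewrite entN mulrN. Qed.

(** Linear part of the exponent of the involution: it collects the exponents of the generators on
    which the involution is -1. *)
Definition lf (k0 p : nat) l : int :=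
  \sum_(i < 2 * k0) ent l i + (if p == 1%N then ent l (2 * k0)%N else 0).

Lemma lfD k0 p l m : lf k0 p (l + m) = lf k0 p l + lf k0 p m.
Proof.
rewrite /lf (eq_bigr (fun i : 'I__ => ent l i + ent m i)) => [|i _]; last by rewrite entD.
by rewrite big_split /=; case: ifP => _; [rewrite entD addrACA|rewrite !addr0].
Qed.

Lemma lf0 k0 p : lf k0 p 0 = 0.
Proof. by rewrite /lf big1 => [|i _]; rewrite ent0 ?if_same. Qed.

End Entries.

(* Stated for an abstract module: on the concrete type below, unification
   would unfold the operations down to finitely supported functions. *)
Section BilinearProduct.
Variables (k : fieldType) (G : zmodType) (V : lmodType k).
Variables (mu : V -> V -> V) (x : G -> V) (e : G -> G -> k).
Hypothesis muDl : left_distributive mu +%R.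
Hypothesis muDr : right_distributive mu +%R.
Hypothesis mu0g : forall f, mu 0 f = 0.
Hypothesis mug0 : forall f, mu f 0 = 0.
Hypothesis muU : forall a b (c d : k),
  mu (c *: x a) (d *: x b) = (c * d * e a b) *: x (a + b).
Hypothesis indV : forall (P : V -> Prop),
  P 0 -> (forall f g, P f -> P g -> P (f + g)) ->
  (forall c l, P (c *: x l)) -> forall f, P f.
Hypothesis eDl : forall a b c, e (a + b) c = e a c * e b c.
Hypothesis eDr : forall a b c, e a (b + c) = e a b * e a c.
Hypothesis e0l : forall a, e 0 a = 1.
Hypothesis e0r : forall a, e a 0 = 1.

Lemma bilinear_mulA : associative mu.
Proof.
move=> f g h.
elim/indV: f => [|f1 f2 IH1 IH2|c l].
- by rewrite !mu0g.
- by rewrite !muDl IH1 IH2.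
elim/indV: g => [|f1 f2 IH1 IH2|d m].
- by rewrite mug0 !mu0g mug0.
- by rewrite muDl !muDr muDl IH1 IH2.
elim/indV: h => [|f1 f2 IH1 IH2|u p].
- by rewrite !mug0.
- by rewrite !muDr IH1 IH2.
by rewrite !muU addrA eDl eDr; congr (_ *: _); ring.
Qed.

Lemma bilinear_mul1g : left_id (x 0) mu.
Proof.
elim/indV => [|f1 f2 IH1 IH2|c l].
- by rewrite mug0.
- by rewrite muDr IH1 IH2.
by rewrite -[x 0]scale1r muU e0l add0r mul1r mulr1.
Qed.

Lemma bilinear_mulg1 : right_id (x 0) mu.
Proof.
elim/indV => [|f1 f2 IH1 IH2|c l].
- by rewrite mu0g.
- by rewrite muDl IH1 IH2.
by rewrite -[x 0]scale1r muU e0r addr0 !mulr1.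
Qed.

End BilinearProduct.

Fact torus_key : unit. Proof. exact: tt. Qed.

(** [k1] is a phantom parameter: it keeps apart the algebra structures that different numbers of
    anticommuting pairs put on one and the same module. *)
Definition qtorus (k : fieldType) (n k1 : nat) : Type := {malg k['rV[int]_n]}.

Section QTorus.
Variables (k : fieldType) (n k1 : nat).
Local Notation L := 'rV[int]_n.
Local Notation T := (qtorus k n k1).

HB.instance Definition _ := Choice.on T.
HB.instance Definition _ := GRing.Lmodule.on T.

Definition eps (l m : L) : k := sg k (qf k1 l m).

Lemma epsDl l1 l2 m : eps (l1 + l2) m = eps l1 m * eps l2 m.
Proof. by rewrite /eps qfDl sgD. Qed.
Lemma epsDr l m1 m2 : eps l (m1 + m2) = eps l m1 * eps l m2.
Proof. by rewrite /eps qfDr sgD. Qed.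
Lemma eps0l m : eps 0 m = 1. Proof. by rewrite /eps qf0l. Qed.
Lemma eps0r m : eps m 0 = 1. Proof. by rewrite /eps qf0r. Qed.
Lemma epsNl l m : eps (- l) m = eps l m. Proof. by rewrite /eps qfNl sgN. Qed.
Lemma epsNr l m : eps l (- m) = eps l m. Proof. by rewrite /eps qfNr sgN. Qed.
Lemma eps_neq0 l m : eps l m != 0. Proof. exact: sg_neq0. Qed.
Lemma epsS l m : eps l m * eps l m = 1. Proof. exact: sgsg. Qed.

(* Locking keeps unification from unfolding ring operations on [T] down to
   finitely supported functions. *)
Definition xx (l : L) : T := locked_with torus_key << 1 *g l >>.

Lemma xxE l : xx l = << 1 *g l >>.
Proof. by rewrite /xx unlock. Qed.

Definition tmul (f g : T) : T := locked_with torus_key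
  (lext (fun a => lext (fun b => eps a b *: xx (a + b)) g) f).

Lemma tmulE f g :
  tmul f g = lext (fun a => lext (fun b => eps a b *: xx (a + b)) g) f.
Proof. by rewrite /tmul unlock. Qed.

Lemma torus_ind (P : T -> Prop) :
  P 0 -> (forall f g, P f -> P g -> P (f + g)) ->
  (forall c l, P (c *: xx l)) -> forall f, P f.
Proof.
move=> P0 PD PU; apply: (@malg_ind k _ P P0 PD) => c l.
by rewrite malgUE -xxE; apply: PU.
Qed.

Lemma tmulU a b (c d : k) :
  tmul (c *: xx a) (d *: xx b) = (c * d * eps a b) *: xx (a + b).
Proof.
have U (u : k) i : u *: xx i = << u *g i >> by rewrite xxE -malgUE.
by rewrite tmulE !U !lextU !scalerA U.
Qed.

Lemma tmulDl : left_distributive tmul +%R.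
Proof. by move=> f g h; rewrite !tmulE linearD. Qed.

Lemma tmulDr : right_distributive tmul +%R.
Proof.
move=> f g h; rewrite !tmulE -lextD; apply: eq_lext => a.
by rewrite linearD.
Qed.

Lemma tmul0g f : tmul 0 f = 0. Proof. by rewrite tmulE linear0. Qed.
Lemma tmulg0 f : tmul f 0 = 0.
Proof. by rewrite tmulE /lext big1 // => a _; rewrite msupp0 big_nil scaler0. Qed.

Lemma tmulA : associative tmul.
Proof. exact: (bilinear_mulA tmulDl tmulDr tmul0g tmulg0 tmulU torus_ind epsDl epsDr). Qed.

Lemma tmul1g : left_id (xx 0) tmul.
Proof. exact: (bilinear_mul1g tmulDr tmulg0 tmulU torus_ind eps0l). Qed.

Lemma tmulg1 : right_id (xx 0) tmul.
Proof. exact: (bilinear_mulg1 tmulDl tmul0g tmulU torus_ind eps0r). Qed.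

Lemma xx0_neq0 : xx 0 != 0.
Proof. by apply/eqP; rewrite xxE => /malgP/(_ 0) /eqP; rewrite mcoeffUU mcoeff0 oner_eq0. Qed.

HB.instance Definition _ := GRing.Zmodule_isNzRing.Build T
  tmulA tmul1g tmulg1 tmulDl tmulDr xx0_neq0.

Lemma tscaleAl (c : k) (f g : T) : c *: (f * g) = (c *: f) * g.
Proof. by rewrite /GRing.mul /= !tmulE linearZ. Qed.

HB.instance Definition _ := GRing.Lmodule_isLalgebra.Build k T tscaleAl.

Lemma tscaleAr (c : k) (f g : T) : c *: (f * g) = f * (c *: g).
Proof.
rewrite /GRing.mul /= !tmulE -lextZ; apply: eq_lext => a.
by rewrite linearZ.
Qed.

HB.instance Definition _ := GRing.Lalgebra_isAlgebra.Build k T tscaleAr.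

Lemma xxM l m : xx l * xx m = eps l m *: xx (l + m).
Proof. by have := tmulU l m 1 1; rewrite !scale1r !mul1r. Qed.

Lemma xxP (f : T) : f = \sum_(l <- msupp f) f@_l *: xx l.
Proof. by rewrite {1}(monalgE f); apply: eq_bigr => l _; rewrite xxE -malgUE. Qed.

Lemma qtorus_assoc_torus : is_assoc_torus xx.
Proof.
split.
- move=> l; exists (eps l l *: xx (- l)).
  rewrite -scalerAr -scalerAl !xxM epsNl epsNr subrr addNr !scalerA epsS !scale1r.
  by split.
- by move=> l m; exists (eps l m); rewrite xxM.
- by move=> a; exists (msupp a), (fun l => a@_l); apply: xxP.
move=> s c us E l ls.
have E0 : mcoeff l (\sum_(i <- s) c i *: xx i) = 0 by rewrite E; apply: mcoeff0.
have {E0} := etrans (esym (mcoeff_comb s c xx l)) E0.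
rewrite (bigD1_seq l) //= xxE mcoeffU eqxx mulr1.
by rewrite big1 ?addr0 // => i /negPf il; rewrite xxE mcoeffU il mulr0.
Qed.

End QTorus.

Lemma filter_key (T1 T2 : eqType) (s : seq (T1 * T2)) u :
  uniq (unzip1 s) -> u \in s -> [seq i <- s | i.1 == u.1] = [:: u].
Proof.
elim: s => //= v s IH /andP[vs us]; rewrite inE => /orP[/eqP ->|us'].
  rewrite eqxx; congr cons; apply/eqP; rewrite -(negbK (_ == _)) -has_filter.
  by apply/hasPn => w ws; apply: contraNneq vs => <-; apply: map_f.
case: eqP => [e|_]; last exact: IH.
by move: vs; rewrite e map_f.
Qed.

(** Coordinates on a torus whose basis has been rescaled so that its structure constants are exactly
    the signs [eps]. An arbitrary torus with involution is brought to this form once; afterwards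
    every computation is one with integer exponents, whatever the algebra [A] is. *)
Record torus_str (k : fieldType) (n k1 : nat) (A : algType k) := TorusStr {
  tx : 'rV[int]_n -> A;
  tcf : 'rV[int]_n -> A -> k;
  tsupp : A -> seq 'rV[int]_n;
  tsupp_uniq : forall a, uniq (tsupp a);
  mem_tsupp : forall a l, (l \in tsupp a) = (tcf l a != 0);
  tcf_linear : forall l c a b, tcf l (c *: a + b) = c * tcf l a + tcf l b;
  tcfE : forall a, a = \sum_(l <- tsupp a) tcf l a *: tx l;
  tcf_x : forall l m, tcf l (tx m) = (m == l)%:R;
  txM : forall l m, tx l * tx m = eps k k1 l m *: tx (l + m);
  tx0 : tx 0 = 1 }.

Section TorusOfBasis.
Variables (k : fieldType) (n k1 : nat) (A : algType k) (x : 'rV[int]_n -> A).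
Local Notation L := 'rV[int]_n.
Hypothesis xA : is_assoc_torus x.
Hypothesis xxM : forall l m, x l * x m = eps k k1 l m *: x (l + m).

Let expansion (a : A) (s : seq (L * k)) :=
  [&& uniq (unzip1 s), all (fun u => u.2 != 0) s & a == \sum_(u <- s) u.2 *: x u.1].

Let expansion_ex a : exists s, expansion a s.
Proof.
have [_ _ gen _] := xA; have [s [c E]] := gen a.
(* The list given by the generation clause may repeat degrees; the multiplicity is absorbed into the
   coefficient before zero coefficients are discarded. *)
pose d l := c l *+ count_mem l s.
have Ed : a = \sum_(l <- undup s) d l *: x l.
  rewrite E -(big_undup_iterop_count GRing.add).
  rewrite [RHS]big_seq_cond [LHS]big_seq_cond; apply: eq_bigr => l.
  by rewrite andbT mem_undup => ls; rewrite /d -scalerMnl.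
exists [seq (l, d l) | l <- undup s & d l != 0]; apply/and3P; split.
- by rewrite /unzip1 -map_comp map_id filter_uniq // undup_uniq.
- by apply/allP => u /mapP[l]; rewrite mem_filter => /andP[dl _] ->.
rewrite big_map big_filter {1}Ed; apply/eqP.
rewrite [LHS](bigID (fun l => d l != 0)) /= [X in _ + X]big1 ?addr0 //.
by move=> l; rewrite negbK => /eqP ->; rewrite scale0r.
Qed.

Let ex a := xchoose (expansion_ex a).
Let cf l a : k := \sum_(u <- ex a | u.1 == l) u.2.
Let supp a := unzip1 (ex a).

Let cfE0 a : a = \sum_(l <- supp a) cf l a *: x l.
Proof.
have /and3P[us _ /eqP E] := xchooseP (expansion_ex a).
rewrite {1}E /supp /unzip1 big_map /cf -/(ex a).
rewrite [LHS]big_seq [RHS]big_seq; apply: eq_bigr => u ue.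
congr (_ *: _).
rewrite -big_filter.
by rewrite filter_key // big_seq1.
Qed.

Let cf_uniq a (t : seq L) (c : L -> k) : uniq t -> a = \sum_(l <- t) c l *: x l ->
  forall l, cf l a = if l \in t then c l else 0.
Proof.
move=> ut E l; have [_ _ _ ind] := xA.
(* Both expansions are padded with zeros to one common duplicate-free list, where independence
   applies to their difference. *)
pose r := undup (t ++ supp a).
have S (u : seq L) (d : L -> k) : uniq u -> {subset u <= r} ->
    \sum_(l <- u) d l *: x l = \sum_(l <- r) (if l \in u then d l else 0) *: x l.
  move=> uu su.
  rewrite [RHS](bigID (mem u)) /= [X in _ + X]big1 ?addr0; last first.
    by move=> i /negPf ->; rewrite scale0r.
  rewrite -[RHS]big_filter [RHS](perm_big u) /=.
    rewrite [LHS]big_seq [RHS]big_seq.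
    by apply: eq_bigr => i iu; rewrite iu.
  apply: uniq_perm; rewrite ?filter_uniq ?undup_uniq // => i.
  by rewrite mem_filter; case iu: (i \in u) => //=; rewrite su.
have ua : uniq (supp a) by have /and3P[] := xchooseP (expansion_ex a).
have ca : l \notin supp a -> cf l a = 0.
  rewrite /cf -big_filter => ls; rewrite big1_seq // => u /andP[_].
  rewrite mem_filter => /andP[/eqP ul uE]; move: ls.
  by rewrite -ul map_f.
have Z : \sum_(l <- r) ((if l \in t then c l else 0) - (if l \in supp a then cf l a else 0)) *: x l = 0.
  under eq_bigr do rewrite scalerBl.
  rewrite sumrB -!S ?ua ?ut // -?E -?cfE0 ?subrr //.
  - by move=> i; rewrite mem_undup mem_cat orbC => ->.
  - by move=> i; rewrite mem_undup mem_cat => ->.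
have := ind r _ (undup_uniq _) Z l.
rewrite mem_undup mem_cat.
case lt : (l \in t) => /=; case ls : (l \in supp a) => // H.
- by apply/esym/eqP; rewrite -subr_eq0 H.
- by rewrite ca ?ls //; apply/esym; move: (H isT); rewrite subr0.
- by have := H isT; rewrite sub0r => /eqP; rewrite oppr_eq0 => /eqP.
- by rewrite ca ?ls.
Qed.

Lemma torus_str_of : exists X : torus_str n k1 A, tx X = x.
Proof.
have [inv _ gen ind] := xA.
have cfx l m : cf l (x m) = (m == l)%:R.
  rewrite (@cf_uniq (x m) [:: m] (fun _ => 1)) //; last by rewrite big_seq1 scale1r.
  by rewrite inE eq_sym; case: eqP.
have lin l c a b : cf l (c *: a + b) = c * cf l a + cf l b.
  pose r := undup (supp a ++ supp b).
  have ur : uniq r by apply: undup_uniq.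
  have E (a' : A) : {subset supp a' <= r} -> a' = \sum_(l <- r) cf l a' *: x l.
    move=> sr; rewrite {1}[a']cfE0 [RHS](bigID (mem (supp a'))) /=.
    rewrite [X in _ + X]big1 ?addr0; last first.
      move=> i iN; rewrite (cf_uniq _ (cfE0 a')) ?(negPf iN) ?scale0r //.
      by have /and3P[] := xchooseP (expansion_ex a').
    rewrite -[RHS]big_filter; apply: perm_big.
    apply: uniq_perm; rewrite ?filter_uniq //.
      by have /and3P[] := xchooseP (expansion_ex a').
    by move=> i; rewrite mem_filter; case iu: (i \in supp a') => //=; rewrite sr.
  have Ea : a = \sum_(l <- r) cf l a *: x l.
    by apply: E => i; rewrite mem_undup mem_cat => ->.
  have Eb : b = \sum_(l <- r) cf l b *: x l.
    by apply: E => i; rewrite mem_undup mem_cat orbC => ->.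
  have Eab : c *: a + b = \sum_(l <- r) (c * cf l a + cf l b) *: x l.
    rewrite {1}Ea {1}Eb scaler_sumr -big_split; apply: eq_bigr => i _.
    by rewrite scalerA scalerDl.
  have out (a' : A) : {subset supp a' <= r} -> l \notin r -> cf l a' = 0.
    move=> sr lr; rewrite (cf_uniq _ (cfE0 a')); last first.
      by have /and3P[] := xchooseP (expansion_ex a').
    by case: ifP => // /sr; rewrite (negPf lr).
  rewrite (cf_uniq ur Eab); case: ifP => // /negbT lr.
  rewrite !out ?mulr0 ?addr0 // => i; rewrite mem_undup mem_cat => ->; rewrite ?orbT //.
(* [x 0] is an idempotent, since [eps 0 0 = 1], and it has a right inverse. *)
have x00 : x 0 = 1.
  have [y [xy _]] := inv 0.
  have := congr1 (fun u => u * y) (xxM 0 0).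
  by rewrite addr0 eps0l scale1r -mulrA xy mulr1.
have su a : uniq (supp a) by have /and3P[] := xchooseP (expansion_ex a).
have ms a l : (l \in supp a) = (cf l a != 0).
  have /and3P[us /allP nz _] := xchooseP (expansion_ex a).
  apply/idP/idP => [ls|]; last first.
    by apply: contraNT => ls; rewrite (cf_uniq _ (cfE0 a)) // (negPf ls).
  have [u ue ul] := mapP ls.
  have := nz u ue; congr (_ != _).
  rewrite ul /cf -big_filter.
  by rewrite filter_key // big_seq1.
by exists (TorusStr su ms lin cfE0 cfx xxM x00).
Qed.

End TorusOfBasis.

Section TorusTheory.
Variables (k : fieldType) (n k1 : nat) (A : algType k) (X : torus_str n k1 A).
Local Notation L := 'rV[int]_n.
Local Notation x := (tx X).
Local Notation cf := (tcf X).
Local Notation eps := (eps k k1).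

HB.instance Definition _ l := GRing.isLinear.Build k A k^o _ (cf l) (tcf_linear X l).

Lemma cfD l a b : cf l (a + b) = cf l a + cf l b. Proof. exact: linearD. Qed.
Lemma cfN l a : cf l (- a) = - cf l a. Proof. exact: linearN. Qed.
Lemma cfB l a b : cf l (a - b) = cf l a - cf l b. Proof. exact: linearB. Qed.
Lemma cf0 l : cf l 0 = 0. Proof. exact: linear0. Qed.
Lemma cfZ l c a : cf l (c *: a) = c * cf l a. Proof. exact: linearZ. Qed.
Lemma cf_sum l (I : Type) (r : seq I) (P : pred I) (F : I -> A) :
  cf l (\sum_(i <- r | P i) F i) = \sum_(i <- r | P i) cf l (F i).
Proof. exact: linear_sum. Qed.

Lemma cfP a b : (forall l, cf l a = cf l b) -> a = b.
Proof.
move=> E; apply/eqP; rewrite -subr_eq0; apply/eqP.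
rewrite [LHS](tcfE X) big1 // => l _.
by rewrite cfB E subrr scale0r.
Qed.

Lemma cfxx l m : cf l (x m) = (m == l)%:R. Proof. exact: tcf_x. Qed.

Lemma cf_comb (s : seq L) (c : L -> k) l : uniq s ->
  cf l (\sum_(i <- s) c i *: x i) = if l \in s then c l else 0.
Proof.
move=> us; rewrite cf_sum; case: ifP => ls.
  rewrite (bigD1_seq l) //= cfZ cfxx eqxx mulr1 big1 ?addr0 // => i /negPf e.
  by rewrite cfZ cfxx e mulr0.
rewrite big1_seq // => i /andP[_ iS]; rewrite cfZ cfxx.
by case: eqP => [e|]; rewrite ?mulr0 //; move: iS; rewrite e ls.
Qed.

Lemma torus_elem_ind (P : A -> Prop) : P 0 -> (forall a b, P a -> P b -> P (a + b)) ->
  (forall c l, P (c *: x l)) -> forall a, P a.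
Proof. by move=> P0 PD PU a; rewrite (tcfE X a); apply: big_ind. Qed.

Lemma cfMx a l m : cf m (a * x l) = eps (m - l) l * cf (m - l) a.
Proof.
elim/torus_elem_ind: a => [|a b IH1 IH2|c i]; rewrite ?mul0r ?cf0 ?mulr0 //.
  by rewrite mulrDl !cfD IH1 IH2 mulrDr.
rewrite -scalerAl txM !cfZ !cfxx (_ : (i + l == m) = (i == m - l)); last first.
  by rewrite [RHS]eq_sym subr_eq eq_sym.
by case: eqP => [->|]; rewrite ?mulr0 // mulr1 mulrC mulr1.
Qed.

Lemma cfxM a l m : cf m (x l * a) = eps l (m - l) * cf (m - l) a.
Proof.
elim/torus_elem_ind: a => [|a b IH1 IH2|c i]; rewrite ?mulr0 ?cf0 ?mulr0 //.
  by rewrite mulrDr !cfD IH1 IH2 mulrDr.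
rewrite -scalerAr txM !cfZ !cfxx (_ : (l + i == m) = (i == m - l)); last first.
  by rewrite [RHS]eq_sym subr_eq eq_sym addrC.
by case: eqP => [->|]; rewrite ?mulr0 // mulr1 mulrC mulr1.
Qed.

Lemma cfM a b m :
  cf m (a * b) = \sum_(l <- tsupp X a) cf l a * (eps l (m - l) * cf (m - l) b).
Proof.
rewrite {1}(tcfE X a) mulr_suml cf_sum; apply: eq_bigr => l _.
by rewrite -scalerAl cfZ cfxM.
Qed.

Section Lift.
Variables (V : lmodType k) (h : L -> V).

Definition tlift a : V := \sum_(l <- tsupp X a) cf l a *: h l.

Lemma tliftE (s : seq L) a : uniq s -> {subset tsupp X a <= s} ->
  tlift a = \sum_(l <- s) cf l a *: h l.
Proof.
move=> us sub; rewrite /tlift [RHS](bigID (fun l => cf l a != 0)) /=.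
rewrite [X in _ + X]big1 ?addr0 => [|l]; last by rewrite negbK => /eqP ->; rewrite scale0r.
rewrite -[RHS]big_filter; apply: perm_big; apply: uniq_perm.
- exact: tsupp_uniq.
- exact: filter_uniq.
move=> l; rewrite mem_filter -mem_tsupp.
by case la: (l \in tsupp X a) => //=; rewrite (sub _ la).
Qed.

Lemma tlift_linear : linear tlift.
Proof.
move=> c a b.
pose s := undup (tsupp X (c *: a + b) ++ tsupp X a ++ tsupp X b).
have us : uniq s by apply: undup_uniq.
rewrite !(@tliftE s) //; try by move=> i; rewrite mem_undup !mem_cat => ->; rewrite ?orbT.
rewrite scaler_sumr -big_split /=; apply: eq_bigr => l _.
by rewrite cfD cfZ scalerDl scalerA.
Qed.

HB.instance Definition _ := GRing.isLinear.Build k A V _ tlift tlift_linear.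

Lemma tliftx l : tlift (x l) = h l.
Proof.
rewrite (@tliftE [:: l]) ?big_seq1 ?cfxx ?eqxx ?scale1r // => i.
by rewrite mem_tsupp cfxx inE [i == l]eq_sym; case: (l == i) => //=; rewrite eqxx.
Qed.

End Lift.

Lemma linear_ext (V : lmodType k) (f g : {linear A -> V}) :
  (forall l, f (x l) = g (x l)) -> f =1 g.
Proof.
move=> e a; rewrite (tcfE X a) !linear_sum; apply: eq_bigr => l _.
by rewrite !linearZ /= e.
Qed.

(** Substitute for a total order on the degrees: reading a vector as a polynomial and evaluating at
    [B] is additive, and it separates [s] as soon as [B] avoids the roots of the finitely many
    nonzero differences. *)
Lemma separating_int (s : seq L) : exists B : int,
  {in s &, injective (fun l : L => (rVpoly l).[B])}.
Proof.
pose P := \prod_(u <- s) \prod_(v <- s | v != u) rVpoly (u - v).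
have P0 : P != 0.
  rewrite prodf_seq_neq0; apply/allP => u _ /=; rewrite prodf_seq_neq0.
  apply/allP => v _ /=; apply/implyP => uv.
  apply: contraNneq uv => E; rewrite eq_sym -subr_eq0 -(can_eq (@rVpolyK _ n)).
  by rewrite E linear0.
have [B /= PB] : exists B : int, ~~ root P B.
  pose rs := [seq i%:Z | i <- iota 0 (size P)].
  have /allPn[B _ rB] : ~~ all (root P) rs.
    apply/negP => al; have := max_poly_roots P0 al.
    by rewrite map_inj_uniq ?iota_uniq => [/(_ isT)|i j []//]; rewrite size_map size_iota ltnn.
  by exists B.
exists B => u v us vs E; apply/eqP/negPn/negP => uv.
case/negP: PB; rewrite /root horner_prod prodf_seq_eq0; apply/hasP; exists u => //=.
rewrite horner_prod prodf_seq_eq0; apply/hasP; exists v => //=.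
by rewrite eq_sym uv linearB /= hornerD hornerN E subrr.
Qed.

Lemma max_in (f : L -> int) (s : seq L) : s != [::] ->
  exists2 l, l \in s & forall m, m \in s -> f m <= f l.
Proof.
elim: s => // a [|b s] IH _.
  by exists a; rewrite ?inE // => m; rewrite inE => /eqP ->.
have [l ls lm] := IH isT.
have [le|lt] := leP (f a) (f l).
  exists l; first by rewrite inE ls orbT.
  by move=> m; rewrite inE => /orP[/eqP ->|/lm].
exists a; first by rewrite inE eqxx.
move=> m; rewrite inE => /orP[/eqP ->//|/lm] /le_trans; apply; exact: ltW.
Qed.

(** Leading terms: for an additive functional that is injective on the support of [a], the sum of
    two degrees of maximal value is reached by one pair of degrees only, so its coefficient in the
    product does not cancel. *)
Lemma torus_domain (a b : A) : a * b = 0 -> a = 0 \/ b = 0.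
Proof.
move=> ab; case: (eqVneq a 0) => [|a0]; [by left|right].
apply/eqP/negPn/negP => b0.
have sup (c : A) : c != 0 -> tsupp X c != [::].
  by apply: contra_neq => E; rewrite (tcfE X c) E big_nil.
have [B inj] := separating_int (tsupp X a).
pose f (l : L) : int := (rVpoly l).[B].
have fD l m : f (l + m) = f l + f m by rewrite /f linearD hornerD.
have fN l : f (- l) = - f l by rewrite /f linearN hornerN.
have [l ls lmax] := max_in f (sup _ a0).
have [m ms mmax] := max_in f (sup _ b0).
have := congr1 (cf (l + m)) ab; rewrite cf0 cfM (bigD1_seq l) ?tsupp_uniq //=.
rewrite big1_seq ?addr0 => [/eqP|i /andP[il ia]].
  rewrite addrAC subrr add0r !mulf_eq0 (negPf (eps_neq0 _ _ _ _)) /=.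
  by move: ls ms; rewrite !mem_tsupp => /negPf -> /negPf ->.
rewrite (_ : cf (l + m - i) b = 0) ?mulr0 //.
apply/eqP/negPn/negP; rewrite -mem_tsupp => /mmax.
rewrite !fD fN -addrA [_ + (_ - _)]addrCA gerDl subr_le0 => le.
case/negP: il; apply/eqP; apply: inj => //.
by apply/eqP; rewrite eq_le -!/(f _) le lmax.
Qed.

End TorusTheory.

(** Both sides are polynomials in [M] of degree [n], and the hypothesis compares their leading
    coefficients; a large [M] makes the lower terms harmless. *)
Lemma box_growth (n d c N s : nat) : (N * d ^ n < s)%N ->
  exists M, (N * (d * M + 2 * c) ^ n < s * M ^ n)%N.
Proof.
move=> lt.
(* The error term is [C M^(n-1)]; the extra factor [M] on both sides avoids the predecessor of
   [n]. *)
have [C HC] : exists C, forall M, (M * (d * M + 1) ^ n <= M * (d ^ n * M ^ n) + C * M ^ n)%N.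
  elim: n {lt} => [|m [C HC]]; first by exists 0%N => M; rewrite !expn0; lia.
  exists (d * C + d ^ m + C)%N => M.
  rewrite !expnS; have := HC M.
  move: ((d * M + 1) ^ m)%N (M ^ m)%N (d ^ m)%N => E F G H.
  case: M H => [|M] H; first by rewrite !mul0n.
  have := leq_mul (leqnn (d * M.+1 + 1)) H.
  by nia.
pose M := (N * C).+1.
have HM : (N * (d * M + 1) ^ n < s * M ^ n)%N.
  have M0 : (0 < M)%N by [].
  rewrite -(ltn_pmul2l M0).
  have P0 : (0 < M ^ n)%N by rewrite expn_gt0.
  have := leq_mul (leqnn N) (HC M).
  move: (M ^ n)%N (d ^ n)%N ((d * M + 1) ^ n)%N P0 lt => F G E F0 lt H.
  have : (N * C < M)%N by rewrite /M.
  by nia.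
case: c => [|c]; first by exists M; apply: leq_ltn_trans HM; case: (n) => [//|m];
  rewrite leq_mul2l leq_exp2r //; lia.
(* Stretching [M] by the additive constant lets this constant factor out, which reduces to the case
   [d * M + 1] treated above. *)
exists (2 * c.+1 * M)%N.
rewrite (_ : d * (2 * c.+1 * M) + 2 * c.+1 = 2 * c.+1 * (d * M + 1))%N; last by ring.
have : (0 < 2 * c.+1)%N by []; move: (2 * c.+1)%N => q q0.
by rewrite !expnMn mulnCA [(s * _)%N]mulnCA ltn_pmul2l // expn_gt0 q0.
Qed.

Section BoxCounting.
Variables (k : fieldType) (n k1 : nat) (A : algType k) (X : torus_str n k1 A).
Local Notation L := 'rV[int]_n.
Local Notation x := (tx X).
Local Notation cf := (tcf X).

(* A torus has polynomial growth of degree [n]: comparing dimensions over large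
   boxes of [L] forces a relation, with coefficients supported on [d L]. *)
Lemma box_dependence (I J : finType) (w : J -> I -> A) (d : nat) : (0 < d)%N ->
  (#|I| * d ^ n < #|J|)%N ->
  exists a : J -> A, [/\ exists j, a j != 0,
    forall j l, cf l (a j) != 0 -> exists l', l = l' *+ d &
    forall i, \sum_j w j i * a j = 0].
Proof.
move=> d0 lt.
have [c Hc] : exists c : nat, forall j i l t, cf l (w j i) != 0 -> (`|l 0%R t|%N <= c)%N.
  exists (\max_j \max_i \max_(l <- tsupp X (w j i)) \max_t `|(l : L) ord0 t|%N)%N.
  move=> j i l t; rewrite -mem_tsupp => ls.
  apply: leq_trans (leq_bigmax j); apply: leq_trans (leq_bigmax i).
  by apply: leq_trans (leq_bigmax_seq _ ls isT); apply: (leq_bigmax t).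
have [M HM] := box_growth c lt.
(* Unknowns [U]: the coefficient of [a j] at degree [d u], for [u] in a box of side [M]. Equations
   [E]: the coefficient of the [i]-th relation at each degree of a box of side [d M + 2 c] shifted
   by [-c]. As the entries of [w] have degrees bounded by [c], no other degree can occur. *)
pose U := (J * {ffun 'I_n -> 'I_M})%type.
pose E := (I * {ffun 'I_n -> 'I_(d * M + 2 * c)})%type.
pose pu (u : {ffun 'I_n -> 'I_M}) : L := \row_t ((u t : nat)%:Z *+ d).
pose pv (v : {ffun 'I_n -> 'I_(d * M + 2 * c)}) : L := \row_t ((v t : nat)%:Z - c%:Z).
pose W := \matrix_(q < #|{: U}|, e < #|{: E}|)
  cf (pv (enum_val e).2) (w (enum_val q).1 (enum_val e).1 * x (pu (enum_val q).2)).
have : kermx W != 0.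
  rewrite kermx_eq0 /row_free; apply: contraTneq HM => rk.
  have := rank_leq_col W; rewrite rk !card_prod !card_ffun !card_ord.
  by rewrite leqNgt.
case/rowV0Pn => y /sub_kermxP yW y0.
pose a j := \sum_u y 0 (enum_rank ((j, u) : U)) *: x (pu u).
have pu_inj : injective pu.
  move=> u v /rowP e; apply/ffunP => t; apply/val_inj; have := e t; rewrite !mxE.
  by move/eqP; rewrite -subr_eq0 -mulrnBl mulrn_eq0 subr_eq0 eqn0Ngt d0 => /eqP [].
have cfa j u : cf (pu u) (a j) = y 0 (enum_rank ((j, u) : U)).
  rewrite /a cf_sum (bigD1 u) //= cfZ cfxx eqxx mulr1 big1 ?addr0 // => v vu.
  by rewrite cfZ cfxx (inj_eq pu_inj) (negPf vu) mulr0.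
exists a; split.
- have /rV0Pn[q yq] := y0; exists (enum_val q).1.
  apply: contraNneq yq => a0.
  have Eq : enum_rank (((enum_val q).1, (enum_val q).2) : U) = q.
    by rewrite -surjective_pairing enum_valK.
  by rewrite -Eq -cfa a0 cf0.
- move=> j l; rewrite /a cf_sum => nz.
  have [u _ nu] : exists2 u, true & cf l (y 0 (enum_rank ((j, u) : U)) *: x (pu u)) != 0.
    apply/exists_inP; apply: contraNT nz; rewrite negb_exists => /forallP z.
    by apply/eqP; rewrite big1 // => u _; have /negPn/eqP := z u.
  move: nu; rewrite cfZ cfxx; case: (eqVneq (pu u) l) => [<- _|_]; last by rewrite mulr0 eqxx.
  exists (\row_t (u t : nat)%:Z); apply/rowP => t; rewrite !mxE.
  by rewrite -[in RHS](scaler_nat) !mxE mulr_natl.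
move=> i; apply: (cfP (X := X)) => m; rewrite cf0 cf_sum.
rewrite (eq_bigr (fun j => \sum_u y 0 (enum_rank ((j, u) : U)) * cf m (w j i * x (pu u)))); last first.
  move=> j _; rewrite /a mulr_sumr cf_sum; apply: eq_bigr => u _.
  by rewrite -scalerAr cfZ.
rewrite pair_bigA /=.
case: (pickP (fun v => pv v == m)) => [v /eqP vm|nov].
  have /rowP/(_ (enum_rank ((i, v) : E))) := yW; rewrite !mxE => Ev.
  rewrite -[RHS]Ev (reindex (fun q : 'I_#|{: U}| => (enum_val q : U))) /=; last first.
    by apply: onW_bij; apply: enum_val_bij.
  apply: eq_bigr => q _; rewrite !mxE enum_rankK /= vm -surjective_pairing enum_valK //.
rewrite big1 // => [[j u]] _ /=; rewrite cfMx.
case: (eqVneq (cf (m - pu u) (w j i)) 0) => [->|nz]; rewrite ?mulr0 //.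
have bt t : (`|(m 0 t - (u t : nat)%:Z *+ d)%R|%N <= c)%N.
  by have := Hc _ _ _ t nz; rewrite !mxE.
have bu t : (u t * d + d <= d * M)%N.
  by have := ltn_ord (u t); rewrite -mulSnr mulnC leq_mul2l => ->; rewrite orbT.
have vt t : (`|(m 0 t + c%:Z)%R|%N < d * M + 2 * c)%N.
  by have := bt t; have := bu t; move: (m 0 t) => z; lia.
have := nov [ffun t => Ordinal (vt t)]; move/eqP; case; apply/rowP => t.
rewrite !mxE ffunE /=; have := bt t; have := bu t; move: (m 0 t) => z; lia.
Qed.

End BoxCounting.

(** * Nilpotent matrices over a torus *)

(** Independence of eigenvectors for distinct eigenvalues, without division: [D] minus its
    eigenvalue at [j] removes [v j] and multiplies each other [v i] by the nonzero integer
    [2 i - 2 j], which torsion-freeness cancels at the end. *)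
Lemma eigen_indep (V : zmodType) (D : {additive V -> V}) (s : seq nat) (v : nat -> V) :
  (forall (w : V) (z : int), w *~ z = 0 -> z != 0 -> w = 0) ->
  uniq s -> (forall j, D (v j) = v j *+ (2 * j)) ->
  \sum_(j <- s) v j = 0 -> forall j, j \in s -> v j = 0.
Proof.
move=> tf; elim: s v => // j s IH v /= /andP[js us] Dv S.
have vs i : i \in s -> v i = 0.
  move=> iS.
  have /IH : forall i, D (v i *~ ((2 * i)%:Z - (2 * j)%:Z)) = v i *~ ((2 * i)%:Z - (2 * j)%:Z) *+ (2 * i).
    by move=> i'; rewrite raddfMz Dv !pmulrn mulrzAC.
  move/(_ us) => H; apply: (tf _ ((2 * i)%:Z - (2 * j)%:Z)).
    apply: H => //; move: S; rewrite big_cons => S.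
    under eq_bigr do rewrite mulrzBr -!pmulrn -Dv.
    rewrite sumrB -raddf_sum sumrMnl.
    have -> : \sum_(i <- s) v i = - v j by apply/eqP; rewrite -addr_eq0 addrC S.
    by rewrite raddfN Dv mulNrn subrr.
  by rewrite subr_eq0; apply: contraNneq js => -[/eqP]; rewrite eqn_pmul2l // => /eqP <-.
move=> i; rewrite inE => /orP[/eqP ->|]; last exact: vs.
by move: S; rewrite big_cons big1_seq ?addr0 // => ? /andP[_]; apply: vs.
Qed.

Lemma expr_eq0_le (R : pzSemiRingType) (e : R) i j : e ^+ i = 0 -> (i <= j)%N -> e ^+ j = 0.
Proof. by move=> ei /subnK <-; rewrite exprD ei mulr0. Qed.

Section AdPowers.
Variables (R : pzRingType).
Implicit Types e y h : R.

Lemma iter_ad e y t :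
  iter t (fun z => e * z - z * e) y =
  \sum_(i < t.+1) (e ^+ (t - i) * y * (- e) ^+ i) *+ 'C(t, i).
Proof.
elim: t => [|t IH]; first by rewrite big_ord1 subnn bin0 mul1r mulr1.
rewrite iterS IH mulr_sumr mulr_suml -sumrN.
rewrite [in RHS]big_ord_recl [in RHS]big_ord_recr /= !subn0 subnn !bin0 binn.
rewrite (eq_bigr (fun i : 'I_t => (e ^+ (t - i) * y * (- e) ^+ i.+1) *+ 'C(t, i.+1) +
   (e ^+ (t - i) * y * (- e) ^+ i.+1) *+ 'C(t, i))); last first.
  by move=> i _; rewrite -mulrnDr subSS.
rewrite big_split /= big_ord_recl /= subn0 bin0.
rewrite [X in _ + X = _]big_ord_recr /= subnn binn.
rewrite addrACA -!addrA; congr (_ + _); first by rewrite !mulrA exprS.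
rewrite addrCA; congr (_ + (_ + _)).
- by apply: eq_bigr => i _; rewrite mulrnAr !mulrA -exprS subnSK.
- by apply: eq_bigr => i _; rewrite mulrnAl -mulNrn -mulrN -mulrA -exprSr.
by rewrite !mulr1n -mulrN -mulrA -exprSr.
Qed.

Lemma ad_power_eigen h e j : h * e - e * h = e *+ 2 ->
  h * e ^+ j - e ^+ j * h = e ^+ j *+ (2 * j).
Proof.
move=> E; elim: j => [|j IH]; first by rewrite muln0 mulr1 mul1r subrr.
rewrite mulnS mulrnDr exprS.
have -> : h * (e * e ^+ j) - e * e ^+ j * h =
   (h * e - e * h) * e ^+ j + e * (h * e ^+ j - e ^+ j * h).
  by rewrite mulrBl mulrBr !mulrA addrA subrK.
by rewrite E IH mulrnAl mulrnAr.
Qed.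

End AdPowers.

Section Nilpotency.
Variables (k : fieldType) (n k1 : nat) (A : algType k) (X : torus_str n k1 A).
Hypothesis hchar : [pchar k] =i pred0.
Local Notation L := 'rV[int]_n.
Local Notation x := (tx X).
Local Notation cf := (tcf X).
Variable m : nat.
Implicit Types (h e y : 'M[A]_m).

(** The cocycle takes values in signs and is bimultiplicative, so it is trivial on doubled degrees.
    This is why relations with coefficients supported on [2 L] are sought below. *)
Lemma even_central (a b : A) :
  (forall l, cf l a != 0 -> exists l', l = l' *+ 2) -> a * b = b * a.
Proof.
move=> ha; rewrite (tcfE X a) mulr_suml mulr_sumr.
rewrite [LHS]big_seq [RHS]big_seq; apply: eq_bigr => l.
rewrite mem_tsupp => /ha [l' ->]; rewrite -scalerAl -scalerAr; congr (_ *: _).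
apply: (cfP (X := X)) => i; rewrite cfxM cfMx.
have Sl v : eps k k1 (l' *+ 2) v = 1 by rewrite mulr2n epsDl epsS.
have Sr v : eps k k1 v (l' *+ 2) = 1 by rewrite mulr2n epsDr epsS.
by rewrite Sl Sr.
Qed.

Lemma torus_int_torsion_free (a : A) (z : int) : a *~ z = 0 -> z != 0 -> a = 0.
Proof.
move=> az z0; apply: (cfP (X := X)) => l; rewrite cf0.
have := congr1 (cf l) az; rewrite raddfMz /= cf0 -mulrzr => /eqP.
rewrite mulf_eq0 => /orP[/eqP //|].
have/pcharf0P c0 := hchar.
by case: z z0 {az} => z z0; rewrite ?NegzE ?mulrNz ?oppr_eq0 -?pmulrn c0 // => /eqP zz; rewrite zz in z0.
Qed.

(** The powers of [e] are eigenvectors of [ad h] with the distinct eigenvalues [2 j]. Growth yields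
    a nontrivial relation between them with central coefficients, independence makes each term
    [a j *: e ^+ j] vanish, and the torus is a domain. *)
Lemma sl2_nilpotent h e : h * e - e * h = e *+ 2 -> exists j, e ^+ j = 0.
Proof.
(* One equation for each matrix entry, times the index [2 ^ n] of the doubled degrees; the [s.+1]
   powers [e ^+ 0], ..., [e ^+ s] are one too many. *)
move=> E; pose s := (#|{: 'I_m * 'I_m}| * 2 ^ n)%N.
have [|a [[j0 aj0] sa Sa]] := @box_dependence _ _ _ _ X ('I_m * 'I_m)%type 'I_s.+1
  (fun j ab => (e ^+ j) ab.1 ab.2) 2 isT; first by rewrite card_ord.
exists j0; apply/matrixP => i i'; rewrite mxE.
have cen j b : a j * b = b * a j by apply: even_central; apply: sa.
pose v j : 'M[A]_m := if insub j is Some j' then a j' *: e ^+ j else 0.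
pose D (M : 'M[A]_m) : 'M[A]_m := h * M - M * h.
have Dadd : zmod_morphism D.
  by move=> M N; rewrite /D mulrBr mulrBl !opprB addrACA [RHS]addrACA [- (h * N) + _]addrC.
pose Da : {additive 'M[A]_m -> 'M[A]_m} := HB.pack D (GRing.isZmodMorphism.Build _ _ D Dadd).
have Dv j : Da (v j) = v j *+ (2 * j).
  rewrite /= /D /v; case: insubP => [j' _ <-|_]; last by rewrite mulr0 mul0r subrr mul0rn.
  rewrite scalerMnr -(ad_power_eigen j' E) scalerBr; congr (_ - _).
    apply/matrixP => p q; rewrite !mxE mulr_sumr; apply: eq_bigr => t _.
    by rewrite !mxE !mulrA cen.
  exact: esym (scalemxAl _ _ _).
have S0 : \sum_(j <- iota 0 s.+1) v j = 0.
  have -> : iota 0 s.+1 = index_iota 0 s.+1 by rewrite /index_iota subn0.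
  rewrite big_mkord.
  apply/matrixP => p q; rewrite summxE mxE -[RHS](Sa (p, q)).
  by apply: eq_bigr => j _; rewrite /v valK mxE cen.
have tf (w : 'M[A]_m) (z : int) : w *~ z = 0 -> z != 0 -> w = 0.
  move=> wz z0; apply/matrixP => p q; rewrite mxE.
  apply: (@torus_int_torsion_free _ z) => //.
  have := congr1 (fun M : 'M_m => M p q) wz; rewrite mxE => <-.
  by case: (z) => t; rewrite ?NegzE ?mulrNz -!pmulrn ?mxE mulmxnE.
have := eigen_indep tf (iota_uniq _ _) Dv S0 (_ : val j0 \in _).
rewrite mem_iota ltn_ord => /(_ isT); rewrite /v valK => /matrixP/(_ i i').
rewrite !mxE => /(torus_domain X) [z|//].
by rewrite z eqxx in aj0.
Qed.

(** If the nilpotency index [N] exceeded [m], a column on which [e ^+ N.-1] is nonzero would give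
    [N] vectors with [m] coordinates, hence a relation with coefficients on the right. Multiplied on
    the left by the power of [e] that lifts its lowest nonzero term to exponent [N.-1], it loses all
    other terms and contradicts the absence of zero divisors. *)
Lemma nilpotent_index e j : e ^+ j = 0 -> e ^+ m = 0.
Proof.
move=> ej; apply/eqP; apply/negPn/negP => em.
have ex : exists j, e ^+ j == 0 by exists j; apply/eqP.
case: (ex_minnP ex) => N /eqP eN minN.
have mN : (m < N)%N.
  by rewrite ltnNge; apply/negP => Nm; case/eqP: em; apply: expr_eq0_le Nm.
have Np : e ^+ N.-1 != 0.
  by apply/negP => /minN; case: N mN {eN minN} => // N _; rewrite ltnn.
have [[p q] /= epq] : exists pq : 'I_m * 'I_m, (e ^+ N.-1) pq.1 pq.2 != 0.
  apply/existsP; apply: contraNT Np => /existsPn z; apply/eqP/matrixP => p q.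
  by have := z (p, q); rewrite mxE negbK => /eqP.
have [|a [[j0 aj0] _ Sa]] := @box_dependence _ _ _ _ X 'I_m 'I_N
  (fun j i => (e ^+ j) i q) 1 isT; first by rewrite exp1n muln1 !card_ord.
case: (@arg_minnP _ j0 (fun j => a j != 0) (fun j : 'I_N => val j) aj0) => j1 aj1 minj.
have := Sa; pose c := (N.-1 - j1)%N => Sa'.
have S1 : \sum_(j < N) (e ^+ (c + j)) p q * a j = 0.
  under eq_bigr do rewrite exprD mxE mulr_suml.
  rewrite exchange_big big1 //= => t _.
  by under eq_bigr do rewrite -mulrA; rewrite -mulr_sumr Sa' mulr0.
move: S1; rewrite (bigD1 j1) //= big1 ?addr0 => [|j' jj].
  have -> : (c + j1 = N.-1)%N by rewrite /c subnK // -ltnS (ltn_predK mN).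
  by case/(torus_domain X) => z; [rewrite z eqxx in epq|rewrite z eqxx in aj1].
case: (ltngtP j' j1) => [lt|gt|/val_inj /eqP]; last by rewrite (negPf jj).
  suff -> : a j' = 0 by rewrite mulr0.
  by apply/eqP/negPn/negP => /minj; rewrite leqNgt lt.
have le : (N <= c + j')%N.
  by have := ltn_ord j1; rewrite /c; lia.
by rewrite (expr_eq0_le eN le) mxE mul0r.
Qed.

(** In each term [e^(t-i) y (-e)^i] the two exponents add up to at least [2 m - 1], so one of them
    reaches [m]. *)
Lemma sl2_ad_bound h e y t : lie_br h e = e *+ 2 -> (2 * m - 1 <= t)%N ->
  iter t (fun z => lie_br e z) y = 0.
Proof.
move=> E le; have [j ej] := sl2_nilpotent E.
have em := nilpotent_index ej.
have pw i : (m <= i)%N -> e ^+ i = 0 by apply: expr_eq0_le.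
rewrite (iter_ad e y t) big1 // => i _.
case: (leqP m i) => mi.
  by rewrite exprNn (pw i) // mulr0 mulr0 mul0rn.
by rewrite pw ?mul0r ?mul0rn //; lia.
Qed.

End Nilpotency.

(** * Ordered monomials in the generators of a model *)

Definition pairs_of (k0 p : nat) : nat := (k0 + (p == 2))%N.

(** Sign of the involution on the ordered monomial of degree [l]: an involution reverses products,
    and restoring the order costs [qf l l]; the signs of the generators themselves contribute
    [lf]. *)
Definition ssgn (k : fieldType) (n k0 p : nat) (l : 'rV[int]_n) : k :=
  sg k (qf (pairs_of k0 p) l l + lf k0 p l).

Section IntPowers.
Variables (k : fieldType) (A : algType k).
Implicit Types a b t u : A.

Definition scomm (s : int) a b := a * b = sg k s *: (b * a).

Lemma scommC s a b : scomm s a b -> scomm s b a.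
Proof. by rewrite /scomm => ->; rewrite scalerA sgsg scale1r. Qed.

Lemma scomm1 a : scomm 0 a 1.
Proof. by rewrite /scomm mulr1 mul1r scale1r. Qed.

Lemma scommM s1 s2 a b c : scomm s1 a b -> scomm s2 a c -> scomm (s1 + s2) a (b * c).
Proof.
rewrite /scomm => e1 e2; rewrite mulrA e1 -scalerAl -[b * a * c]mulrA e2.
by rewrite -scalerAr scalerA -sgD mulrA.
Qed.

Lemma scommV s a b b' : b * b' = 1 -> b' * b = 1 -> scomm s a b -> scomm s a b'.
Proof.
rewrite /scomm => e1 e2 c.
have : b' * (a * b) * b' = sg k s *: (b' * (b * a) * b') by rewrite c -scalerAr -scalerAl.
rewrite !mulrA e2 mul1r -!mulrA e1 mulr1 => ->.
by rewrite scalerA sgsg scale1r.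
Qed.

Definition zp t u (z : int) : A := if z is Posz m then t ^+ m else u ^+ `|z|%N.

Lemma zp_succ t u z : t * u = 1 -> u * t = 1 -> zp t u (z + 1) = zp t u z * t.
Proof.
move=> tu ut; case: z => m; first by rewrite -PoszD addn1 /= exprSr.
rewrite NegzE; case: m => [|m]; first by rewrite addNr /= ut.
have -> : - (m.+2)%:Z + 1 = - (m.+1)%:Z by lia.
by rewrite -!NegzE /= [in RHS]exprSr -mulrA ut mulr1.
Qed.

Lemma zpD t u z w : t * u = 1 -> u * t = 1 -> zp t u (z + w) = zp t u z * zp t u w.
Proof.
move=> tu ut.
have pred z' : zp t u (z' - 1) = zp t u z' * u.
  by rewrite -[in RHS](subrK 1 z') zp_succ // -mulrA tu mulr1.
elim: w => [|m IH|m IH]; first by rewrite addr0 mulr1.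
  by rewrite -addn1 PoszD addrA zp_succ // IH zp_succ // mulrA.
have -> : - (m.+1)%:Z = - m%:Z - 1 by lia.
by rewrite addrA !pred IH mulrA.
Qed.

Lemma scomm_zp s a t u z : t * u = 1 -> u * t = 1 -> scomm s a t -> scomm (s * z) a (zp t u z).
Proof.
move=> tu ut c.
elim: z => [|m IH|m IH]; first by rewrite mulr0; apply: scomm1.
  rewrite -addn1 PoszD zp_succ // mulrDr mulr1; exact: scommM.
have := scommV tu ut c => c'.
have -> : - (m.+1)%:Z = - m%:Z - 1 by lia.
rewrite zpD // mulrDr; apply: scommM => //.
by rewrite /scomm mulrN1 sgN; move: c'; rewrite /= expr1.
Qed.

End IntPowers.

Section Normalization.
Variables (k : fieldType) (A : algType k) (n k0 p q : nat).
Variables (x : 'rV[int]_n -> A) (inv : A -> A).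
Hypothesis xT : is_torus_inv x inv.
Hypothesis nE : n = (2 * k0 + p + q)%N.
Hypothesis ple : (p <= 2)%N.
Local Notation L := 'rV[int]_n.
Variables (t : 'I_n -> A) (D : 'M[int]_n).
Hypothesis Du : D \in unitmx.
Hypothesis tx : forall i, exists c : k, c != 0 /\ t i = c *: x (row i D).
Hypothesis tC : forall i j : 'I_n, t i * t j = model_comm k k0 p i j *: (t j * t i).
Hypothesis tI : forall i, inv (t i) = model_sign k k0 p i *: t i.
Local Notation k1 := (pairs_of k0 p).

Let invl : forall (c : k) (a b : A), inv (c *: a + b) = c *: inv a + inv b.
Proof. by case: xT => _ []. Qed.
Let invM : forall a b, inv (a * b) = inv b * inv a.
Proof. by case: xT => _ []. Qed.
Let invK : forall a, inv (inv a) = a.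
Proof. by case: xT => _ []. Qed.
Let inv0 : inv 0 = 0.
Proof.
by have := invl (-1) 0 0; rewrite scaler0 addr0 scaleN1r addNr.
Qed.
Let invZ c a : inv (c *: a) = c *: inv a.
Proof. by rewrite -[c *: a]addr0 invl inv0 addr0. Qed.
Let inv1 : inv 1 = 1.
Proof. by have := invM 1 (inv 1); rewrite mul1r !invK mul1r. Qed.

Definition hom (d : L) (a : A) := exists2 c : k, c != 0 & a = c *: x d.

Let xM0 l m : exists2 c : k, c != 0 & x l * x m = c *: x (l + m).
Proof.
have [[xi xm _ _] _] := xT; have [c E] := xm l m; exists c => //.
apply: contra_eq_neq E => ->; rewrite scale0r.
have [y [_ yx]] := xi l; have [z [xz _]] := xi m.
apply/eqP => /(congr1 (fun a => y * a * z)).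
by rewrite mulrA yx mul1r xz mulr0 mul0r => /eqP; rewrite oner_eq0.
Qed.

Let homM d d' a b : hom d a -> hom d' b -> hom (d + d') (a * b).
Proof.
move=> [c c0 ->] [c' c0' ->]; have [e e0 E] := xM0 d d'.
exists (c * (c' * e)); first by rewrite !mulf_neq0.
by rewrite -scalerAl -scalerAr E !scalerA ?mulrA.
Qed.

Let hom1 : hom 0 1.
Proof.
have [c c0 E] := xM0 0 0; rewrite addr0 in E.
have [[xi _ _ _] _] := xT; have [y [xy yx]] := xi 0.
exists c^-1; first by rewrite invr_eq0.
have := congr1 (fun a => y * a) E; rewrite mulrA yx mul1r -scalerAr yx => ->.
by rewrite scalerA mulVf // scale1r.
Qed.

Let homV d a b : hom d a -> a * b = 1 -> hom (- d) b.
Proof.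
move=> ha ab; have hx : hom (- d) (x (- d)) by exists 1; rewrite ?oner_eq0 ?scale1r.
have [c c0 E] := homM hx ha; rewrite addNr in E.
have [e e0 E1] := hom1.
exists (c^-1 * e); first by rewrite mulf_neq0 ?invr_eq0.
have := congr1 (fun y => y * b) E; rewrite -mulrA ab mulr1 => ->.
rewrite -scalerAl !scalerA mulrAC mulVf // mul1r.
by rewrite scalerAl -E1 mul1r.
Qed.

Let tinv i : exists u, t i * u = 1 /\ u * t i = 1.
Proof.
have [c [c0 ->]] := tx i; have [[xi _ _ _] _] := xT; have [y [xy yx]] := xi (row i D).
exists (c^-1 *: y); rewrite -!scalerAl -!scalerAr !scalerA xy yx mulfV // mulVf //.
by rewrite scale1r.
Qed.

Variable u : 'I_n -> A.
Hypothesis tu : forall i, t i * u i = 1 /\ u i * t i = 1.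

Let t' i : A := oapp t 1 (insub i).
Let u' i : A := oapp u 1 (insub i).
Let d' i : L := oapp (fun j => row j D) 0 (insub i).
Let tu' i : t' i * u' i = 1.
Proof. by rewrite /t' /u'; case: insub => [j|] /=; rewrite ?mulr1 //; case: (tu j). Qed.
Let ut' i : u' i * t' i = 1.
Proof. by rewrite /t' /u'; case: insub => [j|] /=; rewrite ?mulr1 //; case: (tu j). Qed.

Let bb i j : int :=
  if [&& i != j, i./2 == j./2 & i < 2 * k1]%N then 1 else 0.

Let tC' i j : scomm (bb i j) (t' i) (t' j).
Proof.
have k1n : (2 * k1 <= n)%N by rewrite nE /pairs_of; case: eqP; lia.
have bbF : ~~ ((i < n) && (j < n))%N -> bb i j = 0.
  by rewrite /bb => nn; case: ifP => // /and3P[_ /eqP e lt]; case/negP: nn; lia.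
rewrite /t'; case: insubP => [i' _ Ei|/negPf lt] /=; last first.
  by rewrite bbF ?lt // /scomm mul1r mulr1 scale1r.
case: insubP => [j' _ Ej|/negPf lt] /=; last first.
  by rewrite bbF ?lt ?andbF // /scomm mul1r mulr1 scale1r.
rewrite /scomm tC /model_comm /bb -Ei -Ej /pairs_of mulnDr.
have -> : (2 * (p == 2) = if p == 2 then 2 else 0)%N by case: eqP.
by case: ifP.
Qed.

Let et i : int := if (i < 2 * k0)%N || ((p == 1%N) && (i == 2 * k0)%N) then 1 else 0.

Let tI' i : (i < n)%N -> inv (t' i) = sg k (et i) *: t' i.
Proof.
move=> ltn_i; rewrite /t' insubT /= tI /model_sign /et /=.
by case: ifP.
Qed.

Let z' i (z : int) := zp (t' i) (u' i) z.
(** The partial monomial in the first [j] generators serves inductions on [j]; [mono n] is the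
    rescaled basis that is wanted. *)
Definition mono j (l : L) : A := \prod_(0 <= i < j) z' i (ent l i).

Let gf j (l m : L) : int :=
  \sum_(0 <= i < j) ent l i * (if odd i && (i < 2 * k1)%N then ent m i.-1 else 0).

(** Among the generators before [j], only the partner [j.-1] of an odd [j] inside a pair fails to
    commute with generator [j]. *)
Let mono_comm j z (m : L) :
  scomm (z * (if odd j && (j < 2 * k1)%N then ent m j.-1 else 0)) (z' j z) (mono j m).
Proof.
suff H i : (i <= j)%N -> scomm (z * (if [&& odd j, j < 2 * k1 & j <= i]%N then ent m j.-1 else 0))
    (z' j z) (mono i m).
  by have := H j (leqnn j); rewrite leqnn andbT.
elim: i => [|i IH] ij.
  rewrite /mono big_geq //.
  rewrite (_ : _ && _ = false) ?mulr0; first exact: scomm1.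
  by case: (j) => [|j'] //=; rewrite !andbF.
rewrite /mono big_nat_recr //=.
have := IH (ltnW ij); rewrite (leqNgt j i) ij !andbF mulr0 => C1.
have C2 := scomm_zp (ent m i) (tu' i) (ut' i) (tC' j i).
have C3 := scommC (scomm_zp z (tu' j) (ut' j) (scommC C2)).
have := scommM C1 C3; congr (scomm _ _ _); rewrite add0r /bb.
rewrite mulrC; congr (_ * _); case: ifP => [/and3P[ne e2 lt2]|].
  have ji : j = i.+1 by lia.
  rewrite mul1r ji in lt2 *; rewrite leqnn lt2 /=.
  have -> : ~~ odd i by lia.
  by [].
rewrite mul0r; case: ifP => // /and3P[oj lt2 le] /negP[].
have ji : j = i.+1 by lia.
by rewrite lt2 ji andbT; lia.
Qed.

Let monoM j l m : mono j l * mono j m = sg k (gf j l m) *: mono j (l + m).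
Proof.
elim: j => [|j IH]; first by rewrite /mono /gf !big_geq // mulr1 scale1r.
rewrite /mono /gf !big_nat_recr //= -/(mono j l) -/(mono j m) -/(mono j (l + m)) -/(gf j l m).
rewrite -mulrA [z' j _ * (_ * _)]mulrA (mono_comm j (ent l j) m).
rewrite -scalerAl -scalerAr -mulrA -zpD // mulrA IH -scalerAl scalerA -sgD.
by rewrite addrC entD.
Qed.

Let inv_zp i z : (i < n)%N -> inv (z' i z) = sg k (et i * z) *: z' i z.
Proof.
move=> lt; rewrite /z'.
have It := tI' lt.
have Iu : inv (u' i) = sg k (et i) *: u' i.
  have := congr1 inv (tu' i); rewrite invM inv1 It -scalerAr => E.
  have := congr1 (fun a => sg k (et i) *: (a * u' i)) E.
  by rewrite -!scalerAl -mulrA tu' mulr1 mul1r scalerA sgsg scale1r.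
have P (a : A) m : inv a = sg k (et i) *: a -> inv (a ^+ m) = sg k (et i * m%:Z) *: a ^+ m.
  move=> Ia; elim: m => [|m IH]; first by rewrite mulr0 scale1r.
  rewrite exprS invM IH Ia -addn1 PoszD mulrDr mulr1 sgD -scalerAl -scalerAr scalerA.
  by rewrite -exprSr exprS.
case: z => m; first exact: P.
by rewrite NegzE /= mulrN sgN; apply: P.
Qed.

Let inv_mono j l : (j <= n)%N ->
  inv (mono j l) = sg k (gf j l l + \sum_(0 <= i < j) et i * ent l i) *: mono j l.
Proof.
elim: j => [|j IH] lt; first by rewrite /mono /gf !big_geq // inv1 scale1r.
rewrite /mono big_nat_recr //= invM -/(mono j l) IH ?(ltnW lt) // inv_zp //.
rewrite -scalerAl -scalerAr (mono_comm j) !scalerA -!sgD; congr (sg _ _ *: _).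
by rewrite /gf !big_nat_recr //= -/(gf j l l); ring.
Qed.

Let mono_hom j l : hom (\sum_(0 <= i < j) d' i *~ ent l i) (mono j l).
Proof.
elim: j => [|j IH]; first by rewrite /mono !big_geq.
rewrite /mono !big_nat_recr //=; apply: homM; first exact: IH.
rewrite /z' /d' /t' /u'; case: insub => [i|] /=; last first.
  by case: ent => m /=; rewrite mul0rz expr1n.
have P d a m : hom d a -> hom (d *+ m) (a ^+ m).
  move=> ha; elim: m => [|m IHm]; first by rewrite mulr0n expr0.
  by rewrite mulrS exprS; apply: homM.
have ht : hom (row i D) (t i) by have [c [c0 ->]] := tx i; exists c.
have hu : hom (- row i D) (u i) by apply: homV ht _; case: (tu i).
case: ent => m /=; first by rewrite -pmulrn; apply: P.
by rewrite NegzE mulrNz -pmulrn -mulNrn; apply: P.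
Qed.

Let gfE l m : gf n l m = qf k1 l m.
Proof.
rewrite /gf /qf.
have k1n : (2 * k1 <= n)%N by rewrite /pairs_of; case: eqP nE; lia.
rewrite (big_cat_nat (leq0n _) k1n) /= [X in _ + X](_ : _ = 0) ?addr0; last first.
  by rewrite big_nat_cond big1 // => i /andP[/andP[le _] _]; rewrite ltnNge le andbF mulr0.
move: (k1) => K; rewrite [LHS]big_nat_cond.
rewrite (eq_bigr (fun i => ent l i * (if odd i then ent m i.-1 else 0))); last first.
  by move=> i /andP[/andP[_ ->] _]; rewrite andbT.
rewrite -big_nat_cond; elim: K => [|K IH]; first by rewrite big_ord0 big_geq.
rewrite mulnS !addSn add0n big_nat_recr // big_nat_recr //= IH big_ord_recr /=.
by rewrite oddM /= mulr0 addr0.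
Qed.

Let etE (l : L) : \sum_(0 <= i < n) et i * ent l i = lf k0 p l.
Proof.
have kn : (2 * k0 <= n)%N by rewrite nE; lia.
rewrite /lf -(big_mkord xpredT (ent l)) (big_cat_nat (leq0n _) kn) /=; congr (_ + _).
  rewrite big_nat_cond [RHS]big_nat_cond; apply: eq_bigr => i /andP[/andP[_ lt] _].
  by rewrite /et lt mul1r.
case: ifP => [/eqP p1|p1].
  rewrite big_ltn; last by rewrite nE p1; lia.
  rewrite big_nat_cond big1 ?addr0; last first.
    by move=> i /andP[/andP[lt _] _]; rewrite /et; case: ifP; rewrite ?mul0r //; lia.
  by rewrite /et p1 !eqxx /= orbT mul1r.
rewrite big_nat_cond big1 // => i /andP[/andP[lt _] _].
by rewrite /et p1 ltnNge lt mul0r.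
Qed.

Let mono0 : mono n 0 = 1.
Proof. by rewrite /mono big1 // => i _; rewrite ent0. Qed.

Let mono_x l : exists c : k, (c != 0) && (mono n l == c *: x (l *m D)).
Proof.
have [c c0 E] := mono_hom n l; exists c; rewrite c0 E; apply/eqP; congr (_ *: x _).
rewrite mulmx_sum_row big_mkord; apply: eq_bigr => i _.
rewrite /d' valK /= entE.
apply/rowP => j; rewrite !mxE; case: (l 0 i) => m.
  by rewrite -pmulrn mulmxnE mxE -natz mulr_natl.
by rewrite NegzE mulrNz -pmulrn mxE mulmxnE mxE mulNr -natz mulr_natl.
Qed.

Lemma mono_mul l m : mono n l * mono n m = eps k k1 l m *: mono n (l + m).
Proof. by rewrite monoM gfE. Qed.

Lemma mono_inv l : inv (mono n l) = ssgn k k0 p l *: mono n l.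
Proof. by rewrite inv_mono // gfE etE. Qed.

(** [mono n l] is a nonzero multiple of [x (l *m D)], and [D] is unimodular, so the monomials are
    the old basis rescaled and relabelled. *)
Lemma mono_assoc_torus : is_assoc_torus (mono n).
Proof.
have [[xi xm xg xf] _] := xT.
pose c l := xchoose (mono_x l).
have c0 l : c l != 0 by have /andP[] := xchooseP (mono_x l).
have cE l : mono n l = c l *: x (l *m D) by have /andP[_ /eqP] := xchooseP (mono_x l).
have cE' l : x l = (c (l *m invmx D))^-1 *: mono n (l *m invmx D).
  by rewrite cE scalerA mulVf // scale1r mulmxKV.
split.
- move=> l; exists (sg k (gf n l (- l)) *: mono n (- l)).
  rewrite -scalerAr -scalerAl !monoM subrr addNr mono0 !scalerA !gfE.
  by rewrite !qfNl !qfNr sgsg !scale1r.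
- by move=> l m; exists (sg k (gf n l m)); apply: monoM.
- move=> a; have [s [b ->]] := xg a.
  exists [seq l *m invmx D | l <- s], (fun l => b (l *m D) * (c l)^-1).
  rewrite big_map; apply: eq_bigr => l _.
  by rewrite mulmxKV // {1}cE' scalerA.
move=> s b us E l ls.
have ud : injective (fun l : L => l *m D) by apply: can_inj (mulmxK Du).
have := xf [seq l *m D | l <- s] (fun l => b (l *m invmx D) * c (l *m invmx D)).
rewrite map_inj_uniq // us big_map => /(_ isT) H.
have /H/(_ (l *m D)) : \sum_(j <- s) (b (j *m D *m invmx D) * c (j *m D *m invmx D)) *: x (j *m D) = 0.
  by rewrite -[RHS]E; apply: eq_bigr => j _; rewrite mulmxK // cE scalerA.
have lD : l *m D \in [seq j *m D | j <- s] by apply/mapP; exists l.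
move/(_ lD); rewrite mulmxK // => /eqP.
by rewrite mulf_eq0 (negPf (c0 _)) orbF => /eqP.
Qed.

End Normalization.

Lemma torus_inv_unit (k : fieldType) (A : algType k) n (x : 'rV[int]_n -> A) inv i
    (t : 'I_n -> A) (D : 'M[int]_n) :
  is_torus_inv x inv -> (exists c : k, c != 0 /\ t i = c *: x (row i D)) ->
  exists u, t i * u = 1 /\ u * t i = 1.
Proof.
move=> xT [c [c0 ->]]; have [[xi _ _ _] _] := xT; have [y [xy yx]] := xi (row i D).
exists (c^-1 *: y); rewrite -!scalerAl -!scalerAr !scalerA xy yx mulfV // mulVf //.
by rewrite scale1r.
Qed.

(** Passage from the presentation by generators to normalized coordinates: both the product and the
    involution become explicit functions of the exponents, determined by [n], [k0] and [p]. *)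
Lemma model_torus_str (k : fieldType) (A : algType k) n (x : 'rV[int]_n -> A) inv k0 p q :
  is_torus_inv x inv -> is_model x inv k0 p q -> (p <= 2)%N ->
  n = (2 * k0 + p + q)%N /\ exists X : torus_str n (pairs_of k0 p) A,
    forall l, inv (tx X l) = ssgn k k0 p l *: tx X l.
Proof.
move=> xT [nE [t [D [Du tx tC tI]]]] ple; split=> //.
have [u tu] := fin_all_exists (fun i => torus_inv_unit xT (tx i)).
have aT : is_assoc_torus (mono t u n).
  by apply: mono_assoc_torus; eassumption.
have mM : forall l m, mono t u n l * mono t u n m = eps k (pairs_of k0 p) l m *: mono t u n (l + m).
  by apply: mono_mul; eassumption.
have [X EX] := torus_str_of aT mM.
by exists X => l; rewrite EX; apply: mono_inv; eassumption.
Qed.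

(** The sign is a quadratic character, and its polar form is the commutation sign. *)
Lemma ssgnD (k : fieldType) n k0 p (l m : 'rV[int]_n) :
  ssgn k k0 p (l + m) =
  ssgn k k0 p l * ssgn k k0 p m * eps k (pairs_of k0 p) l m * eps k (pairs_of k0 p) m l.
Proof.
rewrite /ssgn /eps -!sgD; congr (sg _ _).
by rewrite qfDl !qfDr lfD; ring.
Qed.

Lemma ssgnS (k : fieldType) n k0 p (l : 'rV[int]_n) : ssgn k k0 p l * ssgn k k0 p l = 1.
Proof. exact: sgsg. Qed.

Lemma ssgn0 (k : fieldType) n k0 p : ssgn k k0 p (0 : 'rV[int]_n) = 1.
Proof. by rewrite /ssgn qf0l lf0 addr0. Qed.

Lemma qf_delta n k1 (i j : 'I_n) :
  qf k1 (row i (1%:M : 'M[int]_n)) (row j 1%:M) =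
  if [&& odd i, (j == i.-1 :> nat) & (i < 2 * k1)%N] then 1 else 0.
Proof.
have E (i' : 'I_n) a : ent (row i' (1%:M : 'M[int]_n)) a = (i' == a :> nat)%:R.
  rewrite /ent; case: insubP => [a' _ <-|] /=; first by rewrite !mxE.
  by case: eqP => // <-; rewrite ltn_ord.
rewrite /qf; case: ifP => [/and3P[oi /eqP ji lt]|C].
  have iE : (i : nat) = (2 * i./2).+1.
    by rewrite -[LHS]odd_double_half oi add1n mul2n.
  have ha : (i./2 < k1)%N.
    by rewrite -(ltn_pmul2l (isT : 0 < 2)%N); move: lt; rewrite {1}iE; apply: ltn_trans.
  rewrite (bigD1 (Ordinal ha)) //= big1 ?addr0 => [|a /eqP ne].
    by rewrite !E ji -iE eqxx {1}iE /= eqxx.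
  rewrite E; case: eqP => [ia|]; rewrite ?mul0r //.
  by case: ne; apply: val_inj; rewrite /= ia /= mul2n uphalf_double.
rewrite big1 // => a _; rewrite !E; case: eqP => [ia|]; rewrite ?mul0r //.
case: eqP => [ja|]; rewrite ?mulr0 //; case/negP: C.
rewrite ia ja /= oddM /= eqxx /=.
by move: (nat_of_ord a) (ltn_ord a) => a' la; clear -la; lia.
Qed.

Lemma lf_delta n k0 p (i : 'I_n) :
  lf k0 p (row i (1%:M : 'M[int]_n)) =
  if (i < 2 * k0)%N || ((p == 1%N) && (i == 2 * k0 :> nat)%N) then 1 else 0.
Proof.
have E (i' : 'I_n) a : ent (row i' (1%:M : 'M[int]_n)) a = (i' == a :> nat)%:R.
  rewrite /ent; case: insubP => [a' _ <-|] /=; first by rewrite !mxE.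
  by case: eqP => // <-; rewrite ltn_ord.
rewrite /lf E; case: ltnP => lt /=.
  rewrite (bigD1 (Ordinal lt)) //= big1 ?addr0 => [|a /eqP ne].
    by rewrite E eqxx (ltn_eqF lt); case: (p == 1%N); rewrite addr0.
  by rewrite E; case: eqP => // e; case: ne; apply: val_inj.
rewrite big1 ?add0r => [|a _]; first by case: (p == 1%N); case: (_ == _).
by rewrite E; case: eqP => // e; move: (ltn_ord a); rewrite -e ltnNge lt.
Qed.

Section StandardInvolution.
Variables (k : fieldType) (n k0 p q : nat) (A : algType k).
Local Notation k1 := (pairs_of k0 p).
Variable (X : torus_str n k1 A).
Local Notation x := (tx X).
Local Notation s := (ssgn k k0 p).

Definition tinv : A -> A := tlift X (fun l => s l *: x l).
HB.instance Definition _ := GRing.Linear.on tinv.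

Lemma tinvx l : tinv (x l) = s l *: x l. Proof. exact: tliftx. Qed.

Lemma tinvM a b : tinv (a * b) = tinv b * tinv a.
Proof.
elim/(torus_elem_ind (X := X)): a => [|a1 a2 IH1 IH2|c l].
- by rewrite mul0r linear0 mulr0.
- by rewrite mulrDl !linearD mulrDr /= IH1 IH2.
elim/(torus_elem_ind (X := X)): b => [|a1 a2 IH1 IH2|d m].
- by rewrite mulr0 linear0 mul0r.
- by rewrite mulrDr !linearD mulrDl /= IH1 IH2.
rewrite -scalerAl -scalerAr txM !linearZ /= !tinvx -!scalerAl -!scalerAr txM.
rewrite !scalerA addrC ssgnD; congr (_ *: _).
set u := eps k k1 l m; set v := eps _ _ m l.
have u2 : u * u = 1 by apply: epsS.
by rewrite -[RHS]mulr1 -u2; ring.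
Qed.

Lemma tinvK a : tinv (tinv a) = a.
Proof.
elim/(torus_elem_ind (X := X)): a => [|a1 a2 IH1 IH2|c l].
- by rewrite !linear0.
- by rewrite !linearD /= IH1 IH2.
by rewrite !linearZ /= tinvx linearZ /= tinvx !scalerA -mulrA ssgnS mulr1.
Qed.

Lemma torus_str_torus : is_assoc_torus x.
Proof.
split.
- move=> l; exists (eps k k1 l l *: x (- l)).
  rewrite -scalerAr -scalerAl !txM epsNl epsNr subrr addNr tx0 !scalerA epsS !scale1r.
  by split.
- by move=> l m; exists (eps k k1 l m); rewrite txM.
- by move=> a; exists (tsupp X a), (fun l => tcf X l a); apply: tcfE.
by move=> r c ur E l lr; have := cf_comb X c l ur; rewrite E cf0 lr.
Qed.

Lemma tinv_torus_inv : is_torus_inv x tinv.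
Proof.
split; first exact: torus_str_torus.
split.
- exact: linearP.
- exact: tinvM.
- exact: tinvK.
by move=> l; exists (s l); apply: tinvx.
Qed.

Lemma tinv_model : n = (2 * k0 + p + q)%N -> is_model x tinv k0 p q.
Proof.
move=> nE; split=> //.
exists (fun i => x (row i 1%:M)), 1%:M; split.
- exact: unitmx1.
- by move=> i; exists 1; rewrite oner_eq0 scale1r.
- move=> i j; rewrite !txM scalerA addrC; congr (_ *: _).
  rewrite -[LHS]mulr1 -(epsS k k1 (row j 1%:M) (row i 1%:M)) mulrA; congr (_ * _).
  rewrite /eps -sgD !qf_delta /model_comm.
  have -> : (2 * k0 + (if p == 2 then 2 else 0) = 2 * k1)%N.
    by rewrite /pairs_of mulnDr; case: eqP.
  case: ifP => c1; case: ifP => c2; case: ifP => c3 //; exfalso; lia.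
move=> i; rewrite tinvx /ssgn qf_delta lf_delta /model_sign; congr (_ *: _).
case: ifP => [|_]; last by case: ifP.
by lia.
Qed.

Lemma inv_tinv inv : (forall (c : k) a b, inv (c *: a + b) = c *: inv a + inv b) ->
  (forall l, inv (x l) = s l *: x l) -> inv =1 tinv.
Proof.
move=> il ix.
pose f : {linear A -> A} := HB.pack inv (GRing.isLinear.Build k A A _ inv il).
by apply: (@linear_ext _ _ _ _ X A f tinv) => l; rewrite /= ix tinvx.
Qed.

End StandardInvolution.

Section TorusIso.
Variables (k : fieldType) (n k1 : nat) (A B : algType k).
Variables (X : torus_str n k1 A) (Y : torus_str n k1 B).

Definition tiso : A -> B := tlift X (tx Y).
HB.instance Definition _ := GRing.Linear.on tiso.

Lemma tisox l : tiso (tx X l) = tx Y l. Proof. exact: tliftx. Qed.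

Lemma tisoM a b : tiso (a * b) = tiso a * tiso b.
Proof.
elim/(torus_elem_ind (X := X)): a => [|a1 a2 IH1 IH2|c l].
- by rewrite mul0r linear0 mul0r.
- by rewrite mulrDl !linearD mulrDl /= IH1 IH2.
elim/(torus_elem_ind (X := X)): b => [|a1 a2 IH1 IH2|d m].
- by rewrite mulr0 linear0 mulr0.
- by rewrite mulrDr !linearD mulrDr /= IH1 IH2.
by rewrite -scalerAl -scalerAr txM !linearZ /= !tisox -!scalerAl -!scalerAr txM.
Qed.

End TorusIso.

Lemma tisoK (k : fieldType) (n k1 : nat) (A B : algType k)
    (X : torus_str n k1 A) (Y : torus_str n k1 B) : cancel (tiso X Y) (tiso Y X).
Proof.
move=> a; elim/(torus_elem_ind (X := X)): a => [|a1 a2 IH1 IH2|c l].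
- by rewrite !linear0.
- by rewrite !linearD /= IH1 IH2.
by rewrite !linearZ /= !tisox.
Qed.

Lemma qtorus_str (k : fieldType) n k1 : exists X : torus_str n k1 (qtorus k n k1), True.
Proof.
have [X _] := torus_str_of (@qtorus_assoc_torus k n k1) (@xxM k n k1).
by exists X.
Qed.

Lemma tcf_tiso (k : fieldType) (n k1 : nat) (A B : algType k)
    (X : torus_str n k1 A) (Y : torus_str n k1 B) a l : tcf Y l (tiso X Y a) = tcf X l a.
Proof.
elim/(torus_elem_ind (X := X)): a => [|a1 a2 IH1 IH2|c i].
- by rewrite linear0 !cf0.
- by rewrite linearD !cfD /= IH1 IH2.
by rewrite linearZ /= tisox !cfZ !cfxx.
Qed.

(** * Skew matrices over a torus and the derived algebra *)

Section Derived.
Variables (k : fieldType) (A : algType k) (m : nat).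
Implicit Types (S : 'M[A]_m -> Prop) (M N : 'M[A]_m).

Lemma mxscaleE c M : mxscale c M = c%:A *: M.
Proof. by apply/matrixP => i j; rewrite !mxE -scalerAl mul1r. Qed.

Lemma mxscale_ij c M i j : mxscale c M i j = c *: M i j.
Proof. by rewrite mxE. Qed.

Lemma mxscaleD c M N : mxscale c (M + N) = mxscale c M + mxscale c N.
Proof. by rewrite !mxscaleE scalerDr. Qed.

Lemma mxscaleA c d M : mxscale c (mxscale d M) = mxscale (c * d) M.
Proof. by apply/matrixP => i j; rewrite !mxE scalerA. Qed.

Lemma mxscale1 M : mxscale 1 M = M.
Proof. by apply/matrixP => i j; rewrite !mxE scale1r. Qed.

Lemma mxscaler0 c : mxscale c (0 : 'M[A]_m) = 0.
Proof. by apply/matrixP => i j; rewrite !mxE scaler0. Qed.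

Lemma mxscaleN1 M : mxscale (-1) M = - M.
Proof. by apply/matrixP => i j; rewrite !mxE scaleN1r. Qed.

Lemma mxscale_sum c (I : Type) (s : seq I) (P : pred I) (F : I -> 'M[A]_m) :
  mxscale c (\sum_(i <- s | P i) F i) = \sum_(i <- s | P i) mxscale c (F i).
Proof. by rewrite mxscaleE scaler_sumr; apply: eq_bigr => i _; rewrite mxscaleE. Qed.

Lemma derived0 S : derived S 0.
Proof. by exists [::]; split=> //; rewrite big_nil. Qed.

Lemma derivedD S M N : derived S M -> derived S N -> derived S (M + N).
Proof.
move=> [s [Hs ->]] [t [Ht ->]]; exists (s ++ t); split; last by rewrite big_cat.
by move=> u; rewrite mem_cat => /orP[/Hs|/Ht].
Qed.

Lemma derivedZ S c M : derived S M -> derived S (mxscale c M).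
Proof.
move=> [s [Hs ->]]; exists [seq (c * u.1.1, u.1.2, u.2) | u <- s]; split.
  by move=> u /mapP[v /Hs Hv ->].
by rewrite mxscale_sum big_map; apply: eq_bigr => u _; rewrite mxscaleA.
Qed.

Lemma derived_sum S (I : eqType) (s : seq I) (P : pred I) (F : I -> 'M[A]_m) :
  (forall i, i \in s -> P i -> derived S (F i)) -> derived S (\sum_(i <- s | P i) F i).
Proof.
move=> H; rewrite big_seq_cond; apply: big_ind => [|? ?|i /andP[]].
- exact: derived0.
- exact: derivedD.
exact: H.
Qed.

Lemma derived_br S M N : S M -> S N -> derived S (lie_br M N).
Proof.
move=> SM SN; exists [:: (1, M, N)]; rewrite big_seq1 mxscale1; split=> //.
by move=> u; rewrite inE => /eqP ->.
Qed.

Lemma derived_scaled S c M : c != 0 -> derived S (mxscale c M) -> derived S M.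
Proof. by move=> c0 /(derivedZ c^-1); rewrite mxscaleA mulVf // mxscale1. Qed.

End Derived.

Section Homogeneous.
Variables (k : fieldType) (n k1 : nat) (A : algType k) (X : torus_str n k1 A) (m : nat).
Local Notation L := 'rV[int]_n.
Local Notation x := (tx X).
Local Notation cf := (tcf X).
Local Notation eps := (eps k k1).
Implicit Types (M : 'M[A]_m) (N : 'M[k]_m) (l : L).

Definition mcf l M : 'M[k]_m := map_mx (cf l) M.
Definition hx N l : 'M[A]_m := map_mx (fun c => c *: x l) N.

Lemma hxE N l i j : hx N l i j = N i j *: x l.
Proof. by rewrite mxE. Qed.

Lemma mcfE l M i j : mcf l M i j = cf l (M i j).
Proof. by rewrite mxE. Qed.

Lemma mcfD l M M' : mcf l (M + M') = mcf l M + mcf l M'.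
Proof. by apply/matrixP => i j; rewrite !mxE cfD. Qed.
Lemma mcf0 l : mcf l 0 = 0.
Proof. by apply/matrixP => i j; rewrite !mxE cf0. Qed.
Lemma mcfN l M : mcf l (- M) = - mcf l M.
Proof. by apply/matrixP => i j; rewrite !mxE cfN. Qed.
Lemma mcfZ l c M : mcf l (mxscale c M) = c *: mcf l M.
Proof. by apply/matrixP => i j; rewrite !mxE cfZ. Qed.
Lemma mcf_sum l (I : Type) (s : seq I) (P : pred I) (F : I -> 'M[A]_m) :
  mcf l (\sum_(i <- s | P i) F i) = \sum_(i <- s | P i) mcf l (F i).
Proof. exact: (big_morph (mcf l) (mcfD l) (mcf0 l)). Qed.

Lemma mcfP M M' : (forall l, mcf l M = mcf l M') -> M = M'.
Proof.
move=> e; apply/matrixP => i j; apply: (cfP (X := X)) => l.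
by have /matrixP/(_ i j) := e l; rewrite !mxE.
Qed.

Lemma mcf_hx l l' N : mcf l (hx N l') = if l' == l then N else 0.
Proof.
apply/matrixP => i j; rewrite !mxE cfZ cfxx; case: eqP => _; rewrite ?mulr1 //.
by rewrite mulr0 mxE.
Qed.

Lemma hxD N N' l : hx (N + N') l = hx N l + hx N' l.
Proof. by apply/matrixP => i j; rewrite !mxE scalerDl. Qed.
Lemma hx0 l : hx 0 l = 0.
Proof. by apply/matrixP => i j; rewrite !mxE scale0r. Qed.
Lemma hxN N l : hx (- N) l = - hx N l.
Proof. by apply/matrixP => i j; rewrite !mxE scaleNr. Qed.
Lemma hxZ c N l : hx (c *: N) l = mxscale c (hx N l).
Proof. by apply/matrixP => i j; rewrite !mxE scalerA. Qed.
Lemma hx_sum l (I : Type) (s : seq I) (P : pred I) (F : I -> 'M[k]_m) :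
  hx (\sum_(i <- s | P i) F i) l = \sum_(i <- s | P i) hx (F i) l.
Proof. exact: (big_morph (fun N => hx N l) (fun N N' => hxD N N' l) (hx0 l)). Qed.

Lemma hxM N N' l l' : hx N l *m hx N' l' = hx (eps l l' *: (N *m N')) (l + l').
Proof.
apply/matrixP => i j; rewrite !mxE mulr_sumr scaler_suml; apply: eq_bigr => t _.
by rewrite !mxE -scalerAl -scalerAr txM !scalerA; congr (_ *: _); ring.
Qed.

Lemma hx_br N N' l l' : lie_br (hx N l) (hx N' l') =
  hx (eps l l' *: (N *m N') - eps l' l *: (N' *m N)) (l + l').
Proof. by rewrite /lie_br !hxM [l' + l]addrC hxD hxN. Qed.

Lemma hx_br0 N N' l : lie_br (hx N 0) (hx N' l) = hx (N *m N' - N' *m N) l.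
Proof. by rewrite hx_br eps0l eps0r !scale1r add0r. Qed.

Lemma hx_decomp M : exists s : seq L, M = \sum_(l <- s) hx (mcf l M) l.
Proof.
exists (undup (flatten [seq tsupp X (M ij.1 ij.2) | ij <- enum {: 'I_m * 'I_m}])).
set s := undup _; have us : uniq s by apply: undup_uniq.
apply/matrixP => i j; rewrite summxE.
have Es : {subset tsupp X (M i j) <= s}.
  move=> l li; rewrite mem_undup; apply/flattenP; exists (tsupp X (M i j)) => //.
  by apply/mapP; exists (i, j); rewrite ?mem_enum.
apply: (cfP (X := X)) => l; rewrite cf_sum.
rewrite (eq_bigr (fun i0 => cf l (cf i0 (M i j) *: x i0))); last by move=> l' _; rewrite !mxE.
rewrite -cf_sum cf_comb //; case: ifP => // /negbT ls.
by apply/eqP; apply: contraNT ls => nz; apply: Es; rewrite mem_tsupp.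
Qed.

Lemma diag_br (d : 'I_m -> k) M i j :
  lie_br (hx (diag_mx (\row_t d t)) 0) M i j = (d i - d j) *: M i j.
Proof.
rewrite /lie_br !mxE (bigD1 i) //= big1 ?addr0 => [|t /negPf ti]; last first.
  by rewrite !mxE eq_sym ti mulr0n scale0r mul0r.
rewrite (bigD1 j) //= big1 ?addr0 => [|t /negPf tj]; last first.
  by rewrite !mxE tj mulr0n scale0r mulr0.
by rewrite !mxE !eqxx !mulr1n tx0 -scalerAl -scalerAr mul1r mulr1 scalerBl.
Qed.

End Homogeneous.

(** The degrees of central monomials, in coordinates and hence decidable; [radP] gives the intrinsic
    meaning. *)
Definition radb n (k1 : nat) (l : 'rV[int]_n) : bool :=
  [forall a : 'I_k1, ~~ odd `|ent l (2 * a)|%N && ~~ odd `|ent l (2 * a).+1|%N].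

Section Radical.
Variables (k : fieldType) (n k1 : nat).
Hypothesis hchar : [pchar k] =i pred0.
Hypothesis k1n : (2 * k1 <= n)%N.
Local Notation L := 'rV[int]_n.
Local Notation eps := (eps k k1).

Lemma nat_neq0 m : (0 < m)%N -> m%:R != 0 :> k.
Proof. by case: m => // m _; have/pcharf0P -> := hchar. Qed.

Lemma two_neq0 : 2 != 0 :> k. Proof. exact: nat_neq0. Qed.

Lemma eq_opp_0 (a : k) : a = - a -> a = 0.
Proof.
move/eqP; rewrite -subr_eq0 opprK -mulr2n -mulr_natl mulf_eq0 (negPf two_neq0).
by move/eqP.
Qed.

Lemma sg_eq1 z : (sg k z == 1) = ~~ odd `|z|%N.
Proof.
rewrite sg_odd; case: (odd _); rewrite /= ?eqxx //.
apply/negP => /eqP; rewrite expr1 => e; have := oner_neq0 k.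
by rewrite (@eq_opp_0 1) ?eqxx.
Qed.

Lemma sg_even z : ~~ odd `|z|%N -> sg k z = 1.
Proof. by rewrite -sg_eq1 => /eqP. Qed.

(** When one exponent of a pair is odd, the partner generator anticommutes with [x l]. *)
Lemma not_rad (l : L) : ~~ radb k1 l -> exists m, eps l m = - eps m l.
Proof.
move=> nr; have [a] : exists a : 'I_k1, ~~ (~~ odd `|ent l (2 * a)|%N && ~~ odd `|ent l (2 * a).+1|%N).
  by apply/existsP; rewrite -negb_forall.
rewrite negb_and !negbK => ho.
have E (i : 'I_n) b : ent (row i (1%:M : 'M[int]_n)) b = (i == b :> nat)%:R.
  rewrite /ent; case: insubP => [b' _ <-|] /=; first by rewrite !mxE.
  by case: eqP => // <-; rewrite ltn_ord.
have lt0 : (2 * a < n)%N by have := ltn_ord a; lia.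
have lt1 : ((2 * a).+1 < n)%N by have := ltn_ord a; lia.
have S z : odd `|z|%N -> sg k z = -1 by rewrite sg_odd => ->.
case/orP: ho => od.
  exists (row (Ordinal lt1) 1%:M); rewrite /eps.
  have -> : qf k1 l (row (Ordinal lt1) 1%:M) = 0.
    by rewrite /qf big1 // => b _; rewrite E /=; case: eqP => [e|]; rewrite ?mulr0 //; lia.
  have -> : qf k1 (row (Ordinal lt1) 1%:M) l = ent l (2 * a).
    rewrite /qf (bigD1 a) //= E eqxx mul1r big1 ?addr0 // => b ba.
    rewrite E /=; case: eqP => [[e]|]; rewrite ?mul0r //; case/eqP: ba; apply: val_inj => /=; lia.
  by rewrite (S _ od) opprK.
exists (row (Ordinal lt0) 1%:M); rewrite /eps.
have -> : qf k1 l (row (Ordinal lt0) 1%:M) = ent l (2 * a).+1.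
  rewrite /qf (bigD1 a) //= E eqxx mulr1 big1 ?addr0 // => b ba.
  rewrite E /=; case: eqP => [e|]; rewrite ?mulr0 //; case/eqP: ba; apply: val_inj => /=; lia.
have -> : qf k1 (row (Ordinal lt0) 1%:M) l = 0.
  by rewrite /qf big1 // => b _; rewrite E /=; case: eqP => [e|]; rewrite ?mul0r //; lia.
by rewrite (S _ od).
Qed.

Lemma radP (l : L) : reflect (forall m, eps l m = eps m l) (radb k1 l).
Proof.
apply: (iffP idP) => [/forallP h m|h].
  rewrite /eps /qf !(big_morph (sg k) (sgD k) (sg0 k)); apply: eq_bigr => a _.
  have /andP[h0 h1] := h a.
  by rewrite !sg_even // abszM oddM ?(negPf h0) ?(negPf h1) ?andbF.
apply/negPn/negP => /not_rad[m]; rewrite h => /eq_opp_0 /eqP.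
by rewrite (negPf (eps_neq0 _ _ _ _)).
Qed.

End Radical.

Section SkewMatrices.
Variables (k : fieldType) (n k0 p : nat) (A : algType k).
Local Notation k1 := (pairs_of k0 p).
Variable (X : torus_str n k1 A).
Hypothesis hchar : [pchar k] =i pred0.
Hypothesis k1n : (2 * k1 <= n)%N.
Variables (r : nat) (tau : k).
Hypothesis tau2 : tau * tau = 1.
Local Notation L := 'rV[int]_n.
Local Notation m := (r + r)%N.
Local Notation x := (tx X).
Local Notation cf := (tcf X).
Local Notation eps := (eps k k1).
Local Notation s := (ssgn k k0 p).
Implicit Types (M : 'M[A]_m) (N : 'M[k]_m) (l : L) (i j : 'I_m).

Lemma cf_tinv l a : cf l (tinv X a) = s l * cf l a.
Proof.
elim/(torus_elem_ind (X := X)): a => [|a1 a2 IH1 IH2|c i].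
- by rewrite linear0 cf0 mulr0.
- by rewrite linearD !cfD /= IH1 IH2 mulrDr.
rewrite linearZ /= tinvx !cfZ !cfxx; case: eqP => [->|]; rewrite ?mulr0 //.
by rewrite !mulr1 mulrC.
Qed.

(** With [tau = -1] the map [adj] below is the adjoint for the symplectic matrix [Gmx], with
    [tau = 1] the one for the antidiagonal [Jmx]; the two families share all arguments that need
    only [tau * tau = 1]. *)
Definition sig i : k := if (i < r)%N then 1 else tau.

Lemma sigS i : sig i * sig i = 1.
Proof. by rewrite /sig; case: ifP; rewrite ?mulr1. Qed.

Lemma sig_rev i : sig (rev_ord i) = tau * sig i.
Proof.
rewrite /sig /=; case: (ltnP i r) => h; last first.
  by rewrite tau2 (_ : (_ < r)%N) //; have := ltn_ord i; clear -h; lia.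
by rewrite mulr1 ltnNge (_ : (r <= _)%N) //; have := ltn_ord i; clear -h; lia.
Qed.

Definition adj M : 'M[A]_m :=
  \matrix_(i, j) ((sig i * sig j) *: tinv X (M (rev_ord j) (rev_ord i))).

Definition adjk (c : k) N : 'M[k]_m :=
  \matrix_(i, j) ((sig i * sig j * c) * N (rev_ord j) (rev_ord i)).

Lemma mcf_adj l M : mcf X l (adj M) = adjk (s l) (mcf X l M).
Proof. by apply/matrixP => i j; rewrite !mxE cfZ cf_tinv mulrA. Qed.

Lemma adjM M M' : adj (M *m M') = adj M' *m adj M.
Proof.
apply/matrixP => i j; rewrite !mxE (linear_sum (tinv X)) scaler_sumr (reindex_inj rev_ord_inj) /=.
apply: eq_bigr => t _; rewrite !mxE tinvM -scalerAl -scalerAr scalerA.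
congr (_ *: _).
have -> : sig i * sig t * (sig t * sig j) = sig i * (sig t * sig t) * sig j by ring.
by rewrite sigS mulr1.
Qed.

Lemma adjD M M' : adj (M + M') = adj M + adj M'.
Proof. by apply/matrixP => i j; rewrite !mxE linearD scalerDr. Qed.

Lemma adjN M : adj (- M) = - adj M.
Proof. by apply/matrixP => i j; rewrite !mxE linearN scalerN. Qed.

Lemma adjZ c M : adj (mxscale c M) = mxscale c (adj M).
Proof. by apply/matrixP => i j; rewrite !mxE linearZ /= !scalerA mulrC. Qed.

Definition skA M : Prop := adj M = - M.
Definition skk c N : Prop := adjk c N = - N.

Lemma skAP M : skA M <-> forall l, skk (s l) (mcf X l M).
Proof.
split=> [h l|h]; first by rewrite /skk -mcf_adj h mcfN.
by apply: (mcfP (X := X)) => l; rewrite mcf_adj h mcfN.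
Qed.

Lemma skA_br M M' : skA M -> skA M' -> skA (lie_br M M').
Proof.
rewrite /skA /lie_br => h h'.
by rewrite adjD adjN !adjM h h' !mulNmx !mulmxN !opprK opprB.
Qed.

Lemma skAD M M' : skA M -> skA M' -> skA (M + M').
Proof. by rewrite /skA adjD => -> ->; rewrite opprD. Qed.

Lemma skAZ c M : skA M -> skA (mxscale c M).
Proof. by rewrite /skA adjZ => ->; apply/matrixP => i j; rewrite !mxE scalerN. Qed.

Lemma skA0 : skA 0.
Proof. by apply/matrixP => i j; rewrite !mxE linear0 scaler0 oppr0. Qed.

(** Explicit form of the derived algebra. The commutators of the torus span the components outside
    the radical, so the radical part of the trace is what obstructs being a sum of brackets. *)
Definition Lx M : Prop := skA M /\ forall l, radb k1 l -> cf l (\tr M) = 0.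

Lemma cf_tr l M : cf l (\tr M) = \tr (mcf X l M).
Proof. by rewrite /mxtrace cf_sum; apply: eq_bigr => i _; rewrite mxE. Qed.

Lemma LxP M : Lx M <->
  forall l, skk (s l) (mcf X l M) /\ (radb k1 l -> \tr (mcf X l M) = 0).
Proof.
split=> [[/skAP h t] l|h]; first by split=> // /t; rewrite cf_tr.
split; first by apply/skAP => l; case: (h l).
by move=> l rl; rewrite cf_tr; case: (h l) => _; apply.
Qed.

(** If [i + j = l] with [l] radical, then [eps i j] and [eps j i] agree: replace [j] by [l - i] in
    both. *)
Lemma cf_rad_comm l a b : radb k1 l -> cf l (a * b) = cf l (b * a).
Proof.
move/(radP hchar k1n) => rl.
elim/(torus_elem_ind (X := X)): a => [|a1 a2 IH1 IH2|c i].
- by rewrite mul0r mulr0.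
- by rewrite mulrDl mulrDr !cfD IH1 IH2.
elim/(torus_elem_ind (X := X)): b => [|a1 a2 IH1 IH2|d j].
- by rewrite mul0r mulr0.
- by rewrite mulrDl mulrDr !cfD IH1 IH2.
rewrite -!scalerAl -!scalerAr !txM !cfZ !cfxx [j + i]addrC.
case: eqP => [e|]; rewrite ?mulr0 // !mulr1.
have -> : j = l - i by rewrite -e addrC addKr.
rewrite epsDr epsDl epsNl epsNr rl; ring.
Qed.

Lemma cf_tr_br l M M' : radb k1 l -> cf l (\tr (lie_br M M')) = 0.
Proof.
move=> rl; rewrite /lie_br raddfB /= cfB /mxtrace !cf_sum.
apply/eqP; rewrite subr_eq0; apply/eqP.
rewrite (eq_bigr (fun i => \sum_j cf l (M i j * M' j i))); last first.
  by move=> i _; rewrite mxE cf_sum.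
rewrite exchange_big; apply: eq_bigr => i _ /=; rewrite mxE cf_sum.
by apply: eq_bigr => j _; apply: cf_rad_comm.
Qed.

Lemma LxZ c M : Lx M -> Lx (mxscale c M).
Proof.
move=> [h t]; split; first exact: skAZ.
move=> l rl; rewrite cf_tr mcfZ linearZ /= -cf_tr t ?mulr0 //.
Qed.

Lemma LxD M M' : Lx M -> Lx M' -> Lx (M + M').
Proof.
move=> [h t] [h' t']; split; first exact: skAD.
by move=> l rl; rewrite raddfD /= cfD t ?t' ?addr0.
Qed.

Lemma Lx0 : Lx 0.
Proof. by split; [exact: skA0 | move=> l _; rewrite mxtrace0 cf0]. Qed.

Lemma Lx_br M M' : Lx M -> Lx M' -> Lx (lie_br M M').
Proof. by move=> [h _] [h' _]; split; [exact: skA_br | move=> l; apply: cf_tr_br]. Qed.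

Lemma derived_Lx M : derived skA M -> Lx M.
Proof.
move=> [S [hS ->]]; rewrite big_seq; apply: big_ind => [|*|u /hS[h1 h2]].
- exact: Lx0.
- exact: LxD.
apply: LxZ; split; first exact: skA_br.
by move=> l; apply: cf_tr_br.
Qed.

Lemma skA_hx N l : skk (s l) N -> skA (hx X N l).
Proof.
move=> h; apply/skAP => l'; rewrite mcf_hx; case: eqP => [<-//|_].
by apply/matrixP => i j; rewrite !mxE mulr0 oppr0.
Qed.

Lemma Lx_hx N l : skk (s l) N -> (radb k1 l -> \tr N = 0) -> Lx (hx X N l).
Proof.
move=> h t; split; first exact: skA_hx.
move=> l' rl; rewrite cf_tr mcf_hx; case: eqP => [e|_]; last by rewrite mxtrace0.
by rewrite t // e.
Qed.

End SkewMatrices.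

Lemma rev_ord_neq r (i : 'I_(r + r)) : (rev_ord i == i) = false.
Proof. by apply/eqP => /(congr1 val) /=; have := ltn_ord i; lia. Qed.

Lemma tr_delta (R : pzSemiRingType) q (i j : 'I_q) :
  \tr (delta_mx i j : 'M[R]_q) = (i == j)%:R.
Proof.
rewrite /mxtrace (bigD1 i) //= mxE eqxx big1 ?addr0 // => t /negPf ti.
by rewrite mxE ti.
Qed.

Section RootVectors.
Variables (k : fieldType) (r : nat) (tau : k).
Hypothesis hchar : [pchar k] =i pred0.
Hypothesis tau2 : tau * tau = 1.
Local Notation m := (r + r)%N.
Local Notation sig := (@sig k r tau).
Local Notation adjk := (@adjk k r tau).
Local Notation skk := (@skk k r tau).
Implicit Types (N : 'M[k]_m) (i j : 'I_m) (c : k).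

Lemma adjkZ c a N : adjk c (a *: N) = a *: adjk c N.
Proof. by apply/matrixP => i j; rewrite !mxE mulrCA. Qed.
Lemma adjkD c N N' : adjk c (N + N') = adjk c N + adjk c N'.
Proof. by apply/matrixP => i j; rewrite !mxE mulrDr. Qed.
Lemma adjkN c N : adjk c (- N) = - adjk c N.
Proof. by apply/matrixP => i j; rewrite !mxE mulrN. Qed.

Lemma adjkK c N : c * c = 1 -> adjk c (adjk c N) = N.
Proof.
move=> c2; apply/matrixP => i j; rewrite !mxE !rev_ordK !(sig_rev tau2) !mulrA.
have -> : sig i * sig j * c * tau * sig j * tau * sig i * c =
  (sig i * sig i) * (sig j * sig j) * (tau * tau) * (c * c) by ring.
by rewrite !(sigS tau2) tau2 c2 !mul1r.
Qed.

Lemma adjk_delta c i j :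
  adjk c (delta_mx i j) = (sig i * sig j * c) *: delta_mx (rev_ord j) (rev_ord i).
Proof.
apply/matrixP => a b; rewrite !mxE.
have -> : (rev_ord b == i) && (rev_ord a == j) = (a == rev_ord j) && (b == rev_ord i).
  by rewrite andbC -!(can2_eq (@rev_ordK m) (@rev_ordK m)).
case: andP => [[/eqP -> /eqP ->]|]; rewrite ?mulr0 // !(sig_rev tau2).
have -> : tau * sig j * (tau * sig i) = (tau * tau) * (sig i * sig j) by ring.
by rewrite tau2 mul1r.
Qed.

(** Twice the skew part of an elementary matrix: a root vector for [i != j], diagonal for [i = j].
    At [j = rev_ord i] it equals [(1 - tau c)] times the elementary matrix, and so may vanish. *)
Definition rootmx c i j : 'M[k]_m := delta_mx i j - adjk c (delta_mx i j).

Lemma skk_rootmx c i j : c * c = 1 -> skk c (rootmx c i j).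
Proof. by move=> c2; rewrite /skk /rootmx adjkD adjkN adjkK // opprB addrC. Qed.

Lemma skk_decomp c N : skk c N -> N = \sum_i \sum_j (2^-1 * N i j) *: rootmx c i j.
Proof.
move=> h; rewrite /skk in h.
have E M : M = \sum_i \sum_j M i j *: delta_mx i j :> 'M[k]_m by apply: matrix_sum_delta.
have two := two_neq0 hchar.
rewrite (_ : \sum_i _ = 2^-1 *: (N - adjk c N)).
  by rewrite h opprK -mulr2n -scaler_nat scalerA mulVf // scale1r.
have Es : adjk c N = \sum_i \sum_j N i j *: adjk c (delta_mx i j).
  rewrite {1}(E N) (big_morph (adjk c) (adjkD c) (_ : adjk c 0 = 0)).
    apply: eq_bigr => i _; rewrite (big_morph (adjk c) (adjkD c) (_ : adjk c 0 = 0)).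
      by apply: eq_bigr => j _; rewrite adjkZ.
    by apply/matrixP => a b; rewrite !mxE mulr0.
  by apply/matrixP => a b; rewrite !mxE mulr0.
rewrite {2}(E N) Es -sumrB scaler_sumr; apply: eq_bigr => i _.
rewrite -sumrB scaler_sumr; apply: eq_bigr => j _.
by rewrite /rootmx -scalerBr scalerA.
Qed.

Definition wt (q t : 'I_m) : k := (t == q)%:R - (t == rev_ord q)%:R.
Definition Hd (q : 'I_m) : 'M[k]_m := diag_mx (\row_t wt q t).

Lemma wt_rev q t : wt q (rev_ord t) = - wt q t.
Proof.
rewrite /wt (can2_eq (@rev_ordK m) (@rev_ordK m)) (inj_eq rev_ord_inj).
by rewrite opprB.
Qed.

Lemma skk_Hd q : skk 1 (Hd q).
Proof.
apply/matrixP => i j; rewrite !mxE mulr1 (inj_eq rev_ord_inj) eq_sym.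
case: (eqVneq i j) => [->|_]; last by rewrite !mulr0n mulr0 oppr0.
by rewrite (sigS tau2) mul1r !mulr1n wt_rev.
Qed.

Lemma tr_Hd q : \tr (Hd q) = 0.
Proof.
rewrite mxtrace_diag (eq_bigr (fun t => wt q t)) => [|t _]; last by rewrite mxE.
apply: (eq_opp_0 hchar); rewrite {1}(reindex_inj rev_ord_inj) -sumrN /=.
by apply: eq_bigr => t _; rewrite wt_rev.
Qed.

Lemma wt_root q i j c a b :
  (wt q a - wt q b) * rootmx c i j a b = (wt q i - wt q j) * rootmx c i j a b.
Proof.
rewrite /rootmx adjk_delta !mxE.
case e1: ((a == i) && (b == j)); first by move: e1 => /andP[/eqP -> /eqP ->].
case e2: ((a == rev_ord j) && (b == rev_ord i)); last by rewrite mulr0 subr0 !mulr0.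
by move: e2 => /andP[/eqP -> /eqP ->]; congr (_ * _); rewrite !wt_rev opprK addrC.
Qed.

Lemma wt_root_neq0 i j : i != j -> wt i i - wt i j != 0.
Proof.
move=> ij; rewrite /wt eqxx [i == rev_ord i]eq_sym rev_ord_neq [j == i]eq_sym (negPf ij).
by case: (j == rev_ord i); rewrite !(mulr0n, mulr1n, subr0, addr0, sub0r, opprK) ?oner_neq0 // (two_neq0 hchar).
Qed.

End RootVectors.

Section Symplectic.
Variables (k : fieldType) (n k0 p : nat) (A : algType k).
Local Notation k1 := (pairs_of k0 p).
Variable (X : torus_str n k1 A).
Hypothesis hchar : [pchar k] =i pred0.
Hypothesis k1n : (2 * k1 <= n)%N.
Variables (r : nat) (tau : k).
Hypothesis tau2 : tau * tau = 1.
Local Notation L := 'rV[int]_n.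
Local Notation m := (r + r)%N.
Local Notation s := (ssgn k k0 p).
Implicit Types (M : 'M[A]_m) (N : 'M[k]_m) (l : L) (i j : 'I_m).
Local Notation skA := (@skA k n k0 p A X r tau).
Local Notation Lx := (@Lx k n k0 p A X r tau).
Local Notation skk := (@skk k r tau).
Local Notation rootmx := (@rootmx k r tau).
Local Notation sig := (@sig k r tau).

Lemma Hd_br q M i j : lie_br (hx X (Hd k q) 0) M i j = (wt k q i - wt k q j) *: M i j.
Proof. exact: diag_br. Qed.

Lemma skA_Hd q : skA (hx X (Hd k q) 0).
Proof. by apply: skA_hx; rewrite ssgn0; apply: skk_Hd. Qed.

Lemma Lx_Hd q : Lx (hx X (Hd k q) 0).
Proof. by apply: Lx_hx; [rewrite ssgn0; apply: skk_Hd | rewrite tr_Hd]. Qed.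

Lemma Hd_rootmx q i j c l : lie_br (hx X (Hd k q) 0) (hx X (rootmx c i j) l) =
  mxscale (wt k q i - wt k q j) (hx X (rootmx c i j) l).
Proof. by apply/matrixP => a b; rewrite Hd_br mxscale_ij !hxE !scalerA wt_root. Qed.

Lemma skA_rootmx i j l : skA (hx X (rootmx (s l) i j) l).
Proof. by apply: skA_hx; apply: skk_rootmx => //; apply: ssgnS. Qed.

Lemma Lx_rootmx i j l : i != j -> Lx (hx X (rootmx (s l) i j) l).
Proof.
move=> ij; apply: Lx_hx; first by apply: skk_rootmx => //; apply: ssgnS.
move=> _; rewrite /rootmx adjk_delta // raddfB /= linearZ /=.
by rewrite !tr_delta ?(inj_eq rev_ord_inj) // ?[j == i]eq_sym (negPf ij) mulr0 subr0.
Qed.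

(** An off-diagonal root vector is an eigenvector of [ad (Hd i)] with eigenvalue 1 or 2, hence
    itself a multiple of a bracket. *)
Lemma derived_rootmx i j l : i != j -> derived skA (hx X (rootmx (s l) i j) l).
Proof.
move=> ij; apply: (derived_scaled (wt_root_neq0 hchar ij)).
rewrite -Hd_rootmx; apply: derived_br; [exact: skA_Hd | exact: skA_rootmx].
Qed.

Lemma rootmx_br_pair i j l : i != j -> j != rev_ord i ->
  lie_br (hx X (rootmx 1 i j) 0) (hx X (rootmx (s l) j i) l) =
  hx X (rootmx (s l) i i) l - hx X (rootmx (s l) j j) l.
Proof.
move=> ij ji'; rewrite hx_br0 -hxN -hxD; congr (hx X _ l).
have ij' : (i == rev_ord j) = false by rewrite -(can2_eq (@rev_ordK m) (@rev_ordK m)) eq_sym (negPf ji').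
have jr : (rev_ord j == i) = false by rewrite eq_sym.
have ir : (rev_ord i == j) = false by rewrite eq_sym (negPf ji').
rewrite /rootmx !adjk_delta // !mulmxBl !mulmxBr -!scalemxAl -!scalemxAr.
rewrite !mul_delta_mx_cond !eqxx ij' jr ir (negPf ji') !mulr1n !mulr0n !scaler0 !subr0 !sub0r !opprK !scalerA.
have e1 : sig i * sig j * 1 * (sig j * sig i * s l) = s l.
  have -> : sig i * sig j * 1 * (sig j * sig i * s l) =
    (sig i * sig i) * (sig j * sig j) * s l by ring.
  by rewrite !sigS // !mul1r.
have e2 : sig j * sig i * s l * (sig i * sig j * 1) = s l.
  by rewrite mulrC e1.
rewrite e1 e2 !sigS // !mul1r !opprD !opprK.
by rewrite addrACA [RHS]addrACA; congr (_ + _); rewrite addrC.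
Qed.

End Symplectic.

Section SpecialSymplectic.
Variables (k : fieldType) (n k0 p : nat) (A : algType k).
Local Notation k1 := (pairs_of k0 p).
Variable (X : torus_str n k1 A).
Hypothesis hchar : [pchar k] =i pred0.
Hypothesis k1n : (2 * k1 <= n)%N.
Variables (r : nat).
Local Notation L := 'rV[int]_n.
Local Notation m := (r + r)%N.
Local Notation s := (ssgn k k0 p).
Local Notation eps := (eps k k1).
Implicit Types (M : 'M[A]_m) (N : 'M[k]_m) (l : L) (i j : 'I_m).
Local Notation skA := (@skA k n k0 p A X r (-1)).
Local Notation Lx := (@Lx k n k0 p A X r (-1)).
Local Notation skk := (@skk k r (-1)).
Local Notation rootmx := (@rootmx k r (-1)).
Local Notation sig := (@sig k r (-1)).
Local Notation adjk := (@adjk k r (-1)).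

Let tau2 : (-1) * (-1) = 1 :> k. Proof. by rewrite mulrNN mulr1. Qed.

Lemma ssgn_cases l : s l = 1 \/ s l = -1. Proof. exact: sg_cases. Qed.

Lemma skk_long c i : c = 1 -> skk c (delta_mx i (rev_ord i)).
Proof.
move=> ->; rewrite /skk adjk_delta // rev_ordK sig_rev // mulr1 mulrCA sigS //.
by rewrite mulr1 scaleN1r.
Qed.

Lemma tr_long i : \tr (delta_mx i (rev_ord i) : 'M[k]_m) = 0.
Proof. by rewrite tr_delta eq_sym rev_ord_neq. Qed.

Lemma skA_long l i : s l = 1 -> skA (hx X (delta_mx i (rev_ord i)) l).
Proof. by move=> sl; apply: skA_hx; apply: skk_long. Qed.

Lemma Lx_long l i : s l = 1 -> Lx (hx X (delta_mx i (rev_ord i)) l).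
Proof. by move=> sl; apply: Lx_hx; [apply: skk_long | rewrite tr_long]. Qed.

Lemma rootmx_diag c i : rootmx c i i = delta_mx i i - c *: delta_mx (rev_ord i) (rev_ord i).
Proof. by rewrite /rootmx adjk_delta // sigS // mul1r. Qed.

Lemma long_br l i :
  lie_br (hx X (delta_mx i (rev_ord i)) 0) (hx X (delta_mx (rev_ord i) i) l) =
  hx X (rootmx 1 i i) l.
Proof. by rewrite hx_br0 !mul_delta_mx rootmx_diag scale1r. Qed.

Lemma derived_diag_fixed l i : s l = 1 -> derived skA (hx X (rootmx (s l) i i) l).
Proof.
move=> sl; rewrite sl -long_br; apply: derived_br.
  by apply: skA_long; rewrite ssgn0.
by have := skA_long (rev_ord i) sl; rewrite rev_ordK.
Qed.

(** For a skew degree [l], split it as [u + (l - u)] with [x u] and [x (l - u)] anticommuting; the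
    bracket of the diagonal vectors at [i] of these two degrees is a nonzero multiple of the wanted
    one. *)
Lemma derived_diag_nonrad l i : ~~ radb k1 l -> derived skA (hx X (rootmx (s l) i i) l).
Proof.
move=> /(not_rad k k1n) [u hu].
have [sl|sl] := ssgn_cases l; first exact: derived_diag_fixed.
have e0 := eps_neq0 k k1 u (l - u).
apply: (derived_scaled (mulf_neq0 (two_neq0 hchar) e0)).
have skew v : eps v u = - eps u v -> s (u + v) = s u * s v * -1.
  move=> h; rewrite ssgnD h.
  by transitivity (s u * s v * - (eps u v * eps u v)); [ring | rewrite epsS].
have huv : eps (l - u) u = - eps u (l - u).
  by rewrite epsDl epsDr epsNl epsNr hu mulNr.
have := derived_br (skA_rootmx X tau2 i i u) (skA_rootmx X tau2 i i (l - u)).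
rewrite hx_br huv (addrC u) subrK; congr (derived _ _).
rewrite -hxZ; congr (hx X _ l).
rewrite scaleNr opprK -scalerDr mulrC -scalerA; congr (_ *: _).
rewrite !rootmx_diag !mulmxBl !mulmxBr -!scalemxAl -!scalemxAr !mul_delta_mx_cond.
rewrite !eqxx rev_ord_neq eq_sym rev_ord_neq !mulr1n !mulr0n !scaler0 !subr0 !sub0r !opprK !scalerA.
have := skew _ huv; rewrite (addrC u) subrK mulrN1 => ->.
by rewrite [s (l - u) * _]mulrC -mulr2n -scaler_nat scaleNr opprK.
Qed.

Lemma diag_diff_derived l i j : s l = -1 ->
  derived skA (hx X (rootmx (s l) i i) l - hx X (rootmx (s l) j j) l).
Proof.
move=> sl; case: (eqVneq i j) => [->|ij]; first by rewrite subrr; apply: derived0.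
case: (eqVneq j (rev_ord i)) => [->|ji].
  rewrite sl !rootmx_diag rev_ordK !scaleN1r !opprK [delta_mx (rev_ord i) _ + _]addrC subrr.
  exact: derived0.
rewrite -(rootmx_br_pair X tau2) //; apply: derived_br.
  by have := skA_rootmx X tau2 i j 0; rewrite ssgn0.
exact: skA_rootmx.
Qed.

(** Degree by degree, off-diagonal parts are reached through the Cartan elements. Diagonal parts are
    brackets of opposite long root vectors in symmetric degrees, and of diagonal matrices in
    nonradical skew degrees. In a radical skew degree only differences of diagonal vectors are
    reached, and the trace condition shows that these suffice. *)
Lemma Lx_derived M : Lx M -> derived skA M.
Proof.
move=> /LxP h; have [S ->] := hx_decomp X M.
apply: derived_sum => l _ _; have {h} [h t] := h l.
set N := mcf X l M in h t *.
have sl2 : s l * s l = 1 by apply: ssgnS.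
rewrite (skk_decomp hchar h) hx_sum.
rewrite (eq_bigr (fun i => mxscale (2^-1 * N i i) (hx X (rootmx (s l) i i) l) +
    \sum_(j | j != i) mxscale (2^-1 * N i j) (hx X (rootmx (s l) i j) l))); last first.
  by move=> i _; rewrite hx_sum (bigD1 i) //= hxZ; congr (_ + _); apply: eq_bigr => j _; rewrite hxZ.
rewrite big_split /=; apply: derivedD; last first.
  apply: derived_sum => i _ _; apply: derived_sum => j _ ji.
  by apply: derivedZ; apply: derived_rootmx => //; rewrite eq_sym.
have [sl|sl] := ssgn_cases l.
  by apply: derived_sum => i _ _; apply: derivedZ; apply: derived_diag_fixed.
case: (boolP (radb k1 l)) => [rl|nr]; last first.
  by apply: derived_sum => i _ _; apply: derivedZ; apply: derived_diag_nonrad.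
case: (pickP (fun _ : 'I_m => true)) => [i0 _|no]; last by rewrite big_pred0 //; apply: derived0.
(* Every diagonal vector is compared with the one at [i0]; the multiple of the latter that remains
   is half the trace. *)
rewrite (eq_bigr (fun i => mxscale (2^-1 * N i i) (hx X (rootmx (s l) i i) l - hx X (rootmx (s l) i0 i0) l)
   + mxscale (2^-1 * N i i) (hx X (rootmx (s l) i0 i0) l))); last first.
  by move=> i _; rewrite -mxscaleD subrK.
rewrite big_split /=; apply: derivedD.
  by apply: derived_sum => i _ _; apply: derivedZ; apply: diag_diff_derived.
rewrite (_ : \sum_i _ = 0); first exact: derived0.
under eq_bigr do rewrite -hxZ -scalerA; rewrite -hx_sum -scaler_sumr -scaler_suml.
by have := t rl; rewrite /mxtrace => ->; rewrite scale0r scaler0 hx0.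
Qed.

End SpecialSymplectic.

Section Definitions.
Variables (k : fieldType) (A : algType k) (r : nat).
Implicit Types (i j : 'I_(r + r)).

Lemma Jmx_val i j : Jmx A (r + r) i j = (j == rev_ord i)%:R.
Proof.
rewrite mxE; congr (_%:R); congr nat_of_bool.
rewrite -(inj_eq val_inj) /=; have := ltn_ord i; have := ltn_ord j; lia.
Qed.

Lemma Gmx_val i j : Gmx A r i j = (sig (-1 : k) i)%:A *+ (j == rev_ord i).
Proof.
have E (a b : 'I_r) : Jmx A r a b = (a + b == r.-1)%N%:R by rewrite mxE.
rewrite /Gmx /sig -(inj_eq val_inj).
case: (split_ordP i) => a ->; case: (split_ordP j) => b -> /=.
- rewrite block_mxEul mxE (_ : (_ == _) = false) //.
  by move: (ltn_ord a) (ltn_ord b); move: (nat_of_ord a) (nat_of_ord b); clear; lia.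
- rewrite block_mxEur E /= scale1r; congr (_%:R); congr nat_of_bool.
  by move: (ltn_ord a) (ltn_ord b); move: (nat_of_ord a) (nat_of_ord b); clear; lia.
- rewrite block_mxEdl mxE E /= scaleN1r mulNrn; congr (- _).
  congr (_%:R); congr nat_of_bool.
  by move: (ltn_ord a) (ltn_ord b); move: (nat_of_ord a) (nat_of_ord b); clear; lia.
rewrite block_mxEdr mxE (_ : (_ == _) = false) //.
by move: (ltn_ord a) (ltn_ord b); move: (nat_of_ord a) (nat_of_ord b); clear; lia.
Qed.

End Definitions.

Lemma eq_derived (k : fieldType) (A : algType k) m (S S' : 'M[A]_m -> Prop) M :
  (forall N, S N <-> S' N) -> derived S M -> derived S' M.
Proof.
by move=> e [s [h ->]]; exists s; split=> // u /h [h1 h2]; split; apply/e.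
Qed.

Section SspIsLx.
Variables (k : fieldType) (n k0 p : nat) (A : algType k).
Local Notation k1 := (pairs_of k0 p).
Variable (X : torus_str n k1 A) (inv : A -> A).
Hypothesis hchar : [pchar k] =i pred0.
Hypothesis k1n : (2 * k1 <= n)%N.
Hypothesis invE : inv =1 tinv X.
Variable r : nat.

Lemma skew_sympl_skA M : skew_sympl inv M <-> skA X (-1) (M : 'M[A]_(r + r)).
Proof.
have tau2 : (-1) * (-1) = 1 :> k by rewrite mulrNN mulr1.
suff E : Ginvmx A r *m (map_mx inv M)^T *m Gmx A r = adj X (-1) M.
  by rewrite /skew_sympl E.
apply/matrixP => i j; rewrite /Ginvmx !mulNmx !mxE (bigD1 (rev_ord j)) //= big1 ?addr0; last first.
  move=> t tj; rewrite Gmx_val (_ : (j == rev_ord t) = false) ?mulr0 //.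
  by apply: contra_neqF tj => /eqP ->; rewrite rev_ordK.
rewrite [X in X * _]mxE (bigD1 (rev_ord i)) //= big1 ?addr0 => [|t ti]; last first.
  by rewrite Gmx_val (negPf ti) mul0r.
rewrite !Gmx_val !rev_ordK !eqxx !mulr1n !mxE invE sig_rev //.
rewrite -!scalerAl -!scalerAr mul1r mulr1 !scalerA -scaleNr.
by congr (_ *: _); ring.
Qed.

Lemma ssp_Lx M : ssp inv M <-> Lx X (-1) (M : 'M[A]_(r + r)).
Proof.
split=> h.
  apply: derived_Lx => //; rewrite ?mulrNN ?mulr1 //.
  exact: (eq_derived skew_sympl_skA).
apply: (@eq_derived _ _ _ (skA X (-1))) => [N|]; first by split; apply skew_sympl_skA.
exact: Lx_derived.
Qed.

End SspIsLx.

Section OrthIsLx.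
Variables (k : fieldType) (n : nat) (A : algType k).
Variable (X : torus_str n (pairs_of 0 0) A).
Hypothesis hchar : [pchar k] =i pred0.
Hypothesis idE : forall a, tinv X a = a.
Variable r : nat.

(** Over a commutative torus with identity involution the trace condition is automatic: the adjoint
    preserves the trace, so a skew matrix has trace equal to its own opposite. *)
Lemma orth_Lx M : orth M <-> Lx X 1 (M : 'M[A]_(r + r)).
Proof.
have E : Jmx A (r + r) *m M^T *m Jmx A (r + r) = adj X 1 M.
  apply/matrixP => i j; rewrite !mxE (bigD1 (rev_ord j)) //= big1 ?addr0; last first.
    move=> t tj; rewrite Jmx_val (_ : (j == rev_ord t) = false) ?mulr0 //.
    by apply: contra_neqF tj => /eqP ->; rewrite rev_ordK.
  rewrite mxE (bigD1 (rev_ord i)) //= big1 ?addr0 => [|t ti]; last first.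
    by rewrite Jmx_val (negPf ti) mul0r.
  rewrite !Jmx_val !rev_ordK !eqxx mul1r mulr1 mxE idE.
  by rewrite /sig !if_same mulr1 scale1r.
rewrite /orth E; split=> [h|[//]]; split=> // l _.
rewrite cf_tr; apply: (eq_opp_0 hchar).
have /skAP/(_ l) := h; rewrite /skk => {}h.
rewrite -raddfN -h /mxtrace (reindex_inj rev_ord_inj) /=; apply: eq_bigr => i _.
by rewrite [RHS]mxE /sig !if_same /ssgn /qf /lf big_ord0 big_ord0 mulr1 !addr0 sg0 !mul1r.
Qed.

End OrthIsLx.

Section LieIsoGeneral.
Variable k : fieldType.

Definition lie_sub (A : algType k) m (L : 'M[A]_m -> Prop) : Prop :=
  [/\ L 0, (forall c M N, L M -> L N -> L (mxscale c M + N)) &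
      forall M N, L M -> L N -> L (lie_br M N)].

Definition lie_hom (A B : algType k) m1 m2 (L1 : 'M[A]_m1 -> Prop) (L2 : 'M[B]_m2 -> Prop)
    (f : 'M[A]_m1 -> 'M[B]_m2) : Prop :=
  [/\ (forall M, L1 M -> L2 (f M)),
      (forall c M N, L1 M -> L1 N -> f (mxscale c M + N) = mxscale c (f M) + f N) &
      (forall M N, L1 M -> L1 N -> f (lie_br M N) = lie_br (f M) (f N))].

Definition lie_pair (A B : algType k) m1 m2 (L1 : 'M[A]_m1 -> Prop) (L2 : 'M[B]_m2 -> Prop) f g :=
  [/\ lie_hom L1 L2 f, lie_hom L2 L1 g, (forall M, L1 M -> g (f M) = M) &
      (forall N, L2 N -> f (g N) = N)].

Lemma lie_pair_sym (A B : algType k) m1 m2 (L1 : 'M[A]_m1 -> Prop) (L2 : 'M[B]_m2 -> Prop) f g :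
  lie_pair L1 L2 f g -> lie_pair L2 L1 g f.
Proof. by case. Qed.

(** An isomorphism is only constrained on the subalgebras, so its inverse has to be chosen there;
    with an explicit pair, invariants are transported symmetrically in both directions. *)
Lemma lie_iso_pairP (A B : algType k) m1 m2 (L1 : 'M[A]_m1 -> Prop) (L2 : 'M[B]_m2 -> Prop) :
  lie_sub L1 -> lie_sub L2 -> lie_iso L1 L2 <-> exists f g, lie_pair L1 L2 f g.
Proof.
move=> [z1 s1 b1] [z2 s2 b2].
split=> [[f [fm fs fi fl fb]]|[f [g [[fm fl fb] [gm gl gb] fg gf]]]]; last first.
  exists f; split=> // [Y LY|X Y LX LY E].
    by exists (g Y); split; [exact: gm | exact: gf].
  by rewrite -(fg X) // -(fg Y) // E.
have [g' g'P] : exists g' : 'M[B]_m2 -> 'M[A]_m1, forall Y, L2 Y -> L1 (g' Y) /\ f (g' Y) = Y.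
  apply: (functional_choice (fun Y X => L2 Y -> L1 X /\ f X = Y)) => Y.
  have [h|h] := classic (L2 Y); last by exists 0.
  by have [X e] := fs Y h; exists X.
exists f, g'; split=> //; last by move=> N /g'P[].
- split=> [N /g'P[]//|c M N LM LN|M N LM LN].
    have [[LM' eM] [LN' eN]] := (g'P _ LM, g'P _ LN).
    have [LS eS] := g'P _ (s2 c _ _ LM LN).
    by apply: fi => //; [exact: s1 | rewrite eS fl // eM eN].
  have [[LM' eM] [LN' eN]] := (g'P _ LM, g'P _ LN).
  have [LS eS] := g'P _ (b2 _ _ LM LN).
  by apply: fi => //; [exact: b1 | rewrite eS fb // eM eN].
move=> M LM; have [LS eS] := g'P _ (fm _ LM); exact: fi.
Qed.

Lemma lie_hom0 (A B : algType k) m1 m2 (L1 : 'M[A]_m1 -> Prop) (L2 : 'M[B]_m2 -> Prop) f :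
  lie_sub L1 -> lie_hom L1 L2 f -> f 0 = 0.
Proof.
move=> [z _ _] [_ fl _]; have := fl (-1) 0 0 z z.
by rewrite mxscaler0 addr0 mxscaleN1 addNr.
Qed.

Lemma lie_homD (A B : algType k) m1 m2 (L1 : 'M[A]_m1 -> Prop) (L2 : 'M[B]_m2 -> Prop) f M N :
  lie_sub L1 -> lie_hom L1 L2 f -> L1 M -> L1 N -> f (M + N) = f M + f N.
Proof. by move=> sL [_ fl _] LM LN; have := fl 1 M N LM LN; rewrite !mxscale1. Qed.

Lemma lie_subD (A : algType k) m (L : 'M[A]_m -> Prop) M N :
  lie_sub L -> L M -> L N -> L (M + N).
Proof. by move=> [_ s _] LM LN; rewrite -[M]mxscale1; apply: s. Qed.

Lemma lie_sub_sum (A : algType k) m (L : 'M[A]_m -> Prop) (I : Type) (s : seq I) F :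
  lie_sub L -> (forall i, L (F i)) -> L (\sum_(i <- s) F i).
Proof.
move=> sL LF; have [z _ _] := sL.
by apply: big_ind => // M N; apply: lie_subD.
Qed.

Lemma lie_hom_sum (A B : algType k) m1 m2 (L1 : 'M[A]_m1 -> Prop) (L2 : 'M[B]_m2 -> Prop) f
    (I : Type) (s : seq I) F :
  lie_sub L1 -> lie_hom L1 L2 f -> (forall i, L1 (F i)) ->
  f (\sum_(i <- s) F i) = \sum_(i <- s) f (F i).
Proof.
move=> sL hf LF; elim: s => [|i s IH]; first by rewrite !big_nil (lie_hom0 sL hf).
by rewrite !big_cons (lie_homD sL hf) ?IH //; apply: lie_sub_sum.
Qed.

Lemma centroid_conj (A B : algType k) m1 m2 (L1 : 'M[A]_m1 -> Prop) (L2 : 'M[B]_m2 -> Prop) f g c :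
  lie_pair L1 L2 f g -> centroid L1 c -> centroid L2 (fun N => f (c (g N))).
Proof.
move=> [[fm fl fb] [gm gl gb] fg gf] [cm cl cb]; split=> [N LN|a M N LM LN|M N LM LN].
- by apply: fm; apply: cm; apply: gm.
- by rewrite gl // cl ?fl //; auto.
rewrite gb //; have [e1 e2] := cb _ _ (gm _ LM) (gm _ LN).
split; [rewrite e1 | rewrite e2]; rewrite fb ?gf //; auto.
Qed.

Lemma free_rank_pair (A B : algType k) m1 m2 (L1 V1 : 'M[A]_m1 -> Prop) (L2 V2 : 'M[B]_m2 -> Prop) f g d :
  lie_sub L1 -> lie_sub L2 -> lie_pair L1 L2 f g ->
  (forall M, V1 M -> L1 M) -> (forall M, L1 M -> V1 M -> V2 (f M)) ->
  (forall N, V2 N -> L2 N) -> (forall N, L2 N -> V2 N -> V1 (g N)) ->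
  free_rank L1 V1 d -> free_rank L2 V2 d.
Proof.
move=> sL1 sL2 pr VL1 V12 VL2 V21 [v [vV vgen vind]].
have [hf hg fg gf] := pr; have [fm fl fb] := hf; have [gm gl gb] := hg.
have vL i : L1 (v i) by apply: VL1.
exists (fun i => f (v i)); split.
- by move=> i; apply: V12.
- move=> Y VY; have LY := VL2 _ VY; have [c [cc E]] := vgen _ (V21 _ LY VY).
  exists (fun i N => f (c i (g N))); split; first by move=> i; apply: (centroid_conj pr).
  rewrite -[Y]gf // E (lie_hom_sum _ sL1 hf); last by move=> i; have [cm _ _] := cc i; apply: cm.
  by apply: eq_bigr => i _; rewrite fg.
move=> c cc E i Y LY.
have cm i' N : L2 N -> L2 (c i' N) by have [+ _ _] := cc i'; apply.
have := vind (fun i M => g (c i (f M))) (fun i => centroid_conj (lie_pair_sym pr) (cc i)).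
rewrite -(lie_hom_sum _ sL2 hg) ?E ?(lie_hom0 sL2 hg); last by move=> i'; apply: cm; apply: fm.
move=> /(_ erefl i (g Y) (gm _ LY)) h.
by rewrite -[c i Y]gf; [rewrite -[Y in c i Y]gf // h (lie_hom0 sL1 hf) | apply: cm].
Qed.

End LieIsoGeneral.

Section TorusLieIso.
Variables (k : fieldType) (n k0 p : nat) (A B : algType k) (r : nat) (tau : k).
Variables (X : torus_str n (pairs_of k0 p) A) (Y : torus_str n (pairs_of k0 p) B).
Hypothesis hchar : [pchar k] =i pred0.
Hypothesis k1n : (2 * pairs_of k0 p <= n)%N.
Hypothesis tau2 : tau * tau = 1.

Lemma Lx_sub : lie_sub (@Lx _ _ _ _ _ X r tau).
Proof.
split; first exact: Lx0.
- by move=> c M N LM LN; apply: LxD => //; apply: LxZ.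
by move=> M N; apply: Lx_br.
Qed.

Lemma mcf_tiso l (M : 'M[A]_(r + r)) : mcf Y l (map_mx (tiso X Y) M) = mcf X l M.
Proof. by apply/matrixP => i j; rewrite !mxE tcf_tiso. Qed.

Lemma Lx_tiso (M : 'M[A]_(r + r)) : Lx X tau M -> Lx Y tau (map_mx (tiso X Y) M).
Proof. by move/LxP => h; apply/LxP => l; rewrite mcf_tiso; apply: h. Qed.

Lemma tiso_hom : lie_hom (@Lx _ _ _ _ _ X r tau) (@Lx _ _ _ _ _ Y r tau) (map_mx (tiso X Y)).
Proof.
split; first exact: Lx_tiso.
  by move=> c M N _ _; apply/matrixP => i j; rewrite !mxE linearD linearZ.
have mm (P Q : 'M[A]_(r + r)) :
    map_mx (tiso X Y) (P *m Q) = map_mx (tiso X Y) P *m map_mx (tiso X Y) Q.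
  apply/matrixP => i j; rewrite !mxE linear_sum; apply: eq_bigr => t _.
  by rewrite !mxE /= tisoM.
by move=> M N _ _; rewrite /lie_br (map_mxB (tiso X Y)) !mm.
Qed.

End TorusLieIso.

Lemma tiso_pair (k : fieldType) (n k0 p : nat) (A B : algType k) (r : nat) (tau : k)
    (X : torus_str n (pairs_of k0 p) A) (Y : torus_str n (pairs_of k0 p) B) :
  lie_pair (@Lx _ _ _ _ _ X r tau) (@Lx _ _ _ _ _ Y r tau) (map_mx (tiso X Y)) (map_mx (tiso Y X)).
Proof.
split; try exact: tiso_hom.
  by move=> M _; apply/matrixP => i j; rewrite !mxE tisoK.
by move=> M _; apply/matrixP => i j; rewrite !mxE tisoK.
Qed.

(** * The centroid *)

Section Centroid.
Variables (k : fieldType) (n k0 p : nat) (A : algType k).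
Local Notation k1 := (pairs_of k0 p).
Variable (X : torus_str n k1 A).
Hypothesis hchar : [pchar k] =i pred0.
Hypothesis k1n : (2 * k1 <= n)%N.
Variables (r : nat) (tau : k).
Hypothesis tau2 : tau * tau = 1.
Local Notation L := 'rV[int]_n.
Local Notation m := (r + r)%N.
Local Notation x := (tx X).
Local Notation cf := (tcf X).
Local Notation s := (ssgn k k0 p).
Local Notation eps := (eps k k1).
Implicit Types (M W Y : 'M[A]_m) (N : 'M[k]_m) (l u : L) (i j q : 'I_m) (z a b : A).
Local Notation Lx := (@Lx k n k0 p A X r tau).
Local Notation skk := (@skk k r tau).
Local Notation rootmx := (@rootmx k r tau).
Local Notation sig := (@sig k r tau).
Local Notation adj := (@adj k n k0 p A X r tau).

(** Degrees of the central monomials fixed by the involution. They form a subgroup, which contains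
    all doubled degrees. *)
Definition gam l : bool := radb k1 l && (s l == 1).

Definition inZ z : Prop := forall l, cf l z != 0 -> gam l.

Lemma commute_rad a : (forall l, cf l a != 0 -> radb k1 l) -> forall b, a * b = b * a.
Proof.
move=> h b; rewrite (tcfE X a) mulr_suml mulr_sumr big_seq [RHS]big_seq.
apply: eq_bigr => l; rewrite mem_tsupp => /h /(radP hchar k1n) rl.
rewrite -scalerAl -scalerAr; congr (_ *: _).
apply: (cfP (X := X)) => v; rewrite cfxM cfMx; congr (_ * _).
by rewrite epsDl epsDr epsNl epsNr rl.
Qed.

Lemma rad_commute a : (forall l, a * x l = x l * a) -> forall u, cf u a != 0 -> radb k1 u.
Proof.
move=> h u au; apply/(radP hchar k1n) => v.
have := congr1 (cf (u + v)) (h v); rewrite cfMx cfxM addrK.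
by move/(mulIf au).
Qed.

Lemma inZ_comm z a : inZ z -> z * a = a * z.
Proof. by move=> h; apply: commute_rad => l /h /andP[]. Qed.

Lemma inZ_tinv z : inZ z -> tinv X z = z.
Proof.
move=> h; apply: (cfP (X := X)) => l; rewrite cf_tinv.
case: (eqVneq (cf l z) 0) => [->|/h/andP[_ /eqP ->]]; by rewrite ?mulr0 ?mul1r.
Qed.

Lemma skA_inZ z M : inZ z -> skA X tau M -> skA X tau (z *: M).
Proof.
move=> hz /matrixP h; apply/matrixP => i j; have := h i j; rewrite !mxE => E.
by rewrite tinvM (inZ_tinv hz) -(inZ_comm _ hz) scalerAr E mulrN.
Qed.

Lemma Lx_inZ z M : inZ z -> Lx M -> Lx (z *: M).
Proof.
move=> hz [h t]; split; first exact: skA_inZ.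
move=> l rl; rewrite linearZ /= cfM big_seq big1 // => u.
rewrite mem_tsupp => /hz /andP[ru _].
rewrite t ?mulr0 //; apply/(radP hchar k1n) => v.
move/(radP hchar k1n): rl => rl; move/(radP hchar k1n): ru => ru.
by rewrite epsDl epsDr epsNl epsNr rl ru.
Qed.

Lemma inZ_centroid z : inZ z -> centroid Lx (fun M => z *: M).
Proof.
move=> hz; split=> [M|c M N _ _|M N _ _]; first exact: Lx_inZ.
  by apply/matrixP => i j; rewrite !mxE mulrDr -scalerAr.
rewrite /lie_br !scalerBr !scalemxAl; split; congr (_ - _); rewrite -!scalemxAl.
  apply/matrixP => i j; rewrite !mxE mulr_sumr; apply: eq_bigr => t _.
  by rewrite mxE !mulrA (inZ_comm _ hz).
apply/matrixP => i j; rewrite !mxE mulr_sumr; apply: eq_bigr => t _.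
by rewrite mxE !mulrA (inZ_comm _ hz).
Qed.

Section Kill.
Variable c : 'M[A]_m -> 'M[A]_m.
Hypothesis cc : centroid Lx c.
Implicit Types d : 'I_m -> k.

Let hd d : 'M[A]_m := hx X (diag_mx (\row_t d t)) 0.

Let cL M : Lx M -> Lx (c M). Proof. by case: cc => + _ _; apply. Qed.
Let cbl M M' : Lx M -> Lx M' -> c (lie_br M M') = lie_br (c M) M'.
Proof. by move=> h h'; case: cc => _ _ /(_ _ _ h h') []. Qed.
Let cbr M M' : Lx M -> Lx M' -> c (lie_br M M') = lie_br M (c M').
Proof. by move=> h h'; case: cc => _ _ /(_ _ _ h h') []. Qed.
Let c0 : c 0 = 0.
Proof.
case: cc => _ cl _; have := cl (-1) 0 0 (Lx0 X r tau) (Lx0 X r tau).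
by rewrite mxscaler0 addr0 mxscaleN1 addNr.
Qed.
Lemma centroidD M M' : Lx M -> Lx M' -> c (M + M') = c M + c M'.
Proof. by move=> h h'; case: cc => _ cl _; have := cl 1 M M' h h'; rewrite !mxscale1. Qed.
Lemma centroidZ w M : Lx M -> c (mxscale w M) = mxscale w (c M).
Proof.
by move=> h; case: cc => _ cl _; have := cl w M 0 h (Lx0 X r tau); rewrite c0 !addr0.
Qed.

Let mxscale_eq0 w M : mxscale w M = 0 -> w != 0 -> M = 0.
Proof.
move=> e w0; rewrite -[M]mxscale1 -(mulVf w0) -mxscaleA e.
exact: mxscaler0.
Qed.

(** [w] times [c Y] is [c] of the bracket of [hd d] with [Y], that is, the bracket of [c (hd d) = 0]
    with [Y]. *)
Lemma kill_weight d w Y : Lx (hd d) -> c (hd d) = 0 -> Lx Y -> w != 0 ->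
  lie_br (hd d) Y = mxscale w Y -> c Y = 0.
Proof.
move=> Ld cd LY w0 E; apply: (mxscale_eq0 _ w0).
by rewrite -centroidZ // -E cbl // cd /lie_br mul0mx mulmx0 subr0.
Qed.

Lemma Hd_rootmx1 q : Hd k q = rootmx 1 q q :> 'M[k]_m.
Proof.
rewrite /rootmx adjk_delta // sigS // mulr1 scale1r.
apply/matrixP => i j; rewrite !mxE /wt.
case: (eqVneq i j) => [->|ij].
  by rewrite !andbb mulr1n.
have h t : (i == t) && (j == t) = false by apply: contraNF ij => /andP[/eqP -> /eqP ->].
by rewrite !h subrr mulr0n.
Qed.

Lemma Hd_sub_br i j : i != j -> j != rev_ord i ->
  lie_br (hx X (rootmx 1 i j) 0) (hx X (rootmx 1 j i) 0) = hx X (Hd k i) 0 - hx X (Hd k j) 0.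
Proof.
move=> ij ji; have := rootmx_br_pair X tau2 0 ij ji; rewrite ssgn0 => ->.
by rewrite !Hd_rootmx1.
Qed.

Let Lr1 i j : i != j -> Lx (hx X (rootmx 1 i j) 0).
Proof. by move=> ij; have := Lx_rootmx X tau2 0 ij; rewrite ssgn0. Qed.

(** If [Hd i] is killed, so is the root vector at [(i, j)], and then its bracket [Hd i - Hd j] with
    the opposite root vector. *)
Lemma kill_all_Hd i : c (hx X (Hd k i) 0) = 0 -> forall j, c (hx X (Hd k j) 0) = 0.
Proof.
move=> ci j; case: (eqVneq i j) => [<-//|ij].
have LH q : Lx (hx X (Hd k q) 0) by apply: Lx_Hd.
case: (eqVneq j (rev_ord i)) => [->|ji].
  have -> : hx X (Hd k (rev_ord i)) 0 = mxscale (-1) (hx X (Hd k i) 0).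
    rewrite -hxZ scaleN1r; congr (hx X _ 0); apply/matrixP => a b.
    by rewrite !mxE /wt rev_ordK -[RHS]mulNrn opprB.
  by rewrite centroidZ // ci mxscaler0.
have cF : c (hx X (rootmx 1 i j) 0) = 0.
  apply: (kill_weight (LH i) ci (Lr1 ij) (wt_root_neq0 hchar ij)).
  exact: Hd_rootmx.
have := cbl (Lr1 ij) (Lr1 (_ : j != i)); rewrite eq_sym => /(_ ij).
rewrite Hd_sub_br // cF /lie_br mul0mx mulmx0 subr0 -mxscaleN1.
rewrite centroidD ?ci ?add0r ?centroidZ //; last exact: LxZ.
by move=> e; apply: (mxscale_eq0 e); rewrite oppr_eq0 oner_eq0.
Qed.

Lemma kill_rootmx : (forall q, c (hx X (Hd k q) 0) = 0) ->
  forall i j l, i != j -> c (hx X (rootmx (s l) i j) l) = 0.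
Proof.
move=> h i j l ij.
apply: (kill_weight (Lx_Hd X hchar tau2 i) (h i) (Lx_rootmx X tau2 l ij) (wt_root_neq0 hchar ij)).
exact: Hd_rootmx.
Qed.

(** What rank one demands of the torus: a skew monomial that commutes with all symmetric ones is
    central. It fails for [Q(-1)] with the involution [natural], whose symmetric elements are all
    central. *)
Definition nonexcluded : Prop := forall u, s u = -1 ->
  (forall l, s l = 1 -> eps u l = eps l u) -> radb k1 u.

(** Commuting with the Cartan elements makes [W] diagonal; commuting with the root vectors makes it
    scalar with an entry [w] supported on radical degrees. The trace condition then gives
    [2 r w = 0], and the characteristic is 0. *)
Lemma centralizer_root W : (r = 1%N -> tau = -1 /\ nonexcluded) -> (0 < r)%N -> Lx W ->
  (forall q, lie_br W (hx X (Hd k q) 0) = 0) ->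
  (forall i j l, i != j -> lie_br W (hx X (rootmx (s l) i j) l) = 0) -> W = 0.
Proof.
move=> ne r0 [sW tW] hH hR.
have Wd i j : i != j -> W i j = 0.
  move=> ij; have /matrixP/(_ i j) := hH i.
  have -> : lie_br W (hx X (Hd k i) 0) = - lie_br (hx X (Hd k i) 0) W by rewrite /lie_br opprB.
  rewrite mxE [in X in - X]Hd_br mxE => /eqP; rewrite oppr_eq0 scaler_eq0.
  by rewrite (negPf (wt_root_neq0 hchar ij)) => /eqP.
have brE N l i j : lie_br W (hx X N l) i j = N i j *: (W i i * x l - x l * W j j).
  rewrite /lie_br !mxE (bigD1 i) //= big1 ?addr0 => [|t ti]; last first.
    by rewrite Wd 1?eq_sym // mul0r.
  rewrite (bigD1 j) //= big1 ?addr0 => [|t tj]; last by rewrite Wd // mulr0.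
  by rewrite !hxE -scalerAr -scalerAl -scalerBr.
have W1 (i : 'I_m) : forall j l, i != j -> (j == rev_ord i -> tau = -1 /\ s l = 1) ->
    W i i * x l = x l * W j j.
  move=> j l ij ji; have /matrixP/(_ i j) := hR i j l ij; rewrite brE [X in _ = X]mxE => /eqP.
  rewrite scaler_eq0 => /orP[|]; last by rewrite subr_eq0 => /eqP.
  rewrite /rootmx adjk_delta // !mxE !eqxx /=.
  case: (eqVneq j (rev_ord i)) ji => [-> /(_ isT) [t1 sl]|ji _].
    rewrite rev_ordK !eqxx sig_rev // sl mulr1 mulrCA sigS // !mulr1 t1 opprK.
    by rewrite (negPf (two_neq0 hchar)).
  rewrite (_ : (i == rev_ord j) = false) ?mulr0 ?subr0 ?oner_eq0 //.
  by apply: contra_neqF ji => /eqP ->; rewrite rev_ordK.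
pose i0 : 'I_m := Ordinal (ltn_addr r r0).
suff [w We wr] : exists2 w, (forall i, W i i = w) & (forall u, cf u w != 0 -> radb k1 u).
  suff w0 : w = 0.
    by apply/matrixP => i j; rewrite mxE; case: (eqVneq i j) => [->|/Wd//]; rewrite We.
  apply: (cfP (X := X)) => u; rewrite cf0.
  case: (boolP (radb k1 u)) => [ru|]; last by apply: contraNeq; apply: wr.
  have := tW u ru; rewrite /mxtrace (eq_bigr (fun=> w)) // sumr_const card_ord.
  rewrite -scaler_nat cfZ => /eqP; rewrite mulf_eq0 (negPf (nat_neq0 hchar _)) ?addn_gt0 ?r0 //.
  by move/eqP.
case: (ltngtP r 1) => [|r1|r1]; first by rewrite ltnNge r0.
  (* From rank two on, any two diagonal entries can be compared through an index other than [i] and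
     its mirror image, where the root vector is nonzero in every degree. *)
  have oth (i : 'I_m) : exists j : 'I_m, (j != i) && (j != rev_ord i).
    have lt0 : (0 < m)%N by rewrite addn_gt0 r0.
    have lt1 : (1 < m)%N by rewrite (leq_trans r1) // leq_addr.
    case: (boolP (((i : nat) == 0%N) || ((i : nat) == m.-1))) => hi.
      exists (Ordinal lt1); rewrite -!(inj_eq val_inj) /=; move: (ltn_ord i) hi r1.
      by move: (nat_of_ord i); clear; lia.
    exists (Ordinal lt0); rewrite -!(inj_eq val_inj) /=; move: (ltn_ord i) hi r1.
    by move: (nat_of_ord i); clear; lia.
  have gen i j l : j != i -> j != rev_ord i -> W i i * x l = x l * W j j.
    by move=> ji jr; apply: W1; [rewrite eq_sym | rewrite (negPf jr)].
  have eqd i j : W i i = W j j.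
    case: (eqVneq j i) => [->//|ji]; case: (eqVneq j (rev_ord i)) => [->|jr]; last first.
      by have := gen i j 0 ji jr; rewrite tx0 mulr1 mul1r.
    have [t /andP[ti tr]] := oth i.
    have := gen i t 0 ti tr; rewrite tx0 mulr1 mul1r => ->.
    have := gen (rev_ord i) t 0 tr; rewrite rev_ordK tx0 mulr1 mul1r => -> //.
  exists (W i0 i0) => // u; apply: rad_commute => l.
  by have [t /andP[ti tr]] := oth i0; rewrite (gen i0 t l) // (eqd i0 t).
(* In rank one the only off-diagonal positions are the long ones, which exist in symmetric degrees
   only. So [w] is merely known to commute with symmetric monomials and to be skew; [nonexcluded]
   closes this gap. *)
have [t1 hne] := ne r1.
have revE (i j : 'I_m) : i != j -> j = rev_ord i.
  move=> ij; apply/val_inj => /=; move: ij; rewrite -(inj_eq val_inj) /=.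
  by move: (ltn_ord i) (ltn_ord j); move: (nat_of_ord i) (nat_of_ord j) r1; clear; lia.
have eqd i j l : s l = 1 -> W i i * x l = x l * W j j.
  move=> sl; case: (eqVneq i j) => [e|ij]; last exact: W1.
  have ir : i != rev_ord i by rewrite eq_sym rev_ord_neq.
  have h0 := W1 i (rev_ord i) 0 ir (fun _ => conj t1 (ssgn0 k n k0 p)).
  have hl := W1 i (rev_ord i) l ir (fun _ => conj t1 sl).
  by move: h0 hl; rewrite tx0 mulr1 mul1r -e => <-.
exists (W i0 i0) => [i|u wu].
  by have := eqd i i0 0 (ssgn0 k n k0 p); rewrite tx0 mulr1 mul1r.
have inv_w : tinv X (W i0 i0) = - W i0 i0.
  have /matrixP/(_ i0 i0) := sW; rewrite !mxE sigS // scale1r => <-; congr (tinv X _).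
  by have := eqd i0 (rev_ord i0) 0 (ssgn0 k n k0 p); rewrite tx0 mulr1 mul1r.
apply: hne => [|l sl].
  have := congr1 (cf u) inv_w; rewrite cf_tinv cfN => e.
  by apply: (mulIf wu); rewrite mulN1r.
have := congr1 (cf (u + l)) (eqd i0 i0 l sl); rewrite cfMx cfxM addrK.
by move/(mulIf wu).
Qed.

(** A centroid element is determined by its value at a single [Hd i]: once that is killed, all root
    vectors [e] are, and the bracket of [c Y] with [e] equals that of [Y] with [c e = 0], so [c Y]
    centralizes everything. *)
Lemma centroid_kill : (r = 1%N -> tau = -1 /\ nonexcluded) -> (0 < r)%N ->
  (exists i, c (hx X (Hd k i) 0) = 0) -> forall Y, Lx Y -> c Y = 0.
Proof.
move=> ne r0 [i ci] Y LY.
have cH := kill_all_Hd ci; have cR := kill_rootmx cH.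
apply: centralizer_root => //; first exact: cL.
  move=> q; rewrite -cbl //; last exact: Lx_Hd.
  by rewrite cbr ?cH //; [rewrite /lie_br mul0mx mulmx0 subr0 | exact: Lx_Hd].
move=> i' j l ij; rewrite -cbl //; last exact: Lx_rootmx.
by rewrite cbr ?cR //; [rewrite /lie_br mul0mx mulmx0 subr0 | exact: Lx_rootmx].
Qed.

End Kill.
End Centroid.

Section ElementaryMatrices.
Variables (R : pzRingType) (m : nat).
Implicit Types (i j : 'I_m) (u v : R) (M : 'M[R]_m).

Definition emx u i j : 'M[R]_m := u *: delta_mx i j.

Lemma emxE u i j a b : emx u i j a b = if (a == i) && (b == j) then u else 0.
Proof. by rewrite !mxE; case: ifP; rewrite ?mulr1 ?mulr0. Qed.

Lemma emxM u v i j i' j' : emx u i j *m emx v i' j' = if j == i' then emx (u * v) i j' else 0.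
Proof.
apply/matrixP => a b; rewrite mxE (bigD1 j) //= big1 ?addr0 => [|t /negPf tj]; last first.
  by rewrite !emxE tj andbF mul0r.
rewrite !emxE eqxx andbT; case: (eqVneq j i') => [_|_] /=; last by rewrite mulr0 mxE.
by rewrite emxE /=; case: (a == i); case: (b == j'); rewrite ?mulr0 ?mul0r.
Qed.

Lemma emx_sandwich u v i j i' j' M :
  emx u i j *m M *m emx v i' j' = emx (u * M j i' * v) i j'.
Proof.
apply/matrixP => a b; rewrite mxE (bigD1 i') //= big1 ?addr0 => [|t /negPf ti]; last first.
  by rewrite !emxE ti mulr0.
rewrite mxE (bigD1 j) //= big1 ?addr0 => [|t /negPf tj]; last first.
  by rewrite !emxE tj andbF mul0r.
by rewrite !emxE !eqxx andbT /=; case: (a == i); case: (b == j'); rewrite ?mulr0 ?mul0r.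
Qed.

End ElementaryMatrices.

Lemma mxscaleBl (k : fieldType) (A : algType k) m (a b : k) (M : 'M[A]_m) :
  mxscale (a - b) M = mxscale a M - mxscale b M.
Proof. by apply/matrixP => i j; rewrite !mxE scalerBl. Qed.

Lemma centroid_sub (k : fieldType) (A : algType k) m (L : 'M[A]_m -> Prop) c d :
  lie_sub L -> centroid L c -> centroid L d -> centroid L (fun M => c M - d M).
Proof.
move=> sL [cm cl cb] [dm dl db]; split=> [M LM|a M N LM LN|M N LM LN].
- apply: lie_subD => //; first exact: cm.
  have [z s _] := sL; rewrite -mxscaleN1 -[mxscale _ _]addr0; apply: s => //; exact: dm.
- by rewrite cl // dl // opprD addrACA; congr (_ + _); apply/matrixP => i j; rewrite !mxE scalerBr.
have [c1 c2] := cb M N LM LN; have [d1 d2] := db M N LM LN.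
split; first by rewrite c1 d1 /lie_br mulmxBl mulmxBr !opprB addrACA [RHS]addrACA; congr (_ + _); rewrite addrC.
by rewrite c2 d2 /lie_br mulmxBl mulmxBr !opprB addrACA [RHS]addrACA; congr (_ + _); rewrite addrC.
Qed.

(* If [e ^+ 2 = 0] then [ad e] squared is [y |-> -2 e y e]. *)
Lemma centroid_extremal (k : fieldType) (A : algType k) m (L : 'M[A]_m -> Prop) c e f :
  [pchar k] =i pred0 -> lie_sub L -> centroid L c -> L e -> L f ->
  e *m e = 0 -> e *m f *m e = e -> c e = e *m c f *m e.
Proof.
move=> hchar sL [cm cl cb] Le Lf ee efe.
have [z s b] := sL.
have ad2 Y : lie_br e (lie_br e Y) = mxscale (-2) (e *m Y *m e).
  rewrite /lie_br mulmxBr mulmxBl !mulmxA ee mul0mx sub0r -[Y *m e *m e]mulmxA ee mulmx0 subr0.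
  by apply/matrixP => i j; rewrite !mxE -opprD -mulr2n scaleNr scaler_nat.
have E1 : c (lie_br e (lie_br e f)) = mxscale (-2) (c e).
  rewrite ad2 efe -[mxscale _ e]addr0 cl // (_ : c 0 = 0) ?addr0 //.
  have := cl (-1) 0 0 z z; by rewrite mxscaler0 addr0 mxscaleN1 addNr.
have E2 : c (lie_br e (lie_br e f)) = mxscale (-2) (e *m c f *m e).
  have [_ ->] := cb e (lie_br e f) Le (b _ _ Le Lf).
  by have [_ ->] := cb e f Le Lf; rewrite ad2.
have /(congr1 (mxscale (-2)^-1)) := etrans (esym E1) E2.
by rewrite !mxscaleA mulVf ?mxscale1 // oppr_eq0 (two_neq0 hchar).
Qed.

Section CentroidSymplectic.
Variables (k : fieldType) (n k0 p : nat) (A : algType k).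
Local Notation k1 := (pairs_of k0 p).
Variable (X : torus_str n k1 A).
Hypothesis hchar : [pchar k] =i pred0.
Hypothesis k1n : (2 * k1 <= n)%N.
Variables (r : nat).
Local Notation L := 'rV[int]_n.
Local Notation m := (r + r)%N.
Local Notation x := (tx X).
Local Notation cf := (tcf X).
Local Notation s := (ssgn k k0 p).
Local Notation eps := (eps k k1).
Local Notation Lx := (@Lx k n k0 p A X r (-1)).
Hypothesis r0 : (0 < r)%N.
Hypothesis ne : r = 1%N -> nonexcluded k n k0 p.

Let tau2 : (-1) * (-1) = 1 :> k. Proof. by rewrite mulrNN mulr1. Qed.

Lemma hx_delta l (i j : 'I_m) : hx X (delta_mx i j) l = emx (x l) i j.
Proof.
apply/matrixP => a b; rewrite hxE emxE mxE.
by case: ifP; rewrite ?scale1r ?scale0r.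
Qed.

(** Opposite long root vectors [e 0] and [f] are extremal, so [c] multiplies both by a torus
    element, and by the same one, [a]. The other long root vectors force [a] into the centre and
    membership in [Lx] makes it symmetric; then [c] minus [a] kills a Cartan element. *)
Lemma symplectic_centroid c : centroid Lx c ->
  exists2 z, inZ X z & forall M, Lx M -> c M = z *: M.
Proof.
move=> cc; have [cm cl cb] := cc.
have sL : lie_sub Lx by apply: Lx_sub.
pose o : 'I_m := Ordinal (ltn_addr r r0); pose o' := rev_ord o.
have oo : (o' == o) = false by apply: rev_ord_neq.
have oo1 : (o == o') = false by rewrite eq_sym.
pose e l := emx (x l) o o'; pose f := emx (x 0) o' o.
have Le l : s l = 1 -> Lx (e l) by move=> sl; rewrite /e -hx_delta; apply: Lx_long.
have Le0 : Lx (e 0) by apply: Le; apply: ssgn0.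
have Lf : Lx f.
  by rewrite /f -hx_delta -[in delta_mx _ o](rev_ordK o); apply: Lx_long => //; apply: ssgn0.
have x01 : x 0 = 1 by apply: tx0.
have [a Ece Ecf] : exists2 a, c (e 0) = emx a o o' & c f = emx a o' o.
  have ee : e 0 *m e 0 = 0 by rewrite /e emxM oo.
  have ff : f *m f = 0 by rewrite /f emxM oo1.
  have efe : e 0 *m f *m e 0 = e 0 by rewrite {1 3}/e emx_sandwich emxE !eqxx !x01 !mulr1 -x01.
  have fef : f *m e 0 *m f = f by rewrite {1 3}/f emx_sandwich emxE !eqxx !x01 !mulr1 -x01.
  have E1 : c (e 0) = emx (c f o' o) o o'.
    by rewrite (centroid_extremal hchar sL cc Le0 Lf ee efe) emx_sandwich !x01 mul1r mulr1.
  have E2 : c f = emx (c (e 0) o o') o' o.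
    by rewrite (centroid_extremal hchar sL cc Lf Le0 ff fef) emx_sandwich !x01 mul1r mulr1.
  by exists (c f o' o) => //; rewrite {1}E2 E1 emxE !eqxx.
have cH : c (lie_br (e 0) f) = emx a o o - emx a o' o'.
  have [-> _] := cb _ _ Le0 Lf.
  by rewrite Ece /lie_br /f !emxM !eqxx x01 mulr1 mul1r.
(* The weight of [e l] under [c] of the Cartan element gives [2 c (e l)] with entry [a x_l + x_l a];
   sliding [c] across the bracket of [e l] and [f] gives [c (e l)] with entry [x_l a]. *)
have comm l : s l = 1 -> a * x l = x l * a.
  move=> sl; have Ll := Le l sl.
  have He : lie_br (lie_br (e 0) f) (e l) = mxscale 2 (e l).
    rewrite /lie_br /f /e !emxM !eqxx x01 !mulr1 mulmxBl mulmxBr !emxM !eqxx oo ?oo1 !mul1r !mulr1.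
    by apply/matrixP => i j; rewrite !mxE subr0 sub0r opprK -mulr2n scaler_nat.
  have LH : Lx (lie_br (e 0) f) by have [_ _] := sL; apply.
  have E1 : mxscale 2 (c (e l)) = emx (a * x l + x l * a) o o'.
    rewrite -(centroidZ cc) // -He; have [-> _] := cb _ _ LH Ll.
    rewrite cH /lie_br /e mulmxBl mulmxBr !emxM !eqxx oo ?oo1 subr0 sub0r opprK.
    by apply/matrixP => i j; rewrite !mxE mulrDl.
  have E2 : c (e l) o o' = x l * a.
    have [h1 h2] := cb _ _ Ll Lf; move: (etrans (esym h1) h2) => /matrixP/(_ o o).
    rewrite Ecf /lie_br /e !emxM eqxx /f mxE [X in X + _ = _]mxE (bigD1 o') //= big1 ?addr0; last first.
      by move=> t /negPf to; rewrite emxE to mulr0.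
    rewrite emxE !eqxx /= x01 mulr1 [X in _ + X = _]mxE mxE big1 ?subr0; last first.
      by move=> t _; rewrite emxE oo1 mul0r.
    by move=> ->; rewrite !mxE !eqxx oo1 /= mulr1 mulr0 subr0.
  have /matrixP/(_ o o') := E1; rewrite emxE !eqxx /= mxE E2 scaler_nat mulr2n => e2.
  by apply/esym/(addIr (x l * a)).
have ta : tinv X a = a.
  have [/matrixP/(_ o o') h _] := cm _ Le0; move: h.
  rewrite Ece mxE rev_ordK emxE !eqxx /= sig_rev // mulrCA sigS // mulr1 scaleN1r mxE emxE !eqxx /=.
  by move/oppr_inj.
(* Suppose [u] anticommutes with a degree [l] of [a], which is symmetric. If [u] is symmetric,
   [comm] is contradicted directly; otherwise [l + u] is symmetric and contradicts it instead. *)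
have az : inZ X a.
  move=> l al; have sl : s l = 1.
    by have := congr1 (cf l) ta; rewrite cf_tinv => h; apply: (mulIf al); rewrite mul1r.
  rewrite /gam sl eqxx andbT; apply/negPn/negP => /(not_rad k k1n) [u hu].
  have com v : s v = 1 -> eps l v = eps v l.
    move=> sv; have := congr1 (cf (l + v)) (comm v sv); rewrite cfMx cfxM addrK.
    by move/(mulIf al).
  have [su|su] := ssgn_cases k k0 p u.
    have := eps_neq0 k k1 u l; have := com u su; rewrite hu => /esym/(eq_opp_0 hchar) ->.
    by rewrite eqxx.
  have sul : s (l + u) = 1.
    rewrite ssgnD sl su hu.
    by transitivity (eps u l * eps u l); [ring | apply: epsS].
  have := com _ sul; rewrite epsDr epsDl => /(mulfI (eps_neq0 k k1 l l)) h.
  have := eps_neq0 k k1 u l; rewrite hu in h; rewrite -(eq_opp_0 hchar (esym h)) //.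
  by rewrite eqxx.
exists a => // M LM; apply/eqP; rewrite -subr_eq0; apply/eqP.
have cd := centroid_sub sL cc (inZ_centroid hchar k1n r (-1) az).
apply: (centroid_kill hchar k1n tau2 cd _ r0 _ LM); first by move=> r1; split=> //; apply: ne.
exists o; have EH : hx X (Hd k o) 0 = lie_br (e 0) f.
  by rewrite (Hd_rootmx1 tau2) -long_br !hx_delta.
rewrite EH cH /lie_br /e /f !emxM !eqxx x01 !mulr1.
by rewrite /emx !scale1r scalerBr subrr.
Qed.

End CentroidSymplectic.

Section CentroidOrthogonal.
Variables (k : fieldType) (n : nat) (A : algType k).
Variable (X : torus_str n (pairs_of 0 0) A).
Hypothesis hchar : [pchar k] =i pred0.
Variables (r : nat).
Local Notation m := (r + r)%N.
Local Notation x := (tx X).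
Local Notation Lx := (@Lx k n 0 0 A X r 1).
Hypothesis r2 : (2 < r)%N.

Let tau2 : 1 * 1 = 1 :> k. Proof. by rewrite mulr1. Qed.
Let k1n : (2 * pairs_of 0 0 <= n)%N. Proof. by []. Qed.

Lemma gam_trivial l : gam k 0 0 (l : 'rV[int]_n).
Proof.
apply/andP; split; first by apply/forallP => -[].
by rewrite /ssgn /qf /lf !big_ord0 !addr0.
Qed.

(** Without long roots, a short root vector [e] plays the extremal role, and subtracting [a] gives
    [d] with [d e = 0]. This only kills [Hd i0 - Hd i1]; a third index [i2], on which that element
    has weight 0, then yields the killing of [Hd i0 - Hd i2] and of [Hd i0 + Hd i2], hence of
    [2 Hd i0]. *)
Lemma orthogonal_centroid c : centroid Lx c ->
  exists2 z, inZ X z & forall M, Lx M -> c M = z *: M.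
Proof.
move=> cc; have [cm cl cb] := cc.
have allZ z : inZ X z by move=> l _; apply: gam_trivial.
have com (a b : A) : a * b = b * a by apply: (inZ_comm hchar k1n b (allZ a)).
have sL : lie_sub Lx by apply: Lx_sub.
have lm t : (t < 3)%N -> (t < m)%N by move=> h; apply: ltn_addr; apply: leq_trans r2.
pose i0 : 'I_m := Ordinal (lm 0%N isT); pose i1 : 'I_m := Ordinal (lm 1%N isT).
pose i2 : 'I_m := Ordinal (lm 2%N isT).
have rv (i j : 'I_m) : (i < r)%N -> (j < r)%N -> (j == rev_ord i) = false.
  move=> hi hj; apply/negP => /eqP /(congr1 val) /=.
  by move: (nat_of_ord i) (nat_of_ord j) hi hj; clear; lia.
have h0 : (i0 < r)%N by apply: leq_trans r2.
have h1 : (i1 < r)%N by apply: leq_trans r2.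
have h2 : (i2 < r)%N by [].
have adjE i j : @adjk k r 1 1 (delta_mx i j) = delta_mx (rev_ord j) (rev_ord i) :> 'M[k]_m.
  by rewrite adjk_delta // /sig !if_same !mulr1 scale1r.
have x01 : x 0 = 1 by apply: tx0.
have rootE i j : hx X (@rootmx k r 1 1 i j) 0 = emx 1 i j - emx 1 (rev_ord j) (rev_ord i).
  rewrite /rootmx adjE; apply/matrixP => a b; rewrite hxE x01 !mxE scalerBl.
  by rewrite !mul1r; case: (_ && _); case: (_ && _); rewrite ?scale1r ?scale0r.
have Lr i j : i != j -> Lx (hx X (@rootmx k r 1 1 i j) 0).
  by move=> ij; have := Lx_rootmx X tau2 0 ij; rewrite ssgn0.
have n01 : i0 != i1 by [].
have n10 : i1 != i0 by [].
pose e := hx X (@rootmx k r 1 1 i0 i1) 0; pose f := hx X (@rootmx k r 1 1 i1 i0) 0.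
have Le : Lx e by apply: Lr.
have Lf : Lx f by apply: Lr.
have b01 : (i0 == rev_ord i1) = false by apply: rv.
have b10 : (i1 == rev_ord i0) = false by apply: rv.
have b11 : (i1 == rev_ord i1) = false by apply: rv.
have b00 : (i0 == rev_ord i0) = false by apply: rv.
have c01 : (rev_ord i1 == i0) = false by rewrite eq_sym.
have c10 : (rev_ord i0 == i1) = false by rewrite eq_sym.
have c11 : (rev_ord i1 == i1) = false by rewrite eq_sym.
have c00 : (rev_ord i0 == i0) = false by rewrite eq_sym.
have d01 : (i0 == i1) = false by [].
have d10 : (i1 == i0) = false by [].
have eE : e = emx 1 i0 i1 - emx 1 (rev_ord i1) (rev_ord i0) by apply: rootE.
have fE : f = emx 1 i1 i0 - emx 1 (rev_ord i0) (rev_ord i1) by apply: rootE.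
have ee : e *m e = 0.
  rewrite eE mulmxBl !mulmxBr !emxM !(inj_eq rev_ord_inj) d10 d01 b11 c00.
  by rewrite !subr0.
(* Of the four entries of [M] involved, two lie on the antidiagonal and vanish by skewness, and the
   other two are opposite to each other. *)
have sand M : Lx M -> e *m M *m e = M i1 i0 *: e.
  move=> [/matrixP sM _].
  have sk i j : M i j = - M (rev_ord j) (rev_ord i).
    have := sM i j; rewrite !mxE /sig !if_same mulr1 scale1r (inZ_tinv (allZ _)).
    by move=> ->; rewrite opprK.
  have nn (a : A) : a = - a -> a = 0.
    move=> h; apply: (cfP (X := X)) => l; rewrite cf0; apply: (eq_opp_0 hchar).
    by rewrite -cfN -h.
  have z1 : M i1 (rev_ord i1) = 0 by apply: nn; rewrite {1}sk rev_ordK.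
  have z2 : M (rev_ord i0) i0 = 0 by apply: nn; rewrite {1}sk rev_ordK.
  have z3 : M (rev_ord i0) (rev_ord i1) = - M i1 i0 by rewrite sk !rev_ordK.
  rewrite {1 2}eE mulmxBl mulmxBr !mulmxBl !emx_sandwich !mul1r !mulr1 z1 z2 z3.
  rewrite eE /emx !scale0r subr0 sub0r opprK !scalerBr !scalerA !mulr1.
  by rewrite scaleNr.
have efe : e *m f *m e = e.
  by rewrite sand // fE mxE [X in _ + X]mxE !emxE !eqxx b10 /= subr0 scale1r.
pose a := c f i1 i0.
have Ece : c e = a *: e.
  by rewrite (centroid_extremal hchar sL cc Le Lf ee efe) sand //; apply: cm.
exists a => // M LM; apply/eqP; rewrite -subr_eq0; apply/eqP.
have cd := centroid_sub sL cc (inZ_centroid hchar k1n r 1 (allZ a)).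
set d := (fun _ => _) in cd.
apply: (centroid_kill hchar k1n tau2 cd _ _ _ LM).
- by move=> r1; by move: r2; rewrite r1.
- by apply: leq_ltn_trans r2.
have LH q : Lx (hx X (Hd k q) 0) by apply: Lx_Hd.
have [_ _ db] := cd.
have killed i j : i != j -> j != rev_ord i -> d (hx X (@rootmx k r 1 1 i j) 0) = 0 ->
    d (hx X (Hd k i) 0 - hx X (Hd k j) 0) = 0.
  move=> ij ji dij; rewrite -(Hd_sub_br X tau2) //.
  have ji' : j != i by rewrite eq_sym.
  by have [-> _] := db _ _ (Lr i j ij) (Lr j i ji'); rewrite dij /lie_br mul0mx mulmx0 subr0.
have de : d e = 0 by rewrite /d Ece subrr.
have dH : d (hx X (Hd k i0) 0 - hx X (Hd k i1) 0) = 0.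
  by apply: killed; rewrite ?b10.
pose w t : k := wt k i0 t - wt k i1 t.
have HE : hx X (Hd k i0) 0 - hx X (Hd k i1) 0 = hx X (diag_mx (\row_t w t)) 0.
  rewrite -hxN -hxD; congr (hx X _ 0); apply/matrixP => i j; rewrite !mxE.
  by rewrite -mulrnBl.
(* The root vector at [(i0, j)] has weight [w i0 - w j = 1] under the killed element. *)
have dr j : w j = 0 -> i0 != j -> d (hx X (@rootmx k r 1 1 i0 j) 0) = 0.
  move=> wj ij; have one0 := oner_neq0 k.
  apply: (kill_weight (d := w) cd _ _ (Lr i0 j ij) one0); rewrite -HE //.
    rewrite -mxscaleN1; apply: lie_subD => //.
    by have [_ sc _] := sL; rewrite -[mxscale _ _]addr0; apply: sc => //; apply: Lx0.
  have one : 1 = (wt k i0 i0 - wt k i0 j) - (wt k i1 i0 - wt k i1 j).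
    move: wj; rewrite /w => /eqP; rewrite subr_eq0 => /eqP ->; move: (wt k i1 j) => v.
    have -> : wt k i0 i0 - v - (wt k i1 i0 - v) = wt k i0 i0 - wt k i1 i0 by ring.
    by rewrite /wt eqxx b00 d01 b01 !subr0.
  rewrite [X in mxscale X _]one.
  have -> : lie_br (hx X (Hd k i0) 0 - hx X (Hd k i1) 0) (hx X (@rootmx k r 1 1 i0 j) 0) =
      lie_br (hx X (Hd k i0) 0) (hx X (@rootmx k r 1 1 i0 j) 0) -
      lie_br (hx X (Hd k i1) 0) (hx X (@rootmx k r 1 1 i0 j) 0).
    by rewrite /lie_br mulmxBl mulmxBr !opprB addrACA [RHS]addrACA; congr (_ + _); rewrite addrC.
  by rewrite !Hd_rootmx // [RHS]mxscaleBl.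
have e02 : (i2 == i0) = false by [].
have e12 : (i2 == i1) = false by [].
have f02 : (i2 == rev_ord i0) = false by apply: rv.
have f12 : (i2 == rev_ord i1) = false by apply: rv.
have g02 : (rev_ord i2 == i0) = false by rewrite eq_sym; apply: rv.
have g12 : (rev_ord i2 == i1) = false by rewrite eq_sym; apply: rv.
have w2 : w i2 = 0 by rewrite /w /wt e02 e12 f02 f12 !subr0.
have w2' : w (rev_ord i2) = 0.
  by move/eqP: w2; rewrite /w !wt_rev subr_eq0 => /eqP ->; rewrite subrr.
exists i0.
have n02 : i0 != i2 by rewrite eq_sym e02.
have n02' : i0 != rev_ord i2 by rewrite eq_sym g02.
have K1 := killed i0 i2 n02 (negbT f02) (dr i2 w2 n02).
have K2 : d (hx X (Hd k i0) 0 - hx X (Hd k (rev_ord i2)) 0) = 0.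
  by apply: killed; rewrite ?(inj_eq rev_ord_inj) ?e02 //; apply: dr.
have Hr : hx X (Hd k (rev_ord i2)) 0 = - hx X (Hd k i2) 0.
  rewrite -hxN; congr (hx X _ 0); apply/matrixP => p q.
  by rewrite !mxE /wt rev_ordK -[RHS]mulNrn opprB.
have LN q : Lx (- hx X (Hd k q) 0).
  by rewrite -mxscaleN1; apply: LxZ; apply: Lx_Hd.
have := centroidD cd (lie_subD sL (LH i0) (LN i2)) (lie_subD sL (LH i0) (LN (rev_ord i2))).
rewrite K1 K2 addr0 Hr opprK addrACA addNr addr0 -mulr2n => E.
have : d (mxscale 2 (hx X (Hd k i0) 0)) = 0.
  rewrite -[RHS]E; congr (d _); apply/matrixP => p q.
  by rewrite mxscale_ij scaler_nat mulmxnE.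
rewrite (centroidZ cd) // => /matrixP h; apply/matrixP => p q.
have := h p q; rewrite mxscale_ij [X in _ = X]mxE => /eqP; rewrite scaler_eq0.
by rewrite (negPf (two_neq0 hchar)) => /eqP ->; rewrite mxE.
Qed.

End CentroidOrthogonal.

(** * Free modules over the centroid *)

Section FreeRank.
Variables (k : fieldType) (n k0 p : nat) (A : algType k).
Local Notation k1 := (pairs_of k0 p).
Variable (X : torus_str n k1 A).
Hypothesis hchar : [pchar k] =i pred0.
Hypothesis k1n : (2 * k1 <= n)%N.
Variables (r : nat) (tau : k).
Hypothesis tau2 : tau * tau = 1.
Hypothesis r0 : (0 < r)%N.
Local Notation L := 'rV[int]_n.
Local Notation m := (r + r)%N.
Local Notation x := (tx X).
Local Notation cf := (tcf X).
Local Notation s := (ssgn k k0 p).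
Local Notation eps := (eps k k1).
Local Notation Lx := (@Lx k n k0 p A X r tau).
Local Notation gam := (@gam k n k0 p).
Implicit Types (M W Y : 'M[A]_m) (N : 'M[k]_m) (l u g : L) (z a : A).

Hypothesis centroidE : forall c, centroid Lx c ->
  exists2 z, inZ X z & forall M, Lx M -> c M = z *: M.

Lemma eps_rad l u : radb k1 l -> eps l u = 1.
Proof.
move/forallP => h; apply: (sg_even hchar) => //; rewrite /qf.
apply: (big_ind (fun z : int => ~~ odd `|z|%N)) => // [y z hy hz|a _]; first by clear -hy hz; lia.
by have /andP[_ h1] := h a; rewrite abszM oddM (negPf h1).
Qed.

Lemma gamD l u : gam l -> gam u -> gam (l + u).
Proof.
move=> /andP[/forallP l1 /eqP l2] /andP[/forallP u1 /eqP u2]; apply/andP; split.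
  apply/forallP => a; have := l1 a; have := u1 a; rewrite !entD.
  by move: (ent l _) (ent u _) (ent l _) (ent u _); clear; lia.
rewrite ssgnD l2 u2 !eps_rad ?mulr1 //; exact/forallP.
Qed.

Lemma gamN l : gam l -> gam (- l).
Proof.
move=> /andP[/forallP l1 /eqP l2]; apply/andP; split.
  apply/forallP => a; have := l1 a; rewrite !entN.
  by move: (ent l _) (ent l _); clear; lia.
have := ssgnD k k0 p l (- l); rewrite subrr ssgn0 l2 mul1r epsNl epsNr -mulrA epsS mulr1.
by move=> <-.
Qed.

(** Augmentation sending every monomial to 1. It is multiplicative on [Z], because [eps] is trivial
    on radical degrees, and so provides a [k]-point of [Z]. *)
Definition chi a : k := tlift X (fun _ => 1 : k^o) a.

Lemma chiM z z' : inZ X z -> inZ X z' -> chi (z * z') = chi z * chi z'.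
Proof.
move=> hz _.
have key l : gam l -> chi (x l * z') = chi z'.
  move=> /andP[rl _]; rewrite {1}(tcfE X z') mulr_sumr.
  rewrite /chi (linear_sum (tlift X (fun _ => 1 : k^o))) /tlift; apply: eq_bigr => u _.
  by rewrite -scalerAr txM eps_rad // scale1r -/(tlift _ _ _) linearZ /= tliftx.
rewrite {1}(tcfE X z) mulr_suml /chi (linear_sum (tlift X (fun _ => 1 : k^o))) [in RHS]/tlift mulr_suml.
rewrite big_seq [RHS]big_seq; apply: eq_bigr => l; rewrite mem_tsupp => /hz gl.
by rewrite -scalerAl linearZ /= -/(chi _) key // [_ *: 1]mulr1.
Qed.

Lemma inZ_mul z z' : inZ X z -> inZ X z' -> inZ X (z * z').
Proof.
move=> hz hz' l; rewrite cfM => h.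
have [u uz hu] : exists2 u, u \in tsupp X z & cf (l - u) z' != 0.
  apply/hasP; apply: contraNT h => /hasPn h; rewrite big_seq big1 // => u us.
  by have := h u us; rewrite negbK => /eqP ->; rewrite !mulr0.
by rewrite -(subrK u l); apply: gamD; [apply: hz' | apply: hz; rewrite -mem_tsupp].
Qed.

Lemma inZ_add z z' : inZ X z -> inZ X z' -> inZ X (z + z').
Proof.
move=> hz hz' l; rewrite cfD; case: (eqVneq (cf l z) 0) => [->|/hz //].
by rewrite add0r => /hz'.
Qed.

Lemma inZ_0 : inZ X 0. Proof. by move=> l; rewrite cf0 eqxx. Qed.
Lemma inZ_scale c z : inZ X z -> inZ X (c *: z).
Proof. by move=> hz l; rewrite cfZ mulf_eq0 negb_or => /andP[_ /hz]. Qed.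
Lemma inZ_x l : gam l -> inZ X (x l).
Proof. by move=> gl u; rewrite cfxx; case: (eqVneq l u) => [<-//|_]; rewrite eqxx. Qed.
Lemma inZ_1 : inZ X 1.
Proof.
rewrite -(tx0 X); apply: inZ_x; apply/andP; rewrite ssgn0 eqxx; split=> //.
by apply/forallP => a; rewrite !ent0.
Qed.
Lemma inZ_sum (I : Type) (q : seq I) (P : pred I) (F : I -> A) :
  (forall i, P i -> inZ X (F i)) -> inZ X (\sum_(i <- q | P i) F i).
Proof. by move=> h; apply: big_ind => //; [exact: inZ_0 | exact: inZ_add]. Qed.

Lemma inZ_faithful z : (forall M, Lx M -> z *: M = 0) -> z = 0.
Proof.
move=> h; pose i : 'I_m := Ordinal (ltn_addr r r0).
have := h _ (Lx_Hd X hchar tau2 i) => /matrixP/(_ i i).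
rewrite !mxE eqxx mulr1n tx0 /wt eqxx [i == rev_ord i]eq_sym rev_ord_neq subr0.
by rewrite scale1r mulr1.
Qed.

Lemma free_rankZ (V : 'M[A]_m -> Prop) d : (forall M, V M -> Lx M) -> free_rank Lx V d ->
  exists v : 'I_d -> 'M[A]_m, [/\ forall i, V (v i),
    forall M, V M -> exists z : 'I_d -> A, (forall i, inZ X (z i)) /\ M = \sum_i z i *: v i &
    forall z : 'I_d -> A, (forall i, inZ X (z i)) -> \sum_i z i *: v i = 0 -> forall i, z i = 0].
Proof.
move=> VL [v [vV vg vi]]; exists v; split=> // [M VM|z hz E i].
  have [c [cc E]] := vg M VM.
  have [z hz] := fin_all_exists (fun i =>
    let: ex_intro2 z h1 h2 := centroidE (cc i) in ex_intro (fun z => inZ X z /\ (forall M, Lx M -> c i M = z *: M)) z (conj h1 h2)).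
  exists z; split=> [i|]; first by case: (hz i).
  by rewrite E; apply: eq_bigr => i _; have [_ ->] := hz i; [|apply: VL].
apply: inZ_faithful => M LM.
by apply: (vi (fun i M => z i *: M)) => // i'; apply: inZ_centroid.
Qed.

(** Transition matrices between the two bases multiply to the identity over [Z]; applying [chi] to
    their entries gives matrices over [k] with product 1, where the sizes can be compared. *)
Lemma free_rank_le (V : 'M[A]_m -> Prop) d d' : (forall M, V M -> Lx M) ->
  free_rank Lx V d -> free_rank Lx V d' -> (d <= d')%N.
Proof.
move=> VL /(free_rankZ VL) [v [vV vg vi]] /(free_rankZ VL) [v' [vV' vg' _]].
have [Q hQ] := fin_all_exists (fun i => vg' _ (vV i)).
have [P hP] := fin_all_exists (fun j => vg _ (vV' j)).
apply: (@mulmx1_min k _ _ (\matrix_(i, j) chi (Q i j)) (\matrix_(j, i) chi (P j i))).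
apply/matrixP => i i'; rewrite !mxE.
under eq_bigr do rewrite !mxE.
have ZQ i1 j1 : inZ X (Q i1 j1) by case: (hQ i1).
have ZP i1 j1 : inZ X (P i1 j1) by case: (hP i1).
pose w t := \sum_j Q i j * P j t - (i == t)%:R.
have w0 : forall t, w t = 0.
  apply: vi => [t|].
    apply: inZ_add; first by apply: inZ_sum => j _; apply: inZ_mul.
    by case: (i == t); rewrite ?oppr0; [rewrite -scaleN1r; apply: inZ_scale inZ_1 | apply: inZ_0].
  under eq_bigr do rewrite scalerBl.
  rewrite sumrB [X in _ - X](_ : _ = v i); last first.
    rewrite (bigD1 i) //= eqxx scale1r big1 ?addr0 // => t /negPf ti.
    by rewrite eq_sym ti scale0r.
  have [_ Ei] := hQ i; rewrite [X in _ - X]Ei.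
  apply/eqP; rewrite subr_eq0; apply/eqP.
  under eq_bigr do rewrite scaler_suml.
  rewrite exchange_big; apply: eq_bigr => j _ /=.
  by have [_ ->] := hP j; rewrite scaler_sumr; apply: eq_bigr => t _; rewrite scalerA.
have := w0 i'; rewrite /w => /eqP; rewrite subr_eq0 => /eqP E.
transitivity (chi (\sum_j Q i j * P j i')).
  by rewrite /chi (linear_sum (tlift X (fun _ => 1 : k^o))); apply: eq_bigr => j _; apply/esym; exact: chiM.
rewrite E; case: (i == i'); rewrite ?mulr1n ?mulr0n /chi; last exact: (linear0 (tlift X (fun _ => 1 : k^o))).
by rewrite -(tx0 X) tliftx.
Qed.

Lemma free_rank_uniq (V : 'M[A]_m -> Prop) d d' : (forall M, V M -> Lx M) ->
  free_rank Lx V d -> free_rank Lx V d' -> d = d'.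
Proof. by move=> VL h h'; apply/eqP; rewrite eqn_leq !(free_rank_le VL). Qed.

Section Existence.
Variables (R : finType) (rep : R -> L) (cl : L -> R).
Hypothesis clP : forall l, gam (l - rep (cl l)).
Hypothesis rep_inj : forall b b', gam (rep b - rep b') -> b = b'.
Variables (V : 'M[A]_m -> Prop) (S : L -> {vspace 'M[k]_m}).
Hypothesis VE : forall M, V M <-> forall l, mcf X l M \in S l.
Hypothesis VL : forall M, V M -> Lx M.
Hypothesis Sg : forall l g, gam g -> S (l + g) = S l.

Lemma mcf_scale l z N u : mcf X l (z *: hx X N u) = (cf (l - u) z * eps (l - u) u) *: N.
Proof.
apply/matrixP => i j; rewrite mcfE mxE hxE -scalerAr cfZ cfMx mxE.
by rewrite mulrC [eps _ _ * _]mulrC.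
Qed.

Lemma x_scale c g N u : (c *: x g) *: hx X N u = hx X ((c * eps g u) *: N) (g + u).
Proof.
apply/matrixP => i j; rewrite mxE !hxE -scalerAl -scalerAr txM mxE !scalerA.
by congr (_ *: _); ring.
Qed.

Lemma sum_tag (W : zmodType) (b : R) (F : {b : R & 'I_(\dim (S (rep b)))} -> W) :
  \sum_(t | b == tag t) F t = \sum_i F (Tagged (fun b => 'I_(\dim (S (rep b)))) (i : 'I_(\dim (S (rep b))))).
Proof.
transitivity (\sum_(b' | b == b') \sum_i F (Tagged (fun b => 'I_(\dim (S (rep b)))) (i : 'I_(\dim (S (rep b')))))).
  by rewrite sig_big_dep /=; apply: eq_big => [[b' i]|[b' i] _] //=; rewrite andbT.
by rewrite (big_pred1 b) // => b'; rewrite /= eq_sym.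
Qed.

(** [V] is graded and its components repeat along the support of [Z], so a [k]-basis of the
    component at each coset representative is a [Z]-basis. In a relation, distinct cosets have
    disjoint degrees and cannot interfere. *)
Lemma free_rank_exists : free_rank Lx V (\sum_(b : R) \dim (S (rep b))).
Proof.
pose I := {b : R & 'I_(\dim (S (rep b)))}.
have cardI : #|{: I}| = \sum_(b : R) \dim (S (rep b)).
  rewrite card_tagged sumnE big_map big_enum /=; apply: eq_bigr => b _.
  by rewrite card_ord.
rewrite -cardI.
pose bas (t : I) : 'M[k]_m := (vbasis (S (rep (tag t))))`_(tagged t).
pose v (t : I) := hx X (bas t) (rep (tag t)).
have basS t : bas t \in S (rep (tag t)).
  by apply: vbasis_mem; apply: mem_nth; rewrite size_tuple.
have mcf0S l : (0 : 'M[k]_m) \in S l by apply: mem0v.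
have vV t : V (v t).
  apply/VE => l; rewrite mcf_hx; case: eqP => [<-|_]; [exact: basS | exact: mcf0S].
exists (fun i => v (enum_val i)); split=> //.
  move=> M VM; have [q Eq] := hx_decomp X M.
  pose co l (t : I) := coord (vbasis (S (rep (tag t)))) (tagged t) (mcf X l M).
  pose z (t : I) : A := \sum_(l <- q | cl l == tag t)
    (co l t * eps (l - rep (tag t)) (rep (tag t))) *: x (l - rep (tag t)).
  have zZ t : inZ X (z t).
    by apply: inZ_sum => l /eqP <-; apply: inZ_scale; apply: inZ_x.
  exists (fun i M => z (enum_val i) *: M); split; first by move=> i; apply: inZ_centroid.
  have -> : \sum_(i < #|{: I}|) z (enum_val i) *: v (enum_val i) = \sum_(t : I) z t *: v t.
    rewrite [RHS](reindex (fun i : 'I_#|{: I}| => (enum_val i : I))) //=.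
    by apply: onW_bij; apply: enum_val_bij.
  rewrite {1}Eq.
  under [RHS]eq_bigr do rewrite scaler_suml.
  rewrite (exchange_big_dep xpredT) //=; apply: eq_bigr => l _.
  have Ml : mcf X l M \in S (rep (cl l)).
    have := (VE M).1 VM l; rewrite -{2}(subrK (rep (cl l)) l) addrC Sg //.
  rewrite (coord_vbasis Ml) hx_sum.
  rewrite sum_tag; apply: eq_bigr => i _.
  by rewrite /v x_scale subrK -mulrA epsS mulr1.
move=> c cc E i M LM.
have [z hz] := fin_all_exists (fun i =>
    let: ex_intro2 z h1 h2 := centroidE (cc i) in ex_intro (fun z => inZ X z /\ (forall M, Lx M -> c i M = z *: M)) z (conj h1 h2)).
have [_ ->] := hz i; last by [].
suff -> : z i = 0 by rewrite scale0r.
apply: (cfP (X := X)) => g; rewrite cf0; apply/eqP/negPn/negP => zg.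
have [hzi _] := hz i; have gg := hzi g zg.
pose b := tag (enum_val i).
have vL t : Lx (v t) by apply: VL.
have := congr1 (mcf X (g + rep b)) E; rewrite mcf_sum mcf0.
rewrite (reindex (fun t : I => enum_rank t)) /=; last by apply: onW_bij; apply: enum_rank_bij.
rewrite (eq_bigr (fun t : I => if b == tag t then (cf g (z (enum_rank t)) * eps g (rep b)) *: bas t else 0)); last first.
  move=> t _; rewrite enum_rankK; have [hzt ->] := hz (enum_rank t); last exact: vL.
  rewrite mcf_scale; case: (eqVneq b (tag t)) => [<-|bt]; first by rewrite addrK.
  rewrite (_ : cf _ _ = 0) ?mul0r ?scale0r //; apply/eqP; apply: contraNT bt => /hzt h.
  apply/eqP; apply: rep_inj; rewrite -[rep b](addKr g) -addrA; apply: gamD => //.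
  exact: gamN.
rewrite -big_mkcond sum_tag => e.
have /freeP := basis_free (vbasisP (S (rep b))).
move/(_ (fun i' => cf g (z (enum_rank (Tagged (fun b => 'I_(\dim (S (rep b)))) i' : I))) * eps g (rep b))).
move=> /(_ e (tagged (enum_val i))).
rewrite (_ : enum_rank _ = i); last by rewrite -[RHS]enum_valK; congr enum_rank; rewrite /b; case: (enum_val i).
by move/eqP; rewrite mulf_eq0 (negPf zg) (negPf (eps_neq0 _ _ _ _)).
Qed.

End Existence.
End FreeRank.

(** * Degrees modulo the support of the centre *)

Lemma big_ord_pairs (V : nmodType) (F : nat -> V) a :
  \sum_(i < 2 * a) F i = \sum_(j < a) (F (2 * j)%N + F (2 * j).+1).
Proof.
elim: a => [|a IH]; first by rewrite !big_ord0.
rewrite mulnS !addSn add0n !big_ord_recr /= IH addrA //.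
Qed.

Lemma half_cases (i : nat) : exists a, i = (2 * a)%N \/ i = (2 * a).+1.
Proof. by exists i./2; have := odd_double_half i; case: (odd i); clear; lia. Qed.

Section Representatives.
Variables (k : fieldType) (n k0 p q : nat).
Hypothesis hchar : [pchar k] =i pred0.
Hypothesis nE : n = (2 * k0 + p + q)%N.
Hypothesis ple : (p <= 2)%N.
Local Notation k1 := (pairs_of k0 p).
Local Notation L := 'rV[int]_n.
Local Notation s := (ssgn k k0 p).
Local Notation gam := (@gam k n k0 p).

(** Parities of the first [2 k0 + p] exponents, grouped by tensor factor so that sums over cosets
    split as products. *)
Definition cosets : finType := ({ffun 'I_k0 -> bool * bool} * {ffun 'I_p -> bool})%type.
Implicit Types (b : cosets) (l : L).

Definition cbit b (i : nat) : bool :=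
  if insub i./2 is Some a then (if odd i then (b.1 a).2 else (b.1 a).1)
  else if insub (i - 2 * k0)%N is Some j then b.2 j else false.

Definition rep b : L := \row_i (cbit b i : nat)%:Z.

Definition cl l : cosets :=
  ([ffun a : 'I_k0 => (odd `|ent l (2 * a)|%N, odd `|ent l (2 * a).+1|%N)],
   [ffun j : 'I_p => odd `|ent l (2 * k0 + j)|%N]).

Lemma ent_rep b i : (i < n)%N -> ent (rep b) i = (cbit b i : nat)%:Z.
Proof. by move=> lt; rewrite /ent insubT /= mxE. Qed.

Lemma cbit1 b (a : 'I_k0) : cbit b (2 * a) = (b.1 a).1.
Proof. by rewrite /cbit mul2n doubleK valK odd_double. Qed.
Lemma cbit2 b (a : 'I_k0) : cbit b (2 * a).+1 = (b.1 a).2.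
Proof. by rewrite /cbit mul2n /= uphalf_double valK /= odd_double. Qed.
Lemma cbit3 b (j : 'I_p) : cbit b (2 * k0 + j) = b.2 j.
Proof.
rewrite /cbit addKn valK insubF //.
by rewrite ltnNge -(leq_pmul2l (isT : 0 < 2)%N); have := odd_double_half (2 * k0 + j); lia.
Qed.

Lemma lt_n1 (a : 'I_k0) : (2 * a < n)%N.
Proof. by rewrite nE; have := ltn_ord a; clear; lia. Qed.
Lemma lt_n2 (a : 'I_k0) : ((2 * a).+1 < n)%N.
Proof. by rewrite nE; have := ltn_ord a; clear; lia. Qed.
Lemma lt_n3 (j : 'I_p) : (2 * k0 + j < n)%N.
Proof. by rewrite nE; have := ltn_ord j; clear; lia. Qed.

Lemma ent1 b (a : 'I_k0) : ent (rep b) (2 * a) = ((b.1 a).1 : nat)%:Z.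
Proof. by rewrite ent_rep ?lt_n1 // cbit1. Qed.
Lemma ent2 b (a : 'I_k0) : ent (rep b) (2 * a).+1 = ((b.1 a).2 : nat)%:Z.
Proof. by rewrite ent_rep ?lt_n2 // cbit2. Qed.
Lemma ent3 b (j : 'I_p) : ent (rep b) (2 * k0 + j) = (b.2 j : nat)%:Z.
Proof. by rewrite ent_rep ?lt_n3 // cbit3. Qed.

(** The radical already forces the paired exponents to be even. For [p = 1] the generator of [B_1]
    is unpaired, and there the condition on the sign supplies the missing parity. *)
Lemma gamE l : gam l = [forall i : 'I_(2 * k0 + p), ~~ odd `|ent l i|%N].
Proof.
apply/andP/forallP => [[/forallP rl sl] i|h].
  case: (ltnP i (2 * k1)) => ik.
    have [a ea] := half_cases i.
    have ha : (a < k1)%N by move: (nat_of_ord i) ik ea; clear; lia.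
    by have /andP[h1 h2] := rl (Ordinal ha); case: ea => ->.
  have p1 : p = 1%N.
    by move: (nat_of_ord i) (ltn_ord i) ik ple; rewrite /pairs_of; clear; case: (p =P 2); lia.
  have ki : (i : nat) = (2 * k0)%N.
    by move: (nat_of_ord i) (ltn_ord i) ik; rewrite /pairs_of p1; clear; lia.
  have p1b : p == 1%N by apply/eqP.
  move: sl; rewrite ki /ssgn sg_eq1 // /lf p1b.
  have k1E : k1 = k0 by rewrite /pairs_of p1 addn0.
  have ev j : (j < 2 * k0)%N -> ~~ odd `|ent l j|%N.
    move=> jk; have [a ea] := half_cases j.
    have ha : (a < k1)%N by rewrite k1E; move: jk ea; clear; lia.
    by have /andP[h1 h2] := rl (Ordinal ha); case: ea => ->.
  have e1 : ~~ odd `|qf k1 l l|%N.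
    rewrite /qf; apply: (big_ind (fun z : int => ~~ odd `|z|%N)) => // [y z|a _]; first by clear; lia.
    by rewrite abszM oddM; have /andP[/negPf -> _] := rl a; rewrite andbF.
  have e2 : ~~ odd `|(\sum_(j < 2 * k0) ent l j)%R|%N.
    apply: (big_ind (fun z : int => ~~ odd `|z|%N)) => // [y z|a _]; first by clear; lia.
    exact: ev.
  by move: (qf k1 l l) (\sum_(j < _) _) (ent l _) e1 e2; clear; lia.
have H i : (i < 2 * k0 + p)%N -> ~~ odd `|ent l i|%N by move=> lt; apply: (h (Ordinal lt)).
have H1 i : (i < 2 * k1)%N -> ~~ odd `|ent l i|%N.
  move=> lt; apply: H; apply: leq_trans lt _; rewrite /pairs_of; clear.
  by case: eqP => [->|]; lia.
split; first by apply/forallP => a; rewrite !H1 //; have := ltn_ord a; clear; lia.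
rewrite /ssgn sg_eq1 //.
have e1 : ~~ odd `|qf k1 l l|%N.
  rewrite /qf; apply: (big_ind (fun z : int => ~~ odd `|z|%N)) => // [y z|a _]; first by clear; lia.
  by rewrite abszM oddM negb_and H1 //; have := ltn_ord a; clear; lia.
have e2 : ~~ odd `|lf k0 p l|%N.
  rewrite /lf.
  have e2 : ~~ odd `|(\sum_(j < 2 * k0) ent l j)%R|%N.
    apply: (big_ind (fun z : int => ~~ odd `|z|%N)) => // [y z|a _]; first by clear; lia.
    by apply: H; have := ltn_ord a; clear; lia.
  have e3 : ~~ odd `|(if p == 1%N then ent l (2 * k0) else 0)%R|%N.
    by case: eqP => // p1; apply: H; rewrite p1; clear; lia.
  by move: (\sum_(j < _) _) (if _ then _ else _) e2 e3; clear; lia.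
by move: (qf k1 l l) (lf _ _ _) e1 e2; clear; lia.
Qed.

Lemma cl_gam l : gam (l - rep (cl l)).
Proof.
rewrite gamE; apply/forallP => i; rewrite entD entN.
have par (z : int) (b : bool) : odd `|z|%N = b -> ~~ odd `|(z - (b : nat)%:Z)%R|%N.
  by clear; case: b; lia.
case: (ltnP i (2 * k0)) => ik.
  have [a ea] := half_cases i.
  have ha : (a < k0)%N by move: (nat_of_ord i) ik ea; clear; lia.
  case: ea => ->.
    by rewrite (ent1 _ (Ordinal ha)) /= ffunE; apply: par.
  by rewrite (ent2 _ (Ordinal ha)) /= ffunE; apply: par.
have hj : (i - 2 * k0 < p)%N by move: ik (ltn_ord i); clear; lia.
rewrite -(subnKC ik) (ent3 _ (Ordinal hj)) /= ffunE; exact: par.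
Qed.

Lemma rep_gam_inj b b' : gam (rep b - rep b') -> b = b'.
Proof.
rewrite gamE => /forallP h.
have H i : (i < 2 * k0 + p)%N -> ~~ odd `|(ent (rep b) i - ent (rep b') i)%R|%N.
  by move=> lt; have := h (Ordinal lt); rewrite entD entN.
have bb (c d : bool) : ~~ odd `|((c : nat)%:Z - (d : nat)%:Z)%R|%N -> c = d by case: c; case: d.
case: b b' {h} H => f g [f' g'] H; congr pair.
  apply/ffunP => a.
  have h1 := H (2 * a)%N; have h2 := H (2 * a).+1; move: h1 h2.
  rewrite !ent1 !ent2 /= => h1 h2.
  have la := ltn_ord a.
  rewrite [LHS]surjective_pairing [RHS]surjective_pairing; congr pair; apply: bb.
    by apply: h1; move: la; clear; lia.
  by apply: h2; move: la; clear; lia.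
apply/ffunP => j; have := H (2 * k0 + j)%N; rewrite !ent3 /= => h1; apply: bb; apply: h1.
by rewrite ltn_add2l.
Qed.

(** In [Q(-1)] with [natural] only the trivial class is symmetric, the three others are skew. The
    signs are integers, so that their sums do not depend on [k]. *)
Definition wz (t : bool * bool) : int := if t.1 || t.2 then -1 else 1.
Definition pz (g : {ffun 'I_p -> bool}) : int :=
  if p == 1%N then \prod_j (-1) ^+ (g j) else
  if p == 2%N then 1 - 2 * \prod_j (g j : nat)%:R else 1.
Definition sz b : int := (\prod_a wz (b.1 a)) * pz b.2.

Lemma sz_pm b : sz b = 1 \/ sz b = -1.
Proof.
have pm (u v : int) : (u = 1 \/ u = -1) -> (v = 1 \/ v = -1) -> (u * v = 1 \/ u * v = -1).
  by move=> [->|->] [->|->]; rewrite ?mulr1 ?mul1r ?mulrNN; auto.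
rewrite /sz; apply: (pm).
  by apply: (big_ind (fun z => z = 1 \/ z = -1)) => [|u v|a _]; [left|exact: pm|rewrite /wz; case: ifP; auto].
rewrite /pz; case: ifP => _; last (case: ifP => _; last by left).
  apply: (big_ind (fun z => z = 1 \/ z = -1)) => [|u v|a _]; [by left|exact: pm|].
  by case: (b.2 a); auto.
have [->|->] : \prod_j (b.2 j : nat)%:R = 0 :> int \/ \prod_j (b.2 j : nat)%:R = 1 :> int.
- apply: (big_ind (fun z : int => z = 0 \/ z = 1)) => [|u v [->|->] [->|->]|a _]; rewrite ?mulr0 ?mul0r ?mul1r; auto.
  by case: (b.2 a); auto.
- by left.
by right.
Qed.

Lemma s_rep b : s (rep b) = (sz b)%:~R.
Proof.
rewrite /ssgn sgD rmorphM /=.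
have -> : sg k (qf k1 (rep b) (rep b)) = (\prod_a sg k (((b.1 a).2 && (b.1 a).1 : nat)%:Z)) *
    sg k (if p == 2%N then ent (rep b) (2 * k0).+1 * ent (rep b) (2 * k0)%N else 0).
  rewrite /qf /pairs_of; case: (p == 2%N) => /=.
    rewrite addn1 big_ord_recr /= sgD; congr (_ * _).
    rewrite (big_morph (sg k) (sgD k) (sg0 k)); apply: eq_bigr => a _.
    by rewrite ent1 ent2; case: (b.1 a) => [[] []].
  rewrite addn0 sg0 mulr1 (big_morph (sg k) (sgD k) (sg0 k)); apply: eq_bigr => a _.
  by rewrite ent1 ent2; case: (b.1 a) => [[] []].
rewrite /lf sgD (big_ord_pairs (ent (rep b))) (big_morph (sg k) (sgD k) (sg0 k)).
rewrite mulrCA mulrA mulrA -big_split /= -mulrA; congr (_ * _).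
  rewrite rmorph_prod; apply: eq_bigr => a _; rewrite ent1 ent2 /wz -sgD.
  by case: (b.1 a) => [[] []]; rewrite sg_odd /= ?expr1 ?expr0 ?rmorphN ?rmorph1.
rewrite /pz; case: (p =P 1%N) => p1.
  have p2f : (p == 2%N) = false by rewrite p1.
  rewrite p2f sg0 mul1r.
  have h0 : (0 < p)%N by rewrite p1.
  rewrite -[(2 * k0)%N]addn0 (ent3 b (Ordinal h0)) rmorph_prod (bigD1 (Ordinal h0)) //= big1 ?mulr1.
    by case: (b.2 _).
  by move=> j /eqP []; apply: val_inj => /=;
    have := leq_trans (ltn_ord j) (eq_leq p1); rewrite ltnS leqn0 => /eqP.
rewrite sg0 mulr1; case: (p =P 2) => p2 //.
have h0 : (0 < p)%N by rewrite p2.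
have h1 : (1 < p)%N by rewrite p2.
rewrite -[(2 * k0).+1]addn1 -[(2 * k0)%N]addn0 (ent3 b (Ordinal h0)) addn0 (ent3 b (Ordinal h1)).
rewrite (bigD1 (Ordinal h0)) //= (bigD1 (Ordinal h1)) //= big1 ?mulr1.
  by case: (b.2 _); case: (b.2 _).
move=> j /andP[/eqP j0 /eqP j1]; case: j0; apply: val_inj => /=.
have : (j : nat) != 1%N by apply/eqP => e; apply: j1; apply: val_inj.
by have := leq_trans (ltn_ord j) (eq_leq p2); clear; lia.
Qed.

Lemma s_rep1 b : (s (rep b) == 1) = (sz b == 1).
Proof.
rewrite s_rep; have [->|->] := sz_pm b; first by rewrite !eqxx.
apply/negbTE; rewrite rmorphN rmorph1; apply/eqP => e; have := oner_neq0 k.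
by rewrite (eq_opp_0 hchar (esym e)) eqxx.
Qed.

Lemma card_cosets : #|cosets| = (4 ^ k0 * 2 ^ p)%N.
Proof. by rewrite card_prod !card_ffun card_prod card_bool !card_ord. Qed.

(** The sum factors over the tensor factors: each plane [natural] contributes [1 - 3], the factor
    [B_1] contributes [1 - 1] and [B_2] contributes [3 - 1]. *)
Lemma sum_sz : \sum_b sz b = (-2) ^+ k0 * (if p == 1%N then 0 else if p == 2%N then 2 else 1).
Proof.
rewrite /sz -(pair_big xpredT xpredT (fun (f : {ffun 'I_k0 -> bool * bool}) (g : {ffun 'I_p -> bool}) => \prod_a wz (f a) * pz g)) /=.
under eq_bigr do rewrite -mulr_sumr.
rewrite -mulr_suml; congr (_ * _).
  rewrite -(bigA_distr_bigA (fun (_ : 'I_k0) t => wz t)) prodr_const card_ord; congr (_ ^+ _).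
  rewrite -(pair_big xpredT xpredT (fun x y => wz (x, y))) /= !big_bool /=.
  by rewrite ?big_bool.
rewrite /pz; case: (p =P 1%N) => p1.
  rewrite -(bigA_distr_bigA (fun (_ : 'I_p) (t : bool) => (-1) ^+ t)) prodr_const card_ord p1.
  by rewrite big_bool.
case: (p =P 2) => p2.
  rewrite sumrB sumr_const -mulr_sumr.
  rewrite -(bigA_distr_bigA (fun (_ : 'I_p) (t : bool) => (t : nat)%:R)) prodr_const card_ord p2.
  by rewrite big_bool card_ffun card_bool card_ord ?p2.
by rewrite sumr_const card_ffun card_bool card_ord; move: p1 p2 ple; case: (p) => [|[|[|]]].
Qed.

Definition npos : nat := #|[set b | sz b == 1]|.

Lemma npos_sum : (2 * npos)%:Z = #|cosets|%:Z + \sum_b sz b.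
Proof.
have -> : \sum_b sz b = \sum_b ((if sz b == 1 then 2 else 0) - 1).
  by apply: eq_bigr => b _; have [->|->] := sz_pm b.
rewrite sumrB sumr_const -big_mkcond sumr_const.
have -> : #|(fun b => sz b == 1)| = npos by rewrite /npos cardsE.
rewrite -[2 *+ _]mulr_natl -[1 *+ _]mulr_natl mulr1 PoszM !natz mulrC.
have -> : #|xpredT : pred cosets| = #|cosets| by apply: eq_card.
by rewrite addrC subrK.
Qed.

Lemma rad_rep b i : radb k1 (rep b) -> (i < 2 * k1)%N -> ~~ odd `|ent (rep b) i|%N.
Proof.
move=> /forallP h lt; have [a ea] := half_cases i.
have ha : (a < k1)%N by move: lt ea; clear; lia.
by have /andP[h1 h2] := h (Ordinal ha); case: ea => ->.
Qed.

(** Classes where the trace condition cuts the skew matrices down. A radical class is trivial on all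
    pairs; it can be skew only through the central generator of [B_1]. *)
Lemma exceptional : #|[set b | radb k1 (rep b) && (sz b != 1)]| = (p == 1%N).
Proof.
have gs b : gam (rep b) -> sz b = 1.
  by case/andP => _; rewrite s_rep1 => /eqP.
case: (p =P 1%N) => p1; last first.
  rewrite (_ : [set _ | _] = set0) ?cards0 //; apply/setP => b; rewrite !inE.
  apply/negP => /andP[rb /eqP]; apply; apply: gs; rewrite gamE; apply/forallP => i.
  apply: rad_rep => //; apply: leq_trans (ltn_ord i) _.
  by rewrite /pairs_of; move: p1 ple; case: (p =P 2); clear; lia.
pose b1 : cosets := ([ffun => (false, false)], [ffun => true]).
rewrite (_ : [set _ | _] = [set b1]) ?cards1 //; apply/setP => b; rewrite !inE.
have k1E : k1 = k0 by rewrite /pairs_of (_ : (p == 2%N) = false) ?addn0 //; apply/eqP; rewrite p1.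
have h0 : (0 < p)%N by rewrite p1.
have b1e i : (i < 2 * k0)%N -> ent (rep b1) i = 0.
  move=> lt; have [a ea] := half_cases i.
  have ha : (a < k0)%N by move: lt ea; clear; lia.
  by case: ea => ->; rewrite ?(ent1 b1 (Ordinal ha)) ?(ent2 b1 (Ordinal ha)) /= ffunE.
apply/andP/eqP => [[rb sb]|->].
  apply: rep_gam_inj; rewrite gamE; apply/forallP => i; rewrite entD entN.
  have rbi j : (j < 2 * k0)%N -> ~~ odd `|ent (rep b) j|%N.
    by move=> lt; apply: rad_rep => //; rewrite k1E.
  case: (ltnP i (2 * k0)) => ik; first by rewrite b1e // subr0 rbi.
  have ii : (i : nat) = (2 * k0)%N.
    by have := leq_trans (ltn_ord i) (eq_leq (congr1 (addn (2 * k0)) p1)); move: ik; clear; lia.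
  rewrite ii -[(2 * k0)%N]addn0 (ent3 b1 (Ordinal h0)) /= ffunE (ent3 b (Ordinal h0)).
  case g0 : (b.2 _) => //; case/eqP: sb; apply: gs; rewrite gamE; apply/forallP => j.
  case: (ltnP j (2 * k0)) => jk; first exact: rbi.
  have jj : (j : nat) = (2 * k0)%N.
    by have := leq_trans (ltn_ord j) (eq_leq (congr1 (addn (2 * k0)) p1)); move: jk; clear; lia.
  by rewrite jj -[(2 * k0)%N]addn0 (ent3 b (Ordinal h0)) g0.
split.
  apply/forallP => a; have la := leq_trans (ltn_ord a) (eq_leq k1E).
  by rewrite !b1e //; move: la; clear; lia.
rewrite /sz big1 => [|a _]; last by rewrite ffunE.
rewrite /pz (_ : (p == 1%N) = true); last by apply/eqP.
by rewrite mul1r (eq_bigr (fun=> -1)) => [|j _]; [rewrite prodr_const card_ord p1 | rewrite ffunE].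
Qed.

End Representatives.

(** * Ranks over the centroid *)

Lemma card_below m : #|[pred ij : 'I_m * 'I_m | (ij.2 < rev_ord ij.1)%N]| = 'C(m, 2).
Proof.
rewrite -sum1_card -(pair_big_dep xpredT (fun i j : 'I_m => (j < rev_ord i)%N) (fun _ _ => 1%N)) /=.
rewrite (reindex_inj rev_ord_inj) /= -bin2_sum big_mkord; apply: eq_bigr => i _.
rewrite (eq_bigl (fun j : 'I_m => (j < i)%N)) => [|j]; last first.
  by have := ltn_ord i; move: (nat_of_ord i) (nat_of_ord j); clear; lia.
by rewrite -(big_ord_widen m (fun=> 1%N) (ltnW (ltn_ord i))) sum_nat_const card_ord muln1.
Qed.

Section SkewDimension.
Variables (k : fieldType) (r : nat) (tau : k).
Hypothesis hchar : [pchar k] =i pred0.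
Hypothesis tau2 : tau * tau = 1.
Local Notation m := (r + r)%N.
Local Notation sig := (@sig k r tau).
Local Notation adjk := (@adjk k r tau).
Local Notation skk := (@skk k r tau).
Variable c : k.
Hypothesis c2 : c * c = 1.
Implicit Types (N : 'M[k]_m) (i j : 'I_m).

Definition skew_map N : 'M[k]_m := adjk c N + N.
Lemma skew_map_linear : linear skew_map.
Proof. by move=> a N N'; rewrite /skew_map adjkD adjkZ scalerDr addrACA. Qed.
HB.instance Definition _ := GRing.isLinear.Build k 'M[k]_m 'M[k]_m _ skew_map skew_map_linear.

Definition skv : {vspace 'M[k]_m} := lker (linfun skew_map).

Lemma mem_skv N : (N \in skv) <-> skk c N.
Proof.
rewrite memv_ker lfunE /= /skew_map; split=> [/eqP|->]; last by rewrite addNr.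
by move/eqP; rewrite addr_eq0 => /eqP.
Qed.

Let P : {pred 'I_m * 'I_m} := [pred ij : 'I_m * 'I_m | (ij.2 < rev_ord ij.1)%N || ((ij.2 == rev_ord ij.1) && (tau * c == -1))].

Let PE i j : P (i, j) = (j < rev_ord i)%N || ((j == rev_ord i) && (tau * c == -1)).
Proof. by []. Qed.

Lemma adjkE N i j : adjk c N i j = sig i * sig j * c * N (rev_ord j) (rev_ord i).
Proof. by rewrite mxE. Qed.

Lemma skk_agree N N' : skk c N -> skk c N' -> (forall i j, P (i, j) -> N i j = N' i j) -> N = N'.
Proof.
move=> /matrixP h /matrixP h' e; apply/matrixP => i j.
case: (ltngtP j (rev_ord i)) => lt.
- by apply: e; rewrite PE lt.
- have e1 : N (rev_ord j) (rev_ord i) = N' (rev_ord j) (rev_ord i).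
    by apply: e; rewrite PE rev_ordK lt.
  have := h i j; have := h' i j; rewrite !adjkE !mxE e1 => -> /eqP.
  by rewrite eqr_opp => /eqP.
have ji : j = rev_ord i by apply: val_inj.
case tc : (tau * c == -1); first by apply: e; rewrite PE ji eqxx tc orbT.
have tc1 : tau * c = 1.
  have : (tau * c) * (tau * c) = 1 by transitivity ((tau * tau) * (c * c)); [ring | rewrite tau2 c2 mulr1].
  move/eqP; rewrite -expr2 sqrf_eq1 tc orbF => /eqP //.
have z M : adjk c M i j = (- M) i j -> M i j = 0.
  rewrite adjkE mxE ji rev_ordK sig_rev // => E; apply: (eq_opp_0 hchar); rewrite -E.
  transitivity ((sig i * sig i) * (tau * c) * M i (rev_ord i)); last by ring.
  by rewrite sigS // tc1 !mul1r.
by rewrite (z N (h i j)) (z N' (h' i j)).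
Qed.

Let B (ij : 'I_m * 'I_m) : 'M[k]_m :=
  if (ij.2 < rev_ord ij.1)%N then delta_mx ij.1 ij.2 - adjk c (delta_mx ij.1 ij.2)
  else delta_mx ij.1 ij.2.

Let BD a b : B (a, b) = if (b < rev_ord a)%N then delta_mx a b - adjk c (delta_mx a b) else delta_mx a b.
Proof. by []. Qed.

Let BE ij i j : P ij -> P (i, j) -> B ij i j = ((i, j) == ij)%:R.
Proof.
case: ij => a b; rewrite !PE BD => hab hij.
case: ifP hab => lt hab; last by rewrite mxE -pair_eqE.
rewrite adjk_delta // !mxE -pair_eqE [pair_eq _ _]/=.
rewrite (_ : (i == rev_ord b) && (j == rev_ord a) = false) ?mulr0 ?subr0 //.
apply/negP => /andP[/eqP ib /eqP ja]; move: hij; rewrite ib ja rev_ordK.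
rewrite ltnNge (ltnW lt) => /andP[/eqP e _].
by move: lt; rewrite -e ltnn.
Qed.

Let skB ij : P ij -> skk c (B ij).
Proof.
case: ij => a b; rewrite PE BD; case: ifP => lt; first by move=> _; apply: skk_rootmx.
rewrite orFb.
move=> /andP[/eqP -> /eqP tc]; rewrite /skk adjk_delta // rev_ordK sig_rev //.
have -> : sig a * (tau * sig a) * c = sig a * sig a * (tau * c) by ring.
by rewrite sigS // tc mul1r scaleN1r.
Qed.

(** [adjk] reflects positions in the antidiagonal and multiplies the antidiagonal itself by
    [tau * c]. A skew matrix is therefore free on one side, determined on the other, and on the
    antidiagonal free or zero according to this sign; [P] lists the free positions. *)
Lemma dim_skv : \dim skv = ('C(m, 2) + (if (tau * c == -1)%R then m else 0))%N.
Proof.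
transitivity #|P|; last first.
  pose P1 := [pred ij : 'I_m * 'I_m | (ij.2 < rev_ord ij.1)%N].
  pose P2 := [pred ij : 'I_m * 'I_m | (ij.2 == rev_ord ij.1) && (tau * c == -1)%R].
  have -> : #|P| = #|[predU P1 & P2]| by apply: eq_card.
  have I0 : #|[predI P1 & P2]| = 0%N.
    apply: eq_card0 => -[i j]; rewrite !inE /=.
    by apply/negP => /andP[lt /andP[/eqP e _]]; rewrite e ltnn in lt.
  transitivity (#|[predU P1 & P2]| + #|[predI P1 & P2]|)%N; first by rewrite I0 addn0.
  rewrite cardUI; congr addn; first exact: card_below.
  have <- : (\sum_i \sum_(j : 'I_m | (j == rev_ord i) && (tau * c == -1)%R) 1)%N = #|P2|.
    by rewrite pair_big_dep /= -sum1_card; apply: eq_bigl.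
  case: eqP => _; last by rewrite big1 // => i _; rewrite big1 // => j; rewrite andbF.
  rewrite (eq_bigr (fun=> 1%N)) ?sum_nat_const ?card_ord ?muln1 // => i _.
  by rewrite (big_pred1 (rev_ord i)) // => j; rewrite /= andbT.
pose h0 (v : 'rV[k]_#|P|) : 'M[k]_m := \sum_(t < #|P|) v 0 t *: B (enum_val t).
have h0l : linear h0.
  move=> a u v; rewrite /h0 scaler_sumr -big_split; apply: eq_bigr => t _.
  by rewrite !mxE scalerDl scalerA.
pose h1 : {linear 'rV[k]_#|P| -> 'M[k]_m} := HB.pack h0 (GRing.isLinear.Build k 'rV[k]_#|P| 'M[k]_m _ h0 h0l).
pose h := linfun h1.
have BEt (t t' : 'I_#|P|) : B (enum_val t') (enum_val t).1 (enum_val t).2 = (t == t')%:R.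
  have Pt (u : 'I_#|P|) : P (enum_val u) := enum_valP u.
  have Pt' : P ((enum_val t).1, (enum_val t).2) by rewrite -surjective_pairing; exact: (Pt t).
  by rewrite (BE (Pt t') Pt') -surjective_pairing (inj_eq enum_val_inj).
have hE (v : 'rV[k]_#|P|) (t : 'I_#|P|) : h v (enum_val t).1 (enum_val t).2 = v 0 t.
  rewrite lfunE /= /h0 summxE (bigD1 t) //= mxE BEt eqxx mulr1 big1 ?addr0 // => t' tt.
  by rewrite mxE BEt eq_sym (negPf tt) mulr0.
have hS v : skk c (h v).
  rewrite lfunE; apply/mem_skv; apply: memv_suml => t _; apply: memvZ.
  by apply/mem_skv; exact (skB (enum_valP t)).
have <- : limg h = skv.
  apply/vspaceP => N; apply/idP/idP => [/memv_imgP[v _ ->]|/mem_skv sN]; first exact/mem_skv.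
  pose v : 'rV[k]_#|P| := \row_t N (enum_val t).1 (enum_val t).2.
  have -> : N = h v.
    apply: skk_agree => // i j Pij; have := hE v (enum_rank_in Pij (i, j)).
    by rewrite mxE enum_rankK_in.
  exact: memv_img (memvf _).
rewrite limg_dim_eq; first by rewrite dimvf /dim /= mul1n.
apply/eqP; rewrite capfv -subv0; apply/subvP => v; rewrite memv_ker memv0 => /eqP hv.
by apply/eqP/rowP => t; rewrite -hE hv !mxE.
Qed.

End SkewDimension.

Section TraceZero.
Variables (k : fieldType) (r : nat) (tau : k).
Hypothesis hchar : [pchar k] =i pred0.
Hypothesis tau2 : tau * tau = 1.
Hypothesis r0 : (0 < r)%N.
Local Notation m := (r + r)%N.
Implicit Types (N : 'M[k]_m).

Definition mxtr N : k^o := \tr N.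
Lemma mxtr_linear : linear mxtr.
Proof. by move=> a N N'; rewrite /mxtr linearP. Qed.
HB.instance Definition _ := GRing.isLinear.Build k 'M[k]_m k^o _ mxtr mxtr_linear.

Definition tr0v : {vspace 'M[k]_m} := lker (linfun mxtr).

Lemma mem_tr0v N : (N \in tr0v) = (\tr N == 0).
Proof. by rewrite memv_ker lfunE. Qed.

Lemma skk1_tr N : @skk k r tau 1 N -> \tr N = 0.
Proof.
move=> h; apply: (eq_opp_0 hchar); rewrite -raddfN -h /mxtrace (reindex_inj rev_ord_inj) /=.
apply: eq_bigr => i _; rewrite [RHS]mxE sigS //.
by rewrite !mul1r.
Qed.

Lemma skv1_tr0 : (skv r tau 1 :&: tr0v)%VS = skv r tau 1.
Proof.
apply/capv_idPl/subvP => N /mem_skv h.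
by rewrite mem_tr0v skk1_tr.
Qed.

(** For the sign -1 the identity matrix is skew, and its trace [2 r] is nonzero, so the trace is a
    nonzero functional. *)
Lemma dim_skvN1_tr0 : (\dim (skv r tau (-1) :&: tr0v)).+1 = \dim (skv r tau (-1)).
Proof.
rewrite -[RHS](limg_ker_dim (linfun mxtr)) -addn1; congr addn.
apply/esym/eqP; rewrite eqn_leq.
have -> /= : (\dim (linfun mxtr @: skv r tau (-1)) <= 1)%N.
  by have := dimvS (subvf (linfun mxtr @: skv r tau (-1))); rewrite dimvf.
rewrite lt0n dimv_eq0; apply/eqP => e.
have h1 : (1%:M : 'M[k]_m) \in skv r tau (-1).
  apply/mem_skv/matrixP => i j; rewrite !mxE (inj_eq rev_ord_inj) eq_sym.
  case: eqP => [->|_]; last by rewrite !mulr0n mulr0 oppr0.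
  by rewrite sigS // mul1r mulr1.
have := memv_img (linfun mxtr) h1; rewrite e memv0 lfunE /= /mxtr mxtrace1 => /eqP.
by apply/eqP; apply: (nat_neq0 hchar); rewrite addn_gt0 r0.
Qed.

End TraceZero.

Section Ranks.
Variables (k : fieldType) (n k0 p q : nat) (A : algType k).
Local Notation k1 := (pairs_of k0 p).
Variable (X : torus_str n k1 A).
Hypothesis hchar : [pchar k] =i pred0.
Hypothesis nE : n = (2 * k0 + p + q)%N.
Hypothesis ple : (p <= 2)%N.
Variables (r : nat) (tau : k).
Hypothesis tau2 : tau * tau = 1.
Hypothesis r0 : (0 < r)%N.
Local Notation L := 'rV[int]_n.
Local Notation m := (r + r)%N.
Local Notation s := (ssgn k k0 p).
Local Notation Lx := (@Lx k n k0 p A X r tau).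
Local Notation gam := (@gam k n k0 p).
Local Notation rep := (@rep n k0 p).
Local Notation cl := (@cl n k0 p).
Local Notation cosets := (cosets k0 p).
Local Notation sig := (@sig k r tau).
Local Notation skk := (@skk k r tau).
Local Notation rootmx := (@rootmx k r tau).
Local Notation sz := (@sz k0 p).
Implicit Types (M : 'M[A]_m) (N : 'M[k]_m) (l g : L).

Hypothesis centroidE : forall c, centroid Lx c ->
  exists2 z, inZ X z & forall M, Lx M -> c M = z *: M.

Let k1n : (2 * k1 <= n)%N.
Proof. by rewrite nE /pairs_of; move: ple; case: (p =P 2) => [->|]; clear; lia. Qed.

Lemma ssgn_gam l g : gam g -> s (l + g) = s l.
Proof.
move=> gg; have /andP[rg /eqP sg] := gg; rewrite ssgnD sg mulr1.
have /(radP hchar k1n) h := rg.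
by rewrite -h (eps_rad hchar) // !mulr1.
Qed.

Lemma radb_gam l g : gam g -> radb k1 (l + g) = radb k1 l.
Proof.
move=> /andP[/forallP rg _]; apply: eq_forallb => a; have := rg a; rewrite !entD.
move: (ent l _) (ent g _) (ent l _) (ent g _); clear => u v w z /andP[h1 h2]; congr andb; lia.
Qed.

Definition Lsp l : {vspace 'M[k]_m} :=
  if radb k1 l then (skv r tau (s l) :&: tr0v k r)%VS else skv r tau (s l).

Lemma LspP M : Lx M <-> forall l, mcf X l M \in Lsp l.
Proof.
rewrite LxP; split=> h l; have := h l; rewrite /Lsp.
  case=> h1 h2; case: ifP => rl; last exact/mem_skv.
  by rewrite memv_cap mem_tr0v h2 // eqxx andbT; apply/mem_skv.
case: ifP => rl; last by move/mem_skv.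
by rewrite memv_cap mem_tr0v => /andP[/mem_skv h1 /eqP h2].
Qed.

Lemma Lsp_gam l g : gam g -> Lsp (l + g) = Lsp l.
Proof. by move=> gg; rewrite /Lsp ssgn_gam ?radb_gam. Qed.

Lemma rank_of (S : L -> {vspace 'M[k]_m}) (V : 'M[A]_m -> Prop) :
  (forall M, V M <-> forall l, mcf X l M \in S l) -> (forall M, V M -> Lx M) ->
  (forall l g, gam g -> S (l + g) = S l) -> free_rank Lx V (\sum_(b : cosets) \dim (S (rep b)))%N.
Proof.
move=> VE VL Sg.
exact: (free_rank_exists hchar k1n centroidE (@cl_gam k n k0 p q hchar nE ple)
  (@rep_gam_inj k n k0 p q hchar nE ple) VE VL Sg).
Qed.

Lemma rank_Lx : free_rank Lx Lx (\sum_(b : cosets) \dim (Lsp (rep b)))%N.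
Proof. exact: (rank_of LspP _ Lsp_gam). Qed.

(** The Boolean on the left is the single dimension lost to the trace condition, kept there to avoid
    truncated subtraction. *)
Lemma dim_Lsp b : tau = -1 -> (\dim (Lsp (rep b)) + (radb k1 (rep b) && (sz b != 1)) =
   'C(m, 2) + (if sz b == 1 then m else 0))%N.
Proof.
move=> tE; have c2 := ssgnS k k0 p (rep b); rewrite /Lsp.
have E : (if tau * s (rep b) == -1 then m else 0) = (if sz b == 1 then m else 0).
  by rewrite tE mulN1r eqr_opp (s_rep1 hchar nE ple).
rewrite -{}E; have dv := dim_skv r hchar tau2 c2.
case: (radb k1 (rep b)) => /=; last by rewrite addn0 dv.
rewrite -dv -(s_rep1 hchar nE ple b); have [->|->] := ssgn_cases k k0 p (rep b).
  by rewrite eqxx /= addn0 skv1_tr0.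
have -> : (-1 == 1 :> k) = false by apply/eqP => /esym/(eq_opp_0 hchar)/eqP; rewrite oner_eq0.
by rewrite addn1 dim_skvN1_tr0.
Qed.

Lemma rank_symplectic : tau = -1 -> exists2 d, free_rank Lx Lx d &
  (d + (p == 1%N) = #|cosets| * 'C(m, 2) + npos k0 p * m)%N.
Proof.
move=> tE; exists (\sum_(b : cosets) \dim (Lsp (rep b)))%N; first exact: rank_Lx.
have -> : nat_of_bool (p == 1%N) = (\sum_(b : cosets) (radb k1 (rep b) && (sz b != 1)))%N.
  rewrite -(exceptional hchar nE ple) -sum1dep_card big_mkcond; apply: eq_bigr => b _.
  by case: (_ && _).
rewrite -big_split /=.
rewrite (eq_bigr (fun b => 'C(m, 2) + (if sz b == 1 then m else 0))%N) => [|b _]; last first.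
  exact: dim_Lsp.
rewrite big_split /= sum_nat_const; congr (_ + _)%N.
by rewrite -big_mkcond sum_nat_const; congr (_ * _)%N; rewrite /npos cardsE.
Qed.

Lemma hmx_hx (t : 'I_r) : hmx A t = hx X (Hd k (lshift r t)) 0.
Proof.
apply/matrixP => i j; rewrite hxE tx0 /hmx /Hd !mxE.
have -> : rshift r (rev_ord t) = rev_ord (lshift r t) by apply: val_inj; have := ltn_ord t; rewrite /=; lia.
rewrite /wt; case: (eqVneq i j) => [->|ij].
  by rewrite !andbb mulr1n scalerBl !scaler_nat.
have F u : (i == u) && (j == u) = false.
  by apply/negP => /andP[/eqP iu /eqP ju]; rewrite iu ju eqxx in ij.
by rewrite !F mulr0n scale0r subrr.
Qed.

Lemma intr_eq0_char0 (z : int) : (z%:~R == 0 :> k) = (z == 0).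
Proof.
apply/eqP/eqP => [|->//]; case: z => [[|a]|a] // /eqP.
  by rewrite -[X in X == 0]/(a.+1%:R : k) (negPf (nat_neq0 hchar _)).
by rewrite NegzE rmorphN oppr_eq0 -[X in X == 0]/(a.+1%:R : k) (negPf (nat_neq0 hchar _)).
Qed.

(** Integral version of [wt]: in characteristic 0 nothing is lost, and root conditions become
    integer arithmetic. *)
Definition wti (u t : 'I_m) : int := (t == u : nat)%:Z - (t == rev_ord u : nat)%:Z.

Lemma wt_int u t : wt k u t = (wti u t)%:~R.
Proof. by rewrite /wt /wti rmorphB. Qed.

Lemma rootspaceP (al : 'I_r -> int) M : rootspace Lx al M <->
  Lx M /\ forall t a b, M a b != 0 -> wti (lshift r t) a - wti (lshift r t) b = al t.
Proof.
split=> -[LM h]; split=> //.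
  move=> t a b nz; have /matrixP/(_ a b) := h t; rewrite hmx_hx Hd_br mxscale_ij => /eqP.
  rewrite -subr_eq0 -scalerBl scaler_eq0 (negPf nz) orbF !wt_int -!rmorphB /=.
  by rewrite intr_eq0_char0 subr_eq0 => /eqP.
move=> t; apply/matrixP => a b; rewrite hmx_hx Hd_br mxscale_ij.
have [->|nz] := eqVneq (M a b) 0; first by rewrite !scaler0.
by rewrite !wt_int -rmorphB /= (h t a b nz).
Qed.

Lemma mcf_neq0 M a b : M a b != 0 -> exists l, mcf X l M a b != 0.
Proof.
move=> nz; apply: NNPP => hn; case/eqP: nz; apply: (cfP (X := X)) => l; rewrite cf0.
by apply/eqP/negPn/negP => hl; apply: hn; exists l; rewrite mcfE.
Qed.

Lemma neq0_mcf l M a b : mcf X l M a b != 0 -> M a b != 0.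
Proof. by rewrite mcfE; apply: contraNneq => ->; rewrite cf0. Qed.

Section RootOf.
Variables (al : 'I_r -> int) (i j : 'I_m) (S : L -> {vspace 'M[k]_m}).
Hypothesis alP : forall a b, (forall t, wti (lshift r t) a - wti (lshift r t) b = al t) <->
  (a = i /\ b = j) \/ (a = rev_ord j /\ b = rev_ord i).
Hypothesis SP : forall l N, N \in S l <-> skk (s l) N /\
  forall a b, N a b != 0 -> (a = i /\ b = j) \/ (a = rev_ord j /\ b = rev_ord i).
Hypothesis ij : i != j.

(** A root space is carried by one off-diagonal position and its mirror image. The trace condition
    is then empty, and only skewness in each degree remains. *)
Lemma rootspace_mcf M : rootspace Lx al M <-> forall l, mcf X l M \in S l.
Proof.
rewrite rootspaceP; split=> [[/LxP LM h] l|h].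
  apply/SP; split=> [|a b /neq0_mcf nz]; first by case: (LM l).
  by apply/alP => t; apply: h.
split=> [|t a b /mcf_neq0 [l]]; last by have /SP[_ h'] := h l => /h' /alP.
apply/LxP => l; have /SP[sk supp] := h l; split=> // _.
rewrite /mxtrace big1 // => a _; apply/eqP/negPn/negP => /supp.
case=> -[ea eb]; case/eqP: ij; first by rewrite -ea eb.
by apply: rev_ord_inj; rewrite -eb ea.
Qed.

Lemma rank_root : (forall l g, gam g -> S (l + g) = S l) ->
  free_rank Lx (rootspace Lx al) (\sum_(b : cosets) \dim (S (rep b)))%N.
Proof. by move=> Sg; apply: rank_of => // M; [exact: rootspace_mcf | case]. Qed.

End RootOf.

Lemma skk_entry c N a b : skk c N ->
  N (rev_ord b) (rev_ord a) = - (tau * tau * (sig a * sig b) * c * N a b).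
Proof.
move=> /matrixP/(_ (rev_ord b) (rev_ord a)); rewrite !mxE !rev_ordK !sig_rev // => e.
rewrite -[LHS]opprK -e; congr (- _); ring.
Qed.

(** The position of a long root is its own mirror image, where [adj] acts by [- s l]; the entry is
    free in symmetric degrees and zero in the others. *)
Lemma rank_long : tau = -1 -> free_rank Lx (rootspace Lx (@alpha_2e1 r)) (npos k0 p).
Proof.
move=> tE; pose q0 : 'I_r := Ordinal r0; pose i0 : 'I_m := lshift r q0.
pose S l : {vspace 'M[k]_m} := if s l == 1 then <[delta_mx i0 (rev_ord i0)]>%VS else 0%VS.
have -> : npos k0 p = (\sum_(b : cosets) \dim (S (rep b)))%N.
  rewrite /npos -sum1dep_card big_mkcond; apply: eq_bigr => b _.
  rewrite /S (s_rep1 hchar nE ple); case: ifP; rewrite ?dimv0 // dim_vline => _.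
  case: eqP => // /matrixP/(_ i0 (rev_ord i0)); rewrite !mxE !eqxx => /eqP.
  by rewrite oner_eq0.
apply: (@rank_root _ i0 (rev_ord i0)) => [a b|l N||l g gg].
- rewrite rev_ordK; split=> [/(_ q0)|h t].
    rewrite /alpha_2e1 eqxx -/i0 /wti.
    case: (a =P i0) => ha; case: (a =P rev_ord i0) => ha'; case: (b =P i0) => hb;
      case: (b =P rev_ord i0) => hb' //= e; try (by left); by exfalso; move: e; clear; lia.
  have [-> ->] : a = i0 /\ b = rev_ord i0 by case: h.
  rewrite /wti /alpha_2e1 (inj_eq rev_ord_inj) -!val_eqE /=; have := ltn_ord t.
  move: (nat_of_ord t); clear => u; case: (u =P 0%N) => [->|]; lia.
- split=> [|[sk supp]]; rewrite /S.
    case: eqP => [sl|_]; last first.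
      by rewrite memv0 => /eqP ->; split=> [|a b]; [apply/mem_skv; apply: mem0v | rewrite mxE eqxx].
    move=> /vlineP[c ->]; rewrite sl; split.
      by rewrite /skk adjkZ tE (skk_long i0 (erefl 1)) scalerN.
    move=> a b; rewrite !mxE; case: (a =P i0) => [->|_]; last by rewrite mulr0 eqxx.
    by case: (b =P _) => [->|_]; [left | rewrite mulr0 eqxx].
  have E : N = N i0 (rev_ord i0) *: delta_mx i0 (rev_ord i0).
    apply/matrixP => a b; rewrite [RHS]mxE [delta_mx _ _ _ _]mxE.
    case: (boolP ((a == i0) && (b == rev_ord i0))) => [/andP[/eqP -> /eqP ->]|ne]; first by rewrite mulr1.
    rewrite mulr0; apply/eqP; apply: contraNT ne => /supp; rewrite rev_ordK.
    by case=> -[-> ->]; rewrite !eqxx.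
  case: ifP => sl; first by rewrite E; apply/vlineP; eexists.
  rewrite E memv0 scaler_eq0; apply/orP; left.
  have := skk_entry i0 (rev_ord i0) sk; rewrite rev_ordK sig_rev //.
  have [sl1|->] := ssgn_cases k k0 p l; first by rewrite sl1 eqxx in sl.
  have -> : - (tau * tau * (sig i0 * (tau * sig i0)) * -1 * N i0 (rev_ord i0)) =
    (sig i0 * sig i0) * (tau * tau) * tau * N i0 (rev_ord i0) by ring.
  by rewrite sigS // tau2 tE !mul1r mulN1r => e; apply/eqP/(eq_opp_0 hchar).
- by rewrite eq_sym rev_ord_neq.
by rewrite /S ssgn_gam.
Qed.

(** The position of a short root differs from its mirror image, so one entry is free in every degree
    and determines the other. *)
Lemma rank_short : (1 < r)%N -> free_rank Lx (rootspace Lx (@alpha_e1e2 r)) #|cosets|.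
Proof.
move=> r1; pose q0 : 'I_r := Ordinal r0; pose i0 : 'I_m := lshift r q0.
pose q1 : 'I_r := Ordinal r1; pose i1 : 'I_m := lshift r q1.
pose S l : {vspace 'M[k]_m} := <[rootmx (s l) i0 i1]>%VS.
have i01 : i0 != i1 by rewrite -val_eqE.
have r11 c : rootmx c i0 i1 i0 i1 = 1.
  rewrite /rootmx adjk_delta // !mxE !eqxx -!val_eqE /=.
  by rewrite (_ : (0 == _)%N = false) ?mulr0 ?subr0 //; clear -r1; lia.
have -> : #|cosets| = (\sum_(b : cosets) \dim (S (rep b)))%N.
  rewrite -sum1_card; apply: eq_bigr => b _; rewrite /S dim_vline.
  case: eqP => // /matrixP/(_ i0 i1); rewrite r11 mxE => /eqP.
  by rewrite oner_eq0.
apply: (@rank_root _ i0 i1) => // [a b|l N|l g gg].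
- have disj (u : 'I_m) : ((u == i0) + (u == rev_ord i0) + (u == i1) + (u == rev_ord i1) <= 1)%N.
    rewrite -!val_eqE /=; move: (nat_of_ord u); clear -r1; lia.
  split=> [h|h t].
    have := h q0; have := h q1; rewrite /alpha_e1e2 /= /wti -/i0 -/i1.
    have := disj a; have := disj b => da db e1 e0.
    have : (a == i0) && (b == i1) || (a == rev_ord i1) && (b == rev_ord i0).
      move: da db e1 e0.
      move: (a == i0) (a == rev_ord i0) (a == i1) (a == rev_ord i1).
      move: (b == i0) (b == rev_ord i0) (b == i1) (b == rev_ord i1).
      by clear; lia.
    by case/orP => /andP[/eqP -> /eqP ->]; [left | right].
  have lt := ltn_ord t; rewrite /alpha_e1e2 /wti.
  case: h => -[-> ->]; rewrite -!val_eqE /=; move: (nat_of_ord t) lt; clear -r1 => -[|[|u]] /= lt; lia.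
- have r10 c : rootmx c i0 i1 (rev_ord i1) (rev_ord i0) = - (sig i0 * sig i1 * c).
    rewrite /rootmx adjk_delta // !mxE !eqxx mulr1 (_ : (rev_ord i1 == i0) = false) ?sub0r //.
    by rewrite -val_eqE /=; clear -r1; lia.
  have r1z c a b : ~~ ((a == i0) && (b == i1)) -> ~~ ((a == rev_ord i1) && (b == rev_ord i0)) ->
      rootmx c i0 i1 a b = 0.
    by move=> /negPf h1 /negPf h2; rewrite /rootmx adjk_delta // !mxE h1 h2 mulr0 subrr.
  split=> [|[sk supp]]; rewrite /S.
    move=> /vlineP[c ->]; split.
      have /= := skk_rootmx tau2 i0 i1 (ssgnS k k0 p l).
      by rewrite /skk adjkZ => ->; rewrite scalerN.
    move=> a b; rewrite mxE; have [/andP[/eqP -> /eqP ->] _|h1] := boolP ((a == i0) && (b == i1)); first by left.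
    have [/andP[/eqP -> /eqP ->] _|h2] := boolP ((a == rev_ord i1) && (b == rev_ord i0)); first by right.
    by rewrite r1z // mulr0 eqxx.
  apply/vlineP; exists (N i0 i1); apply/matrixP => a b; rewrite [RHS]mxE.
  have [/andP[/eqP -> /eqP ->]|h1] := boolP ((a == i0) && (b == i1)); first by rewrite r11 mulr1.
  have [/andP[/eqP -> /eqP ->]|h2] := boolP ((a == rev_ord i1) && (b == rev_ord i0)).
    by rewrite (skk_entry _ _ sk) r10 tau2; ring.
  rewrite r1z // mulr0; apply/eqP/negPn/negP => /supp.
  by case=> -[ea eb]; [move: h1 | move: h2]; rewrite ea eb !eqxx.
by rewrite /S ssgn_gam.
Qed.

End Ranks.

(** * Nilpotent elements and the number r *)

Lemma pred_lt m : (0 < m)%N -> (m.-1 < m)%N. Proof. by case: m. Qed.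

Section Shift.
Variables (k : fieldType) (m : nat) (a : nat -> k).

Definition shiftmx : 'M[k]_m := \matrix_(i, j) (if (j == i.+1 :> nat) then a i else 0).

Lemma shiftmx_exp t (i j : 'I_m) :
  (shiftmx ^+ t) i j = (\prod_(i <= u < i + t) a u) *+ (j == i + t :> nat)%N.
Proof.
elim: t i => [|t IH] i; first by rewrite addn0 big_geq // expr0 !mxE -val_eqE eq_sym.
rewrite exprS -[_ * _]/(_ *m _) mxE.
case: (ltnP i.+1 m) => lt; last first.
  rewrite big1 => [|u _]; last by rewrite mxE (_ : (_ == _) = false) ?mul0r //; have := ltn_ord u; move: lt; clear; lia.
  by rewrite (_ : (_ == _) = false) //; have := ltn_ord j; move: lt; clear; lia.
rewrite (bigD1 (Ordinal lt)) //= big1 ?addr0 => [|u]; last first.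
  by rewrite -val_eqE /= => /negPf ui; rewrite mxE ui mul0r.
rewrite mxE eqxx IH /= mulrnAr addSnnS; congr (_ *+ _).
by rewrite [RHS]big_ltn // addnS ltnS leq_addr.
Qed.

Lemma shiftmx_nilp : shiftmx ^+ m = 0.
Proof.
apply/matrixP => i j; rewrite shiftmx_exp mxE (_ : (_ == _) = false) //.
by have := ltn_ord j; clear; lia.
Qed.

Lemma shiftmx_top (m0 : (0 < m)%N) : shiftmx ^+ m.-1 =
  (\prod_(0 <= u < m.-1) a u) *: delta_mx (Ordinal m0) (Ordinal (pred_lt m0)).
Proof.
apply/matrixP => i j; rewrite shiftmx_exp !mxE -!val_eqE /=.
have := ltn_ord j; case: (eqVneq (i : nat) 0%N) => [->|i0] lt /=.
  by rewrite add0n mulr_natr.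
rewrite mulr0 (_ : (_ == _) = false) ?mulr0n //.
by move: lt i0; clear; lia.
Qed.
End Shift.

Lemma shiftmxN (k : fieldType) m (a : nat -> k) : shiftmx m (fun i => - a i) = - shiftmx m a.
Proof. by apply/matrixP => i j; rewrite !mxE; case: ifP; rewrite ?oppr0. Qed.

(** With total exponent [2 m - 2] and nilpotency index at most [m], only the middle term survives,
    with exponent [m - 1] on both sides; its binomial coefficient is nonzero in characteristic 0. *)
Lemma ad_shift_neq0 (k : fieldType) m (a : nat -> k) (m0 : (0 < m)%N) :
  [pchar k] =i pred0 -> (forall i, a i != 0) ->
  iter (2 * m - 2) (fun z => shiftmx m a * z - z * shiftmx m a)
    (delta_mx (Ordinal (pred_lt m0)) (Ordinal m0)) != 0.
Proof.
move=> hchar a0; have m1 := m0; set last_ := Ordinal _; set first_ := Ordinal m0.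
rewrite iter_ad; have lt : (m.-1 < (2 * m - 2).+1)%N by move: m1; clear; lia.
rewrite (bigD1 (Ordinal lt)) //= big1 ?addr0; last first.
  move=> i; rewrite -val_eqE /= => ni; case: (leqP m i) => mi.
    by rewrite exprNn (expr_eq0_le (shiftmx_nilp m a) mi) !mulr0 mul0rn.
  rewrite (expr_eq0_le (shiftmx_nilp m a)) ?mul0r ?mul0rn //.
  by move: (nat_of_ord i) ni mi m1; clear; lia.
have -> : (2 * m - 2 - m.-1 = m.-1)%N by move: m1; clear; lia.
rewrite -shiftmxN !(shiftmx_top _ m0) -/first_ -/last_.
rewrite -!mulmxE -!scalemxAl -!scalemxAr !mul_delta_mx -scaler_nat !scalerA.
apply/eqP => /matrixP/(_ first_ last_); rewrite !mxE !eqxx mulr1; apply/eqP.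
rewrite !mulf_neq0 //; first by apply: (nat_neq0 hchar); rewrite bin_gt0; clear; lia.
  by apply: (big_ind (fun z => z != 0)) => [|x y|]; rewrite ?oner_neq0 //; exact: mulf_neq0.
apply: (big_ind (fun z => z != 0)) => [|x y|]; rewrite ?oner_neq0 //; first exact: mulf_neq0.
by move=> i _; rewrite oppr_eq0.
Qed.

(** Phrased by brackets alone, hence invariant under isomorphism. The equation between [h] and [e]
    is the Lie-theoretic condition that makes the matrix [e] nilpotent. *)
Definition sl2_depth (k : fieldType) (A : algType k) m (L : 'M[A]_m -> Prop) t : Prop :=
  exists h e y, [/\ L h, L e, L y, lie_br h e = mxscale 2 e &
    iter t (fun z => lie_br e z) y <> 0].

Lemma sl2_depth_pair (k : fieldType) (A B : algType k) m1 m2 (L1 : 'M[A]_m1 -> Prop)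
    (L2 : 'M[B]_m2 -> Prop) f g t : lie_sub L1 -> lie_sub L2 ->
  lie_pair L1 L2 f g -> sl2_depth L1 t -> sl2_depth L2 t.
Proof.
move=> s1 s2 [[fL fl fb] gh gf fg] [h [e [y [Lh Le Ly he ne]]]].
have fh : lie_hom L1 L2 f by split.
have f0 := lie_hom0 s1 fh; have [z1 sc1 b1] := s1.
exists (f h), (f e), (f y); split; try exact: fL.
  by rewrite -fb // he -[mxscale 2 e]addr0 fl // f0 addr0.
move=> E; apply: ne.
have Lt u : L1 (iter u (fun z => lie_br e z) y) by elim: u => //= u IH; apply: b1.
have Et u : iter u (fun z => lie_br (f e) z) (f y) = f (iter u (fun z => lie_br e z) y).
  by elim: u => //= u ->; rewrite -fb.
rewrite -(gf _ (Lt t)) -Et E; exact: (lie_hom0 s2 gh).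
Qed.

Section Depth.
Variables (k : fieldType) (n k0 p : nat) (A : algType k).
Local Notation k1 := (pairs_of k0 p).
Variable (X : torus_str n k1 A).
Hypothesis hchar : [pchar k] =i pred0.
Variables (r : nat).
Hypothesis r0 : (0 < r)%N.
Local Notation m := (r + r)%N.

Let tau2 : (-1) * (-1) = 1 :> k. Proof. by rewrite mulrNN mulr1. Qed.

(** Principal [sl_2] in degree 0: [E] is a regular nilpotent, [H] gives the principal grading, and
    [Y] is a lowest root vector, which [ad E] raises through the whole grading. *)
Lemma symplectic_depth : sl2_depth (@Lx k n k0 p A X r (-1)) (4 * r - 2).
Proof.
have m0 : (0 < m)%N by rewrite addn_gt0 r0.
(* The change of sign halfway makes the superdiagonal matrix skew for the symplectic form. *)
pose a (i : nat) : k := if (i < r)%N then 1 else -1.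
pose H : 'M[k]_m := diag_mx (\row_i (m%:R - 1 - 2 * (i : nat)%:R)).
pose E := shiftmx m a; set Y : 'M[k]_m := delta_mx (Ordinal (pred_lt m0)) (Ordinal m0).
have aE i : (i.+1 < m)%N -> a (m - i.+2)%N * ((if (i < r)%N then 1 else -1) * (if (i.+1 < r)%N then 1 else -1)) = - a i.
  move=> lt; rewrite /a; case: (ltnP i r) => c1; case: (ltnP i.+1 r) => c2; case: (ltnP (m - i.+2) r) => c3;
    rewrite ?mulr1 ?mulrN1 ?opprK ?mulr1 ?mulrN1 ?opprK //; exfalso; clear -c1 c2 c3 lt; lia.
have skE : skk (r := r) (-1) 1 E.
  apply/matrixP => i j; rewrite !mxE /= /sig.
  case: (eqVneq (j : nat) i.+1) => ij.
    have lt : (i.+1 < m)%N by rewrite -ij.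
    have -> : (m - i.+1 == (m - j.+1).+1)%N = true by rewrite ij; clear -lt; lia.
    by rewrite ij mulr1 mulrC aE.
  have -> : (m - i.+1 == (m - j.+1).+1)%N = false.
    by have := ltn_ord i; have := ltn_ord j; move: (nat_of_ord i) (nat_of_ord j) ij; clear; lia.
  by rewrite mulr0 oppr0.
have skH : skk (r := r) (-1) 1 H.
  apply/matrixP => i j; rewrite !mxE (inj_eq rev_ord_inj) eq_sym.
  case: (eqVneq i j) => [->|_]; last by rewrite !mulr0n mulr0 oppr0.
  rewrite sigS // !mul1r !mulr1n /= natrB; last exact: ltn_ord.
  rewrite -natr1; ring.
have skY : skk (r := r) (-1) 1 Y.
  by rewrite /Y (_ : Ordinal m0 = rev_ord (Ordinal (pred_lt m0))); [exact: skk_long | apply: val_inj => /=; clear -m0; lia].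
have LL N : skk (r := r) (-1) 1 N -> @Lx k n k0 p A X r (-1) (hx X N 0).
  by move=> h; apply: Lx_hx; rewrite ?ssgn0 // => _; apply: (skk1_tr hchar tau2 h).
exists (hx X H 0), (hx X E 0), (hx X Y 0); split; try exact: LL.
  apply/matrixP => i j; rewrite diag_br mxscale_ij !hxE !mxE.
  case: (eqVneq (j : nat) i.+1) => [->|_]; last by rewrite !scale0r !scaler0.
  by rewrite !scalerA -natr1; congr (_ *: _); ring.
have -> : (4 * r - 2 = 2 * m - 2)%N by clear; lia.
have Et u : iter u (fun z => lie_br (hx X E 0) z) (hx X Y 0) = hx X (iter u (fun z => E * z - z * E) Y) 0.
  by elim: u => //= u ->; rewrite hx_br0.
rewrite Et => e.
have a0 i : a i != 0 by rewrite /a; case: ifP; rewrite ?oppr_eq0 oner_neq0.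
have /eqP := ad_shift_neq0 m0 hchar a0; apply.
by have := mcf_hx X 0 0 (iter (2 * m - 2) (fun z => E * z - z * E) Y); rewrite eqxx e mcf0.
Qed.

Lemma depth_bound tau t : (4 * r - 1 <= t)%N -> ~ sl2_depth (@Lx k n k0 p A X r tau) t.
Proof.
move=> le [h [e [y [_ _ _ he ne]]]]; apply: ne.
apply: (sl2_ad_bound X hchar (h := h)); last by clear -le; lia.
by rewrite he; apply/matrixP => i j; rewrite mxscale_ij mulmxnE scaler_nat.
Qed.

End Depth.

Lemma rank_invariant (k : fieldType) n1 k1 p1 n2 k2 p2 (A B : algType k)
    (X : torus_str n1 (pairs_of k1 p1) A) (Y : torus_str n2 (pairs_of k2 p2) B) r1 r2 f g :
  [pchar k] =i pred0 -> (2 * pairs_of k1 p1 <= n1)%N -> (2 * pairs_of k2 p2 <= n2)%N ->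
  (0 < r1)%N -> (0 < r2)%N ->
  lie_pair (@Lx k n1 k1 p1 A X r1 (-1)) (@Lx k n2 k2 p2 B Y r2 (-1)) f g -> r1 = r2.
Proof.
move=> hchar h1 h2 r10 r20 fg; have t2 : (-1) * (-1) = 1 :> k by rewrite mulrNN mulr1.
have s1 := Lx_sub r1 (tau := -1) X hchar h1 t2.
have s2 := Lx_sub r2 (tau := -1) Y hchar h2 t2.
have d1 := sl2_depth_pair s1 s2 fg (symplectic_depth X hchar r10).
have d2 := sl2_depth_pair s2 s1 (lie_pair_sym fg) (symplectic_depth Y hchar r20).
case: (ltngtP r1 r2) => // lt; exfalso.
  by apply: (depth_bound hchar _ d2); clear -lt; lia.
by apply: (depth_bound hchar _ d1); clear -lt; lia.
Qed.

(** * The nullity *)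

Section PointDerivation.
Variables (k : fieldType) (n k0 p : nat) (A : algType k).
Variable (X : torus_str n (pairs_of k0 p) A).
Hypothesis hchar : [pchar k] =i pred0.
Variable phi : 'rV[int]_n -> k.
Hypothesis phiD : forall l u, phi (l + u) = phi l + phi u.
Local Notation chi := (@chi k n k0 p A X).
Local Notation inZ := (@inZ k n k0 p A X).

(** The invariant derivation scaling [x l] by [phi l], followed by the augmentation: on [Z], a
    tangent vector at the point [chi]. *)
Definition pder (a : A) : k := tlift X (fun l => phi l : k^o) a.

Lemma pder0 : pder 0 = 0. Proof. exact: (linear0 (tlift X (fun l => phi l : k^o))). Qed.
Lemma pderD a b : pder (a + b) = pder a + pder b.
Proof. exact: (linearD (tlift X (fun l => phi l : k^o))). Qed.
Lemma pderZ c a : pder (c *: a) = c * pder a.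
Proof. by rewrite /pder linearZ. Qed.
Lemma pderx l : pder (tx X l) = phi l. Proof. by rewrite /pder tliftx. Qed.
Lemma chi_0 : chi 0 = 0. Proof. exact: (linear0 (tlift X (fun _ => 1 : k^o))). Qed.
Lemma chi_D a b : chi (a + b) = chi a + chi b.
Proof. exact: (linearD (tlift X (fun _ => 1 : k^o))). Qed.
Lemma chi_Z c a : chi (c *: a) = c * chi a.
Proof. by rewrite /chi linearZ. Qed.
Lemma chi_x l : chi (tx X l) = 1. Proof. by rewrite /chi tliftx. Qed.

Lemma inZ_ind (P : A -> Prop) : P 0 -> (forall a b, P a -> P b -> P (a + b)) ->
  (forall c g, gam k k0 p g -> P (c *: tx X g)) -> forall z, inZ z -> P z.
Proof.
move=> P0 PD Px z hz; rewrite (tcfE X z) big_seq; apply: big_ind => // l.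
by rewrite mem_tsupp => /hz; apply: Px.
Qed.

Lemma pderM z z' : inZ z -> pder (z * z') = chi z * pder z' + pder z * chi z'.
Proof.
move=> hz; apply: (inZ_ind (P := fun z => pder (z * z') = chi z * pder z' + pder z * chi z')) hz.
- by rewrite mul0r pder0 chi_0 !mul0r addr0.
- by move=> a b Ea Eb; rewrite mulrDl !pderD chi_D Ea Eb; ring.
move=> c g /andP[rg _]; rewrite -scalerAl !pderZ chi_Z chi_x pderx mulr1.
rewrite -mulrA -mulrDr; congr (_ * _).
elim/(torus_elem_ind (X := X)): z' => [|a b Ea Eb|d u].
- by rewrite mulr0 pder0 chi_0 mulr0 addr0.
- by rewrite mulrDr !pderD chi_D Ea Eb; ring.
by rewrite -scalerAr txM (eps_rad hchar) // scale1r !pderZ chi_Z chi_x !pderx phiD; ring.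
Qed.

End PointDerivation.

(** The support of [Z] thus has full rank [n], and [Z] sees the nullity. *)
Lemma gam_double (k : fieldType) n k0 p (l : 'rV[int]_n) : [pchar k] =i pred0 ->
  gam k k0 p (l + l).
Proof.
move=> hchar; apply/andP; split.
  by apply/forallP => a; rewrite !entD; move: (ent l _) (ent l _); clear; lia.
rewrite ssgnD ssgnS mul1r; apply/eqP; exact: epsS.
Qed.

Section Nullity.
Variables (k : fieldType) (n1 c1 p1 n2 c2 p2 : nat) (A B : algType k).
Variables (X : torus_str n1 (pairs_of c1 p1) A) (Y : torus_str n2 (pairs_of c2 p2) B).
Hypothesis hchar : [pchar k] =i pred0.
Variable th : A -> B.
Hypothesis thZ : forall z, inZ X z -> inZ Y (th z).
Hypothesis th_lin : forall c z z', inZ X z -> inZ X z' -> th (c *: z + z') = c *: th z + th z'.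
Hypothesis thM : forall z z', inZ X z -> inZ X z' -> th (z * z') = th z * th z'.
Hypothesis th1 : th 1 = 1.
Hypothesis th_surj : forall w, inZ Y w -> exists2 z, inZ X z & th z = w.
Local Notation gamX := (@gam k n1 c1 p1).

Let chi' (z : A) : k := chi Y (th z).
Let chi'M z z' : inZ X z -> inZ X z' -> chi' (z * z') = chi' z * chi' z'.
Proof. by move=> h h'; rewrite /chi' thM // chiM //; apply: thZ. Qed.

Let xD g h : gamX g -> tx X (g + h) = tx X g * tx X h.
Proof. by move=> /andP[rg _]; rewrite txM (eps_rad hchar) // scale1r. Qed.

Let chi'_x g : gamX g -> chi' (tx X g) != 0.
Proof.
move=> gg; have gn := gamN gg; apply/eqP => e.
have : chi' (tx X g * tx X (- g)) = 1.
  by rewrite -xD // subrr tx0 /chi' th1 -(tx0 Y) chi_x.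
by rewrite chi'M ?e ?mul0r; [move/eqP; rewrite eq_sym oner_eq0 | apply: inZ_x | apply: inZ_x].
Qed.

Lemma th0 : th 0 = 0.
Proof. by have := th_lin (-1) (@inZ_0 _ _ _ _ _ X) (@inZ_0 _ _ _ _ _ X); rewrite scaler0 addr0 scaleN1r addNr. Qed.

(* A point derivation at the character [chi' = chi o th] which kills the squares of the
   generators kills the whole centre, as [x_g ^ 2] is a monomial in these squares. *)
Lemma nullity_le : (n2 <= n1)%N.
Proof.
rewrite leqNgt; apply/negP => lt.
pose e i : 'rV[int]_n1 := delta_mx 0 i.
pose D (v : 'rV[k]_n2) := pder Y (fun l => \sum_j v 0 j * (l 0 j)%:~R).
have DD (v : 'rV[k]_n2) : forall l u : 'rV[int]_n2, \sum_j v 0 j * ((l + u) 0 j)%:~R =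
    \sum_j v 0 j * (l 0 j)%:~R + \sum_j v 0 j * (u 0 j)%:~R :> k.
  by move=> l u; rewrite -big_split; apply: eq_bigr => j _; rewrite mxE rmorphD mulrDr.
(* The [n2] coordinate derivations are evaluated on the images of the [n1] squares; if [n1 < n2], a
   nonzero combination [v] vanishes on all of them. *)
pose M : 'M[k]_(n2, n1) := \matrix_(j, i) D (delta_mx 0 j) (th (tx X (e i + e i))).
have Dlin v w : D v w = \sum_j v 0 j * D (delta_mx 0 j) w.
  elim/(torus_elem_ind (X := Y)): w => [|a b Ea Eb|c l].
  - by rewrite /D pder0 big1 // => j _; rewrite pder0 mulr0.
  - by rewrite /D pderD; rewrite -/(D _ a) -/(D _ b) Ea Eb -big_split; apply: eq_bigr => j _; rewrite pderD mulrDr.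
  rewrite /D pderZ pderx mulr_sumr; apply: eq_bigr => j _; rewrite pderZ pderx (bigD1 j) //=.
  rewrite big1 ?addr0 => [|u /negPf uj]; last by rewrite mxE uj andbF mul0r.
  by rewrite mxE !eqxx mul1r mulrCA.
have [v v0 vM] : exists2 v : 'rV[k]_n2, v != 0 & v *m M = 0.
  have : kermx M != 0.
    rewrite kermx_eq0 /row_free; apply/eqP => e1.
    by have := rank_leq_col M; rewrite e1 leqNgt lt.
  rewrite -nz_row_eq0 => h; exists (nz_row (kermx M)) => //.
  by apply/sub_kermxP; apply: nz_row_sub.
have De i : D v (th (tx X (e i + e i))) = 0.
  have /matrixP/(_ 0 i) := vM; rewrite !mxE Dlin => E; rewrite -[RHS]E.
  by apply: eq_bigr => j _; rewrite mxE.
have DM z z' : inZ X z -> inZ X z' -> D v (th (z * z')) = chi' z * D v (th z') + D v (th z) * chi' z'.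
  by move=> h h'; rewrite thM // [LHS](pderM hchar (DD v)) //; apply: thZ.
(* Logarithmic derivative, which turns the Leibniz rule into additivity. Doubling the degree makes
   it defined on all of the lattice, not only on the support of [Z]. *)
pose psi (l : 'rV[int]_n1) := D v (th (tx X (l + l))) / chi' (tx X (l + l)).
have psiD g h : gamX g -> gamX h -> D v (th (tx X (g + h))) / chi' (tx X (g + h)) =
   D v (th (tx X g)) / chi' (tx X g) + D v (th (tx X h)) / chi' (tx X h).
  move=> gg gh; rewrite xD // DM ?chi'M; try exact: inZ_x.
  by have := chi'_x gg; have := chi'_x gh => h1 h2; field; rewrite h1 h2.
have psi_add : forall l u, psi (l + u) = psi l + psi u.
  by move=> l u; rewrite /psi addrACA; apply: psiD; exact: gam_double.
have psi0 l : psi l = 0.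
  have p0 : psi 0 = 0 by apply: (addrI (psi 0)); rewrite -psi_add !addr0.
  have pz (a : int) u : psi (u *~ a) = psi u *~ a.
    have pn (b : nat) : psi (u *+ b) = psi u *+ b by elim: b => [|b IH]; rewrite ?mulr0n // !mulrS psi_add IH.
    case: a => a; first exact: pn.
    rewrite NegzE !mulrNz -!pmulrn -pn; apply/eqP; rewrite -addr_eq0 -psi_add addNr.
    by rewrite p0.
  rewrite (row_sum_delta l) (big_morph psi psi_add p0) big1 // => i _.
  by rewrite -[l 0 i]intz scaler_int pz {1}/psi De mul0r mul0rz.
have Dx g : gamX g -> D v (th (tx X g)) = 0.
  move=> gg; have := psi0 g; rewrite /psi psiD // => /eqP.
  rewrite -mulr2n -mulr_natl mulf_eq0 (negPf (two_neq0 hchar)) mulf_eq0 invr_eq0.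
  by rewrite (negPf (chi'_x gg)) orbF => /eqP.
have D0 z : inZ X z -> D v (th z) = 0.
  move=> hz; suff [_] : inZ X z /\ D v (th z) = 0 by [].
  apply: (inZ_ind (P := fun z => inZ X z /\ D v (th z) = 0)) hz => [|a b [ha Ea] [hb Eb]|c g gg].
  - by split; [exact: (@inZ_0 _ _ _ _ _ X) | rewrite th0 /D pder0].
  - by split; [exact: inZ_add | rewrite -[a]scale1r th_lin // scale1r /D pderD -/(D v _) -/(D v _) Ea Eb addr0].
  have hx := @inZ_x _ _ _ _ _ X _ gg; split; first exact: inZ_scale.
  by rewrite -[_ *: _]addr0 th_lin ?th0 ?addr0; [rewrite /D pderZ -/(D v _) Dx // mulr0 | | exact: (@inZ_0 _ _ _ _ _ X)].
case/eqP: v0; apply/rowP => j; rewrite mxE.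
(* At a preimage of the square of the [j]-th basis monomial the derivation takes the value
   [2 v_j]. *)
have [z hz Ez] := th_surj (@inZ_x _ _ _ _ _ Y _ (gam_double c2 p2 (delta_mx 0 j) hchar)).
have := D0 z hz; rewrite Ez /D pderx (bigD1 j) //= big1 ?addr0 => [|u /negPf uj]; last first.
  by rewrite !mxE uj andbF addr0 mulr0.
by rewrite !mxE !eqxx => /eqP; rewrite mulf_eq0 (negPf (two_neq0 hchar)) orbF => /eqP.
Qed.

End Nullity.

Section Transfer.
Variables (k : fieldType) (n1 c1 p1 n2 c2 p2 : nat) (A B : algType k).
Variables (X : torus_str n1 (pairs_of c1 p1) A) (Y : torus_str n2 (pairs_of c2 p2) B).
Hypothesis hchar : [pchar k] =i pred0.
Hypothesis k1n : (2 * pairs_of c1 p1 <= n1)%N.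
Hypothesis k2n : (2 * pairs_of c2 p2 <= n2)%N.
Variables (r1 r2 : nat) (tau : k).
Hypothesis tau2 : tau * tau = 1.
Hypothesis r10 : (0 < r1)%N.
Hypothesis r20 : (0 < r2)%N.
Local Notation L1 := (@Lx k n1 c1 p1 A X r1 tau).
Local Notation L2 := (@Lx k n2 c2 p2 B Y r2 tau).
Hypothesis cen1 : forall c, centroid L1 c -> exists2 z, inZ X z & forall M, L1 M -> c M = z *: M.
Hypothesis cen2 : forall c, centroid L2 c -> exists2 z, inZ Y z & forall M, L2 M -> c M = z *: M.

(** Conjugating multiplication by [z] gives a centroid element of the other algebra, hence
    multiplication by some [th z]. Since [Z] acts faithfully, [th] inherits linearity,
    multiplicativity and surjectivity. *)
Lemma centre_nullity_le f g : lie_pair L1 L2 f g -> (n2 <= n1)%N.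
Proof.
move=> fg; have [[fL fl fb] gh gf fgK] := fg; have [gL gl _] := gh.
have gl0 := lie_hom0 (Lx_sub r2 (tau := tau) Y hchar k2n tau2) gh.
have cz z : inZ X z -> centroid L2 (fun N => f (z *: g N)).
  by move=> hz; apply: (centroid_conj fg (inZ_centroid hchar k1n r1 tau hz)).
have [th thP] : exists th : A -> B, forall z, inZ X z -> inZ Y (th z) /\ forall N, L2 N -> f (z *: g N) = th z *: N.
  apply: (functional_choice (fun z w => inZ X z -> inZ Y w /\ forall N, L2 N -> f (z *: g N) = w *: N)) => z.
  case: (classic (inZ X z)) => hz; last by exists 0.
  by have [w hw e] := cen2 (cz z hz); exists w.
have zL z M : inZ X z -> L1 M -> L1 (z *: M) by move=> hz; exact: Lx_inZ.
have uniq w w' : (forall N, L2 N -> w *: N = w' *: N) -> w = w'.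
  move=> h; apply/eqP; rewrite -subr_eq0; apply/eqP; apply: (@inZ_faithful _ _ _ _ _ Y hchar r2 tau tau2 r20).
  by move=> N LN; rewrite scalerBl h // subrr.
have mxs c z (M : 'M[A]_(r1 + r1)) : mxscale c (z *: M) = (c *: z) *: M.
  by apply/matrixP => i j; rewrite !mxE scalerAl.
have mxs' c z (M : 'M[B]_(r2 + r2)) : mxscale c (z *: M) = (c *: z) *: M.
  by apply/matrixP => i j; rewrite !mxE scalerAl.
apply: (@nullity_le k n1 c1 p1 n2 c2 p2 A B X Y hchar th).
- by move=> z /thP[].
- move=> c z z' hz hz'; apply: uniq => N LN.
  have hc : inZ X (c *: z + z') by apply: inZ_add => //; apply: inZ_scale.
  rewrite -(thP _ hc).2 // !scalerDl -mxs fl ?mxs' //; try by apply: zL => //; apply: gL.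
  by rewrite (thP _ hz).2 // (thP _ hz').2 // mxs'.
- move=> z z' hz hz'; apply: uniq => N LN.
  have hc : inZ X (z * z') by apply: inZ_mul.
  rewrite -(thP _ hc).2 // -!scalerA -(thP _ hz').2 //.
  rewrite -(thP _ hz).2; last by apply: fL; apply: zL => //; apply: gL.
  by rewrite gf //; apply: zL => //; apply: gL.
- apply: uniq => N LN; rewrite -(thP _ (@inZ_1 _ _ _ _ _ X)).2 // scale1r fgK // scale1r //.
move=> w hw.
have cw : centroid L1 (fun M => g (w *: f M)).
  by apply: (centroid_conj (lie_pair_sym fg) (inZ_centroid hchar k2n r2 tau hw)).
have [z hz Ez] := cen1 cw; exists z => //; apply: uniq => N LN.
rewrite -(thP _ hz).2 // -Ez ?fgK //; last exact: gL.
by apply: Lx_inZ.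
Qed.

End Transfer.

(** * Normal form of a quadratic form with values in the field of two elements *)

Section QuadraticForm.
Variables (V : zmodType) (q : V -> bool) (b : V -> V -> bool).
Hypothesis qD : forall x y, q (x + y) = q x (+) q y (+) b x y.
Hypothesis bDl : forall x y z, b (x + y) z = b x z (+) b y z.
Hypothesis bC : forall x y, b x y = b y x.
Hypothesis bxx : forall x, b x x = false.
Implicit Types (x y z u v : V) (s t : seq V) (N : seq (V * V)).

Lemma bDr x y z : b x (y + z) = b x y (+) b x z.
Proof. by rewrite bC bDl !(bC x). Qed.
Lemma b0l z : b 0 z = false.
Proof. by have := bDl 0 0 z; rewrite addr0; case: (b 0 z). Qed.
Lemma bNl x z : b (- x) z = b x z.
Proof. by have := bDl x (- x) z; rewrite subrr b0l; case: (b x z); case: (b _ z). Qed.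
Lemma b0r z : b z 0 = false. Proof. by rewrite bC b0l. Qed.
Lemma bNr x z : b z (- x) = b z x. Proof. by rewrite bC bNl bC. Qed.

Definition subgrp (P : V -> Prop) : Prop := P 0 /\ forall x y, P x -> P y -> P (x - y).

Lemma subgrpN P x : subgrp P -> P x -> P (- x).
Proof. by case=> P0 PB Px; rewrite -[- x]add0r; apply: PB. Qed.
Lemma subgrpD P x y : subgrp P -> P x -> P y -> P (x + y).
Proof. by move=> sP Px Py; rewrite -[y]opprK; apply: sP.2 => //; apply: subgrpN. Qed.

Lemma subgrp_orth x : subgrp (fun v => b x v = false).
Proof. by split=> [|u v hu hv]; rewrite ?b0r // bDr bNr hu hv. Qed.

(** Equality of generated subgroups, expressed by the subgroups that contain the generators.
    Together with equal lengths it will mean a unimodular change of basis. *)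
Definition span_eq s t := forall P, subgrp P ->
  (forall x, x \in s -> P x) <-> (forall x, x \in t -> P x).

Lemma span_eq_trans s t (w : seq V) : span_eq s t -> span_eq t w -> span_eq s w.
Proof. by move=> h h' P sP; rewrite (h P sP); apply: h'. Qed.

Lemma span_eq_mem s t : s =i t -> span_eq s t.
Proof. by move=> e P _; split=> h x hx; apply: h; rewrite ?e // -e. Qed.

Lemma span_eq_cat s s' t t' : span_eq s s' -> span_eq t t' -> span_eq (s ++ t) (s' ++ t').
Proof.
move=> h h' P sP; have [h1 h2] := h P sP; have [h3 h4] := h' P sP.
split=> H x; rewrite mem_cat => /orP[|].
- by apply: h1 => z hz; apply: H; rewrite mem_cat hz.
- by apply: h3 => z hz; apply: H; rewrite mem_cat hz orbT.
- by apply: h2 => z hz; apply: H; rewrite mem_cat hz.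
- by apply: h4 => z hz; apply: H; rewrite mem_cat hz orbT.
Qed.

Lemma span_orth s t x : span_eq s t -> (forall y, y \in s -> b x y = false) ->
  forall y, y \in t -> b x y = false.
Proof. by move=> h hs; apply: (h _ (subgrp_orth x)).1. Qed.

Lemma span_eq_map s t (f : V -> V) (c : V -> V) : (forall x, f x = x + c x) ->
  (forall P x, subgrp P -> (forall y, y \in s -> P y) -> P (c x)) ->
  span_eq (s ++ t) (s ++ map f t).
Proof.
move=> fE cP P sP; split=> H x; rewrite mem_cat => /orP[hx|].
- by apply: H; rewrite mem_cat hx.
- move/mapP=> [y hy ->]; rewrite fE; apply: subgrpD => //; first by apply: H; rewrite mem_cat hy orbT.
  by apply: cP => // z hz; apply: H; rewrite mem_cat hz.
- by apply: H; rewrite mem_cat hx.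
move=> hx; rewrite -[x](addrK (c x)) -fE; apply: sP.2.
  by apply: H; rewrite mem_cat map_f ?orbT.
by apply: cP => // z hz; apply: H; rewrite mem_cat hz.
Qed.

Definition fl N : seq V := flatten [seq [:: c.1; c.2] | c <- N].

Lemma size_fl N : size (fl N) = (2 * size N)%N.
Proof. by elim: N => //= c N IH; rewrite IH mulnS. Qed.

Fixpoint nf N (t : seq V) : Prop :=
  if N is c :: N' then [/\ q c.1, q c.2, b c.1 c.2,
    (forall y, y \in fl N' ++ t -> b c.1 y = false /\ b c.2 y = false) & nf N' t] else True.

Definition isotropic t := (forall x, x \in t -> q x = false) /\
  forall x y, x \in t -> y \in t -> b x y = false.

(** The tail mirrors the last factors of the model: the start of the list is [B_p] (nothing, a
    vector of value 1 orthogonal to the rest, or a plane of type [*]), and the isotropic rest is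
    [R_q]. *)
Definition tailok (p : nat) (t : seq V) : Prop :=
  match p with
  | 0 => isotropic t
  | 1 => if t is u :: t' then [/\ q u, isotropic t' & forall y, y \in t' -> b u y = false] else False
  | _ => if t is c :: d :: t' then
      [/\ ~~ q c && ~~ q d, b c d, isotropic t' & forall y, y \in t' -> b c y = false /\ b d y = false]
      else False
  end.

Lemma nf_orth N t x : nf N t -> x \in fl N -> forall y, y \in t -> b x y = false.
Proof.
elim: N => //= c N IH [_ _ _ h hN]; rewrite !inE => /or3P[/eqP ->|/eqP ->|/IH]; last exact.
- by move=> y hy; have [] := h y; rewrite ?mem_cat ?hy ?orbT.
by move=> y hy; have [] := h y; rewrite ?mem_cat ?hy ?orbT.
Qed.

Lemma nf_tail N t t' : nf N t -> (forall x, x \in fl N -> forall y, y \in t' -> b x y = false) ->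
  nf N t'.
Proof.
elim: N => //= c N IH [q1 q2 b12 h hN] H; split=> // [y|]; last first.
  by apply: IH => // x hx; apply: H; rewrite !inE hx !orbT.
rewrite mem_cat => /orP[hy|hy]; first by apply: h; rewrite mem_cat hy.
by split; apply: H; rewrite // !inE eqxx ?orbT.
Qed.

Definition normal_form s p N t :=
  [/\ (p <= 2)%N, nf N t, tailok p t, span_eq s (fl N ++ t) & size s = (2 * size N + size t)%N].

(** A plane of value 1 on both generators joins [N]. One of value 0 becomes the tail when [p = 0];
    for [p = 1] and [p = 2] it is absorbed by a change of basis that keeps [p = 1], respectively
    returns to [p = 0]. *)
Lemma insert_block x y s p N t : b x y -> ~~ (q x (+) q y) ->
  (forall z, z \in s -> b x z = false /\ b y z = false) ->
  normal_form s p N t -> exists p' N' t', normal_form (x :: y :: s) p' N' t'.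
Proof.
move=> bxy qxy orth [p2 hN hp sp sz].
have hx z : z \in fl N ++ t -> b x z = false by apply: (span_orth sp) => w /orth[].
have hy z : z \in fl N ++ t -> b y z = false by apply: (span_orth sp) => w /orth[].
have byx : b y x by rewrite bC.
have spx : span_eq (x :: y :: s) (x :: y :: (fl N ++ t)).
  exact: (@span_eq_cat [:: x; y] [:: x; y] s _ (fun P _ => conj id id) sp).
case qx: (q x) qxy => qy.
  rewrite addTb negbK in qy.
  exists p, ((x, y) :: N), t; split=> //=; last by rewrite sz mulnS.
  by split=> // z hz; rewrite hx ?hy.
rewrite addFb in qy; move: qx qy => /negbT qx qy.
case: p p2 hp => [|[|[|p]]] // _ hp.
- exists 2, N, (x :: y :: t); split=> //=.
  + apply: (nf_tail hN) => z hz w; rewrite !inE => /or3P[/eqP->|/eqP->|].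
    * by rewrite bC hx // mem_cat hz.
    * by rewrite bC hy // mem_cat hz.
    by apply: (nf_orth hN).
  + by split=> //; [rewrite qx qy | move=> z hz; rewrite hx ?hy // mem_cat hz orbT].
  + apply: span_eq_trans spx _; apply: span_eq_mem => z.
    by rewrite !(inE, mem_cat); case: (z == x); case: (z == y); rewrite ?orbT.
  by rewrite sz !addnS.
- case: t hp hN sp sz hx hy spx => // u t [qu it ut] hN sp sz hx hy spx.
  have ux : b x u = false by apply: hx; rewrite mem_cat inE eqxx orbT.
  have uy : b y u = false by apply: hy; rewrite mem_cat inE eqxx orbT.
  have uo z : z \in fl N ++ u :: t -> b u z = false.
    rewrite mem_cat inE => /or3P[hz|/eqP->|]; [|exact: bxx|exact: ut].
    by rewrite bC (nf_orth hN) // inE eqxx.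
  (* Adding the radical vector [u] of value 1 switches both values of [q] to 1 and leaves the
     commutation relations unchanged. *)
  exists 1%N, ((x + u, y + u) :: N), (u :: t); split=> //=.
  + split; rewrite ?qD ?bDl ?bDr ?ux ?uy ?(negPf qx) ?(negPf qy) ?qu ?bxy ?bxx ?(bC u) ?ux ?uy //.
    by move=> z hz; rewrite !bDl hx ?hy ?uo.
  + apply: span_eq_trans spx _ => P sP; split=> H z; rewrite !inE.
      have Pu : P u by apply: H; rewrite !(inE, mem_cat) eqxx !orbT.
      move=> /or3P[/eqP->|/eqP->|hz]; [| |by apply: H; rewrite !inE hz !orbT].
        by apply: subgrpD => //; apply: H; rewrite inE eqxx.
      by apply: subgrpD => //; apply: H; rewrite !inE eqxx orbT.
    have Pu : P u by apply: H; rewrite !(inE, mem_cat) eqxx !orbT.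
    move=> /or3P[/eqP->|/eqP->|hz]; [| |by apply: H; rewrite !inE hz !orbT].
      by rewrite -[x](addrK u); apply: sP.2 => //; apply: H; rewrite inE eqxx.
    by rewrite -[y](addrK u); apply: sP.2 => //; apply: H; rewrite !inE eqxx orbT.
  by rewrite sz mulnS.
case: t hp hN sp sz hx hy spx => // c [|d t] // [/andP[qc qd] bcd it ct] hN sp sz hx hy spx.
have xc : b x c = false by apply: hx; rewrite mem_cat !inE eqxx orbT.
have yc : b y c = false by apply: hy; rewrite mem_cat !inE eqxx orbT.
have xd : b x d = false by apply: hx; rewrite mem_cat !inE eqxx !orbT.
have yd : b y d = false by apply: hy; rewrite mem_cat !inE eqxx !orbT.
have co z : z \in fl N ++ t -> b c z = false.
  rewrite mem_cat => /orP[hz|/ct[]//].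
  by rewrite bC (nf_orth hN) // inE eqxx.
have do_ z : z \in fl N ++ t -> b d z = false.
  rewrite mem_cat => /orP[hz|/ct[]//].
  by rewrite bC (nf_orth hN) // !inE eqxx orbT.
have xo z : z \in fl N ++ t -> b x z = false.
  by move=> hz; apply: hx; move: hz; rewrite !mem_cat !inE => /orP[->|->]; rewrite ?orbT.
have yo z : z \in fl N ++ t -> b y z = false.
  by move=> hz; apply: hy; move: hz; rewrite !mem_cat !inE => /orP[->|->]; rewrite ?orbT.
have bdc : b d c by rewrite bC.
(* As [q (c + d) = 1], both [x'] and [y'] take the value 1 and still form a plane. [c'] and [d'] are
   [c] and [d] made orthogonal to it, and this correction switches their values to 1 as well. *)
pose x' := x + c + d; pose y' := y + c + d; pose c' := c + x' + y'; pose d' := d + x' + y'.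
pose bE := (qD, bDl, bDr, bxx, bC c x, bC c y, bC d x, bC d y, xc, yc, xd, yd, negPf qx, negPf qy,
  negPf qc, negPf qd, bxy, byx, bcd, bdc).
exists 0%N, ((x', y') :: (c', d') :: N), t; split=> //=.
- split; rewrite /x' /y' /c' /d' ?bE //.
    move=> z; rewrite !inE => /or3P[/eqP ->|/eqP ->|hz]; rewrite ?bE //.
    by rewrite xo ?yo ?co ?do_.
  split; rewrite ?bE //; first by move=> z hz; rewrite !bDl xo ?yo ?co ?do_.
  by apply: (nf_tail hN) => z hz w hw; apply: (nf_orth hN hz); rewrite !inE hw !orbT.
- apply: span_eq_trans spx _ => P sP; split=> H z.
    have Px : P x by apply: H; rewrite inE eqxx.
    have Py : P y by apply: H; rewrite !inE eqxx orbT.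
    have Pc : P c by apply: H; rewrite !(inE, mem_cat) eqxx !orbT.
    have Pd : P d by apply: H; rewrite !(inE, mem_cat) eqxx !orbT.
    have Px' : P x' by rewrite /x'; do !apply: subgrpD => //.
    have Py' : P y' by rewrite /y'; do !apply: subgrpD => //.
    rewrite !inE => /or3P[/eqP->//|/eqP->//|/or3P[/eqP->|/eqP->|hz]].
    + by rewrite /c'; do !apply: subgrpD => //.
    + by rewrite /d'; do !apply: subgrpD => //.
    by apply: H; move: hz; rewrite !(inE, mem_cat) => /orP[->|->]; rewrite ?orbT.
  have Px' : P x' by apply: H; rewrite inE eqxx.
  have Py' : P y' by apply: H; rewrite !inE eqxx orbT.
  have Pc' : P c' by apply: H; rewrite !inE eqxx !orbT.
  have Pd' : P d' by apply: H; rewrite !inE eqxx !orbT.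
  have Pc : P c by rewrite -[c](addrK x') -[c + x'](addrK y'); do 2!apply: sP.2 => //.
  have Pd : P d by rewrite -[d](addrK x') -[d + x'](addrK y'); do 2!apply: sP.2 => //.
  have Px : P x by rewrite -[x](addrK c) -[x + c](addrK d); do 2!apply: sP.2 => //.
  have Py : P y by rewrite -[y](addrK c) -[y + c](addrK d); do 2!apply: sP.2 => //.
  rewrite !(inE, mem_cat) => /or3P[/eqP->//|/eqP->//|/or4P[hz|/eqP->//|/eqP->//|hz]].
    by apply: H; rewrite !(inE, mem_cat) hz !orbT.
  by apply: H; rewrite !(inE, mem_cat) hz !orbT.
by rewrite sz /= !mulnS; clear; lia.
Qed.

Lemma normal_form_span s s' p N t : span_eq s s' -> size s = size s' ->
  normal_form s' p N t -> normal_form s p N t.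
Proof. by move=> h e [p2 hN hp sp sz]; split=> //; [exact: span_eq_trans h sp | rewrite e]. Qed.

(** Here [q] is additive; a vector [u] of value 1, if there is one, is added to the other vectors of
    value 1 to make them isotropic. *)
Lemma normal_form_commuting s : (forall x y, x \in s -> y \in s -> b x y = false) ->
  exists p N t, normal_form s p N t.
Proof.
move=> com; case: (boolP (has q s)) => [/hasP[u us qu]|/hasPn h]; last first.
  exists 0%N, [::], s; split=> //; split=> // x /h /negPf //.
pose c v := if q v then u else 0; pose f v := v + c v.
exists 1%N, [::], (u :: map f (rem u s)).
have com' x y : x \in s -> y \in s -> b x (f y) = false.
  by move=> hx hy; rewrite bDr com // /c; case: ifP; rewrite ?b0r ?com.
have rs z : z \in rem u s -> z \in s by apply: mem_rem.
split=> //=.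
- split=> //; last by move=> _ /mapP[y /rs hy ->]; apply: com'.
  split=> [_ /mapP[y hy ->]|_ _ /mapP[y /rs hy ->] /mapP[z /rs hz ->]].
    rewrite /f qD /c; case qy: (q y); first by rewrite qu com // rs.
    by rewrite b0r -[q 0]addbF -(b0r 0) -[X in _ (+) X]/(b 0 0); have := qD 0 0; rewrite addr0 b0r; case: (q 0).
  by rewrite bDl com' // /c; case: ifP; rewrite ?b0l ?com'.
- apply: (@span_eq_trans _ (u :: rem u s)).
    by apply: span_eq_mem; apply: perm_mem; apply: perm_to_rem.
  apply: (@span_eq_map [:: u] _ f c) => // P x sP H; rewrite /c; case: ifP => _; last exact: sP.1.
  by apply: H; rewrite inE.
by rewrite size_map size_rem // add0n; case: (s) us.
Qed.

(** Split off a noncommuting pair, make the other vectors orthogonal to it, treat these by induction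
    and reinsert the plane. *)
Lemma normal_form_exists m s : (size s <= m)%N -> exists p N t, normal_form s p N t.
Proof.
elim: m s => [|m IH] s; first by rewrite leqn0 => /nilP ->; apply: normal_form_commuting.
move=> le; case: (boolP (has (fun x => has (b x) s) s)) => [/hasP[x xs /hasP[y ys bxy]]|h]; last first.
  apply: normal_form_commuting => x y xs ys; apply/negbTE; apply: contraNN h => bxy.
  by apply/hasP; exists x => //; apply/hasP; exists y.
pose s2 := rem y (rem x s).
have yx : y \in rem x s.
  have : y \in x :: rem x s by rewrite -(perm_mem (perm_to_rem xs)).
  by rewrite inE => /orP[/eqP e|//]; rewrite e bxx in bxy.
have pm : perm_eq s (x :: y :: s2).
  by apply: (perm_trans (perm_to_rem xs)); rewrite perm_cons; apply: perm_to_rem.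
pose c v := (if b y v then x else 0) + (if b x v then y else 0).
pose f v := v + c v.
have byx : b y x by rewrite bC.
have fx v : b x (f v) = false.
  rewrite /f /c !bDr; case e1: (b x v); case: (b y v); by rewrite ?b0r ?bxx ?bxy.
have fy v : b y (f v) = false.
  rewrite /f /c !bDr; case e1: (b y v); case: (b x v); by rewrite ?b0r ?bxx ?byx.
have sz2 : size s = (size s2).+2 by rewrite (perm_size pm).
have [p [N [t nft]]] : exists p N t, normal_form (map f s2) p N t.
  by apply: IH; rewrite size_map; move: le; rewrite sz2 ltnS; apply: ltnW.
have sp : span_eq s (x :: y :: map f s2).
  apply: (span_eq_trans (span_eq_mem (perm_mem pm))).
  apply: (@span_eq_map [:: x; y] _ f c) => // P v sP H; rewrite /c; apply: subgrpD => //; case: ifP => _;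
    by [exact: sP.1 | apply: H; rewrite !inE eqxx ?orbT].
have fin x' y' : b x' y' -> ~~ (q x' (+) q y') -> span_eq [:: x; y] [:: x'; y'] ->
    exists p N t, normal_form s p N t.
  move=> b' q' sp'.
  have o z : z \in map f s2 -> b x' z = false /\ b y' z = false.
    move=> /mapP[v _ ->]; split; rewrite bC; apply: (span_orth sp');
      rewrite ?inE ?eqxx ?orbT // => w; rewrite !inE => /orP[/eqP ->|/eqP ->]; by rewrite bC ?fx ?fy.
  have [p' [N' [t' h]]] := insert_block b' q' o nft.
  exists p', N', t'; apply: normal_form_span h; last by rewrite sz2 /= size_map.
  apply: (span_eq_trans sp); exact: (@span_eq_cat [:: x; y] [:: x'; y'] _ _ sp' (fun P _ => conj id id)).
(* As [b x y = 1], two of [x], [y], [x + y] have equal values, and any two of them generate the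
   plane. *)
case qx : (q x); case qy : (q y).
- by apply: (fin x y) => //; rewrite qx qy.
- apply: (fin (x + y) y); rewrite ?bDl ?bxy ?bxx ?qD ?qx ?qy ?bxy //.
  move=> P sP; split=> H z; rewrite !inE => /orP[/eqP ->|/eqP ->]; try by apply: H; rewrite !inE eqxx ?orbT.
    by apply: subgrpD => //; apply: H; rewrite !inE eqxx ?orbT.
  by rewrite -[x](addrK y); apply: sP.2; apply: H; rewrite !inE eqxx ?orbT.
- apply: (fin x (x + y)); rewrite ?bDr ?bxy ?bxx ?qD ?qx ?qy ?bxy //.
  move=> P sP; split=> H z; rewrite !inE => /orP[/eqP ->|/eqP ->]; try by apply: H; rewrite !inE eqxx ?orbT.
    by apply: subgrpD => //; apply: H; rewrite !inE eqxx ?orbT.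
  by rewrite -[y](addKr x) addrC; apply: sP.2; apply: H; rewrite !inE eqxx ?orbT.
by apply: (fin x y) => //; rewrite qx qy.
Qed.

End QuadraticForm.

Section Indexing.
Variables (V : zmodType) (q : V -> bool) (b : V -> V -> bool).
Hypothesis bC : forall x y, b x y = b y x.
Implicit Types (N : seq (V * V)) (t : seq V).

Lemma tailok_comm p t i j : (p <= 2)%N -> tailok q b p t -> (i < size t)%N -> (j < size t)%N -> i != j ->
  b t`_i t`_j = (i./2 == j./2) && (i < if p == 2 then 2 else 0)%N.
Proof.
have iso t' i' j' : isotropic q b t' -> (i' < size t')%N -> (j' < size t')%N -> b t'`_i' t'`_j' = false.
  by move=> [_ h] hi hj; apply: h; apply: mem_nth.
case: p => [|[|[|p]]] // _.
- by move=> h hi hj _; rewrite iso // ltn0 andbF.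
- case: t => // u t [_ it h]; rewrite ltn0 andbF.
  case: i => [|i] hi; case: j => [|j] hj // _; first by apply: h; apply: mem_nth.
    by rewrite bC; apply: h; apply: mem_nth.
  exact: (iso _ i j it).
case: t => // c [|d t] // [_ bcd it h]; case: i => [|[|i]] hi; case: j => [|[|j]] hj //= _.
- by have [] := h t`_j (mem_nth 0 (hj : (j < size t)%N)).
- by rewrite bC.
- by have [] := h t`_j (mem_nth 0 (hj : (j < size t)%N)).
- by rewrite bC; have [] := h t`_i (mem_nth 0 (hi : (i < size t)%N)).
- by rewrite bC; have [] := h t`_i (mem_nth 0 (hi : (i < size t)%N)).
by rewrite iso // andbF.
Qed.

Lemma nf_comm p N t i j : (p <= 2)%N -> nf q b N t -> tailok q b p t ->
  (i < size (fl N ++ t))%N -> (j < size (fl N ++ t))%N -> i != j ->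
  b (fl N ++ t)`_i (fl N ++ t)`_j =
  (i./2 == j./2) && (i < 2 * size N + if p == 2 then 2 else 0)%N.
Proof.
move=> p2; elim: N i j => [|c N IH] i j; first by move=> _; apply: tailok_comm.
move=> [_ _ bc h hN] ht; rewrite [fl _]/= -/(fl N) mulnS.
case: i => [|[|i]] hi; case: j => [|[|j]] hj //= ij.
- by have [] := h (fl N ++ t)`_j (mem_nth 0 (hj : (j < size (fl N ++ t))%N)).
- by rewrite bC bc.
- by have [] := h (fl N ++ t)`_j (mem_nth 0 (hj : (j < size (fl N ++ t))%N)).
- by rewrite bC; have [] := h (fl N ++ t)`_i (mem_nth 0 (hi : (i < size (fl N ++ t))%N)).
- by rewrite bC; have [] := h (fl N ++ t)`_i (mem_nth 0 (hi : (i < size (fl N ++ t))%N)).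
by rewrite IH.
Qed.

Lemma nf_sign p N t i : (p <= 2)%N -> nf q b N t -> tailok q b p t ->
  (i < size (fl N ++ t))%N ->
  q (fl N ++ t)`_i = (i < 2 * size N)%N || ((p == 1) && (i == 2 * size N))%N.
Proof.
move=> p2; elim: N i => [|c N IH] i; last first.
  move=> [q1 q2 _ _ hN] ht; rewrite [fl _]/= -/(fl N) mulnS.
  by case: i => [|[|i]] //= hi; rewrite IH.
move=> _; rewrite muln0 ltn0 /=; case: p p2 => [|[|[|p]]] // _.
- by move=> [h _] hi; apply: h; apply: mem_nth.
- case: t => // u t [qu [h _] _]; case: i => [|i] //= hi; apply: h; exact: mem_nth.
case: t => // c [|d t] // [/andP[qc qd] _ [h _] _]; case: i => [|[|i]] hi //=.
- exact: negbTE.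
- exact: negbTE.
by apply: h; apply: mem_nth.
Qed.

Lemma tailok_size p t : (p <= 2)%N -> tailok q b p t -> (p <= size t)%N.
Proof. by case: p => [|[|[|p]]] // _; case: t => [|u [|d t]]. Qed.

End Indexing.

(** * Tori with involution are models *)

Section Classification.
Variables (k : fieldType) (A : algType k) (n : nat) (x : 'rV[int]_n -> A) (inv : A -> A).
Hypothesis hchar : [pchar k] =i pred0.
Hypothesis tor : is_torus_inv x inv.
Implicit Types (l u v : 'rV[int]_n).

Let two : (2 : k) != 0.
Proof.
apply/negP => e; have := hchar 2%N; rewrite inE /= e //.
Qed.

Let sgn_inj (b1 b2 : bool) (a : A) : a != 0 -> (-1 : k) ^+ b1 *: a = (-1) ^+ b2 *: a -> b1 = b2.
Proof.
move=> a0; have aN : a <> - a.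
  move=> e; have : (2 : k) *: a = 0 by rewrite scaler_nat mulr2n {1}e addNr.
  by move/eqP; rewrite scaler_eq0 (negPf two) (negPf a0).
case: b1; case: b2 => //; rewrite expr0 expr1 scaleN1r scale1r => e; case: aN => //.
Qed.

Lemma torus_unit_lreg l (a : A) : a != 0 -> x l * a != 0.
Proof.
have [[inv_x _ _ _] _] := tor; have [y [_ yx]] := inv_x l.
by apply: contraNneq => e; rewrite -[a]mul1r -yx -mulrA e mulr0.
Qed.

Lemma torus_x_neq0 l : x l != 0.
Proof. by rewrite -[x l]mulr1; apply: torus_unit_lreg; apply: oner_neq0. Qed.

Lemma involution_sign : exists q : 'rV[int]_n -> bool, forall l, inv (x l) = (-1) ^+ q l *: x l.
Proof.
have [_ [ilin _ iK ix]] := tor.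
apply: (functional_choice (fun l (q : bool) => inv (x l) = (-1) ^+ q *: x l)) => l.
have [c e] := ix l.
have iZ (d : k) a : inv (d *: a) = d *: inv a.
  have i0 : inv 0 = 0 by have := ilin (-1) 0 0; rewrite scaler0 addr0 scaleN1r addNr.
  by rewrite -[d *: a]addr0 ilin i0 addr0.
have : (c * c) *: x l = x l by rewrite -scalerA -e -iZ -e iK.
move/eqP; rewrite -subr_eq0 -[X in _ - X]scale1r -scalerBl scaler_eq0 (negPf (torus_x_neq0 l)) orbF.
rewrite subr_eq0 -expr2 sqrf_eq1 => /orP[/eqP c1|/eqP c1]; [exists false | exists true];
  by rewrite e c1 ?expr0 ?expr1.
Qed.

(** The signs of the involution define [q]; its normal form, started from the standard basis, lists
    degrees whose monomials satisfy the relations of a model. *)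
Lemma torus_classification : exists k0 p q, (p <= 2)%N /\ is_model x inv k0 p q.
Proof.
have [q qE] := involution_sign; have [[_ xM _ _] [ilin iM _ _]] := tor.
pose b l u := q l (+) q u (+) q (l + u).
have iZ (d : k) a : inv (d *: a) = d *: inv a.
  have i0 : inv 0 = 0 by have := ilin (-1) 0 0; rewrite scaler0 addr0 scaleN1r addNr.
  by rewrite -[d *: a]addr0 ilin i0 addr0.
have sgS (c d : bool) : (-1 : k) ^+ c * (-1) ^+ d = (-1) ^+ (c (+) d) by rewrite signr_addb.
(* Apply the involution to [x l * x u]: it reverses the product, while the product is homogeneous
   and so merely gets the sign of [l + u]. *)
have comm l u : x l * x u = (-1) ^+ b l u *: (x u * x l).
  have [c e] := xM l u.
  have : inv (x l * x u) = (-1) ^+ q (l + u) *: (x l * x u).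
    by rewrite e iZ qE !scalerA mulrC.
  rewrite iM !qE -scalerAl -scalerAr scalerA sgS => E.
  move/(congr1 (fun a => (-1) ^+ q (l + u) *: a)): E; rewrite /= !scalerA !sgS addbb expr0 scale1r => <-.
  by rewrite /b (addbC (q l)) addbC.
have bC l u : b l u = b u l by rewrite /b addrC [q l (+) _]addbC.
have bxx l : b l l = false.
  by apply/esym/(sgn_inj (torus_unit_lreg l (torus_x_neq0 l))); rewrite -comm expr0 scale1r.
have qD l u : q (l + u) = q l (+) q u (+) b l u.
  by rewrite /b addbA addbb.
have bDl l u v : b (l + u) v = b l v (+) b u v.
  have [c e] := xM l u.
  have nz : x v * (x l * x u) != 0 by apply/torus_unit_lreg/torus_unit_lreg/torus_x_neq0.
  apply: (sgn_inj nz); rewrite {1}e -scalerAr scalerA [_ * c]mulrC -scalerA -comm scalerAl -e.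
  by rewrite -mulrA (comm u v) -scalerAr (mulrA (x l)) (comm l v) -!scalerAl scalerA sgS -mulrA addbC.
pose bas := [seq delta_mx 0 i : 'rV[int]_n | i <- enum 'I_n].
have [p [N [t [p2 hN ht sp sz]]]] := normal_form_exists qD bDl bC bxx (leqnn (size bas)).
have szb : size bas = n by rewrite size_map size_enum_ord.
have szL : size (fl N ++ t) = n by rewrite size_cat size_fl; apply: etrans (esym sz) szb.
have pt := tailok_size p2 ht.
exists (size N), p, (size t - p)%N; split=> //; split.
  by rewrite -addnA subnKC //; apply: etrans (esym szb) sz.
pose D : 'M[int]_n := \matrix_(i, j) ((fl N ++ t)`_i) 0 j.
have rowD i : row i D = (fl N ++ t)`_i by apply/rowP => j; rewrite !mxE.
exists (fun i => x (row i D)), D; split.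
(* The row lattice of [D] is a subgroup that contains the normal form, hence the standard basis; so
   [D] has a left inverse. *)
- have sub : subgrp (fun v => exists w : 'rV[int]_n, v = w *m D).
    split; first by exists 0; rewrite mul0mx.
    by move=> _ _ [w ->] [w' ->]; exists (w - w'); rewrite mulmxBl.
  have gen : forall v, v \in bas -> exists w : 'rV[int]_n, v = w *m D.
    apply: (sp _ sub).2 => v /(nthP 0)[i]; rewrite szL => lt <-.
    by exists (delta_mx 0 (Ordinal lt)); rewrite -rowE rowD.
  have [W WD] : exists W : 'I_n -> 'rV[int]_n, forall i, delta_mx 0 i = W i *m D.
    apply: (functional_choice (fun i w => delta_mx 0 i = w *m D)) => i.
    by apply: gen; apply: map_f; rewrite mem_enum.
  have : (\matrix_i W i) *m D = 1%:M.
    by apply/row_matrixP => i; rewrite row_mul rowK -WD row1.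
  by move/mulmx1_unit => [].
- by move=> i; exists 1; rewrite scale1r oner_neq0.
- move=> i j; case: (eqVneq i j) => [->|ij]; first by rewrite /model_comm eqxx scale1r.
  rewrite comm !rowD (nf_comm bC p2 hN ht) ?szL ?ltn_ord //.
  rewrite /model_comm -[(i : nat) != j]/(i != j) ij /=.
  by case: (_ && _).
move=> i; rewrite qE rowD (nf_sign p2 hN ht) ?szL ?ltn_ord // /model_sign.
by case: (_ || _).
Qed.

End Classification.

(* The hypotheses say that [u] commutes with the subgroup generated by the [l] with
   [q l = false]; in each case this subgroup and the radical generate everything. *)
Lemma commuting_radical (V : zmodType) (q : V -> bool) (b : V -> V -> bool) (u : V) :
  (forall x y, q (x + y) = q x (+) q y (+) b x y) ->
  (forall x y z, b (x + y) z = b x z (+) b y z) -> (forall x y, b x y = b y x) ->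
  (forall l, q l = false -> b u l = false) ->
  [\/ exists2 t, q t & forall l, b t l = false,
      exists c d, [/\ q c = false, q d = false & b c d] |
      exists a b' c d, [/\ [/\ q a, q b', q c & q d], b a b', b c d &
        [/\ b a c = false, b a d = false, b b' c = false & b b' d = false]]] ->
  forall l, b u l = false.
Proof.
move=> qD bDl bC h.
have bDr x y z : b x (y + z) = b x y (+) b x z by rewrite bC bDl !(bC x).
(* If [q (l + w) = 0], then [u] is orthogonal to [l + w]. It remains to find, for each [l] with
   [q l = 1], such a [w] orthogonal to [u]; the alternatives of the hypothesis provide one. *)
have W l w : b u w = false -> q l (+) q w (+) b l w = false -> b u l = false.
  by move=> uw e; have := h (l + w); rewrite qD e bDr uw addbF; apply.
case=> [[t qt tr] l|[c [d [qc qd bcd]]] l|[a [b' [c [d [[qa qb qc qd] bab bcd [bac bad bbc bbd]]]]]] l].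
- case ql: (q l); last exact: h.
  by have := h (l + t); rewrite qD ql qt (bC l) tr bDr (bC u t) tr !addbF => /(_ erefl).
- have uc := h c qc; have ud := h d qd.
  case ql: (q l); last exact: h.
  case lc: (b l c); first by apply: (W l c uc); rewrite ql qc lc.
  case ld: (b l d); first by apply: (W l d ud); rewrite ql qd ld.
  by apply: (W l (c + d)); rewrite ?qD ?bDr ?uc ?ud ?qc ?qd ?lc ?ld ?bcd ?ql.
have uac : b u a = b u c.
  by have := h (a + c); rewrite qD qa qc bac bDr => /(_ erefl); case: (b u a); case: (b u c).
have uad : b u a = b u d.
  by have := h (a + d); rewrite qD qa qd bad bDr => /(_ erefl); case: (b u a); case: (b u d).
have ubc : b u b' = b u c.
  by have := h (b' + c); rewrite qD qb qc bbc bDr => /(_ erefl); case: (b u b'); case: (b u c).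
have ua : b u a = false.
  have := h (a + (c + d)); rewrite !qD !bDr qa qc qd bac bad bcd -uac -uad => /(_ erefl).
  by case: (b u a).
have ub : b u b' = false by rewrite ubc -uac.
case ql: (q l); last exact: h.
case la: (b l a); last by apply: (W l a ua); rewrite ql qa la.
case lb: (b l b'); last by apply: (W l b' ub); rewrite ql qb lb.
by apply: (W l (a + b')); rewrite ?qD ?bDr ?ua ?ub ?qa ?qb ?la ?lb ?bab ?ql.
Qed.

(** * Recovering k0 and p from ranks *)

Section Numerics.
Implicit Types (r k p h : nat).

Lemma PoszX m e : (m ^ e)%N%:Z = m%:Z ^+ e.
Proof. by rewrite -!natz natrX natz. Qed.

(** The torus has rank [4^level] over its own centre, so [2^level] is its degree. *)
Definition level k p : nat := (k + (p == 2))%N.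
(** Type of the involution when [p] is not 1: [+1] orthogonal, [-1] symplectic. Each factor
    [natural] changes the type, a factor [*] keeps it. *)
Definition esign k p : int := (-1) ^+ k.

Lemma card_cosets_level k p : (p <= 2)%N ->
  (#|cosets k p|)%:Z = (if p == 1%N then 2 else 1) * (2 ^ level k p)%N%:Z ^+ 2.
Proof.
move=> p2; rewrite card_cosets -[4%N]/(2 ^ 2)%N -expnM -expnD -PoszX -expnM [(level _ _ * 2)%N]mulnC /level.
case: p p2 => [|[|[|p]]] // _.
- by rewrite mul1r !addn0.
- by rewrite addn0 addn1 expnS PoszM.
by rewrite mul1r mulnDr.
Qed.

Lemma sum_sz_level k p : (p <= 2)%N ->
  \sum_(b : cosets k p) sz b = if p == 1%N then 0 else esign k p * (2 ^ level k p)%N%:Z.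
Proof.
move=> p2; rewrite sum_sz // /esign /level PoszX -[-2]mulN1r exprMn.
case: p p2 => [|[|[|p]]] // _; rewrite ?mulr0 //.
  by rewrite addn0 mulr1.
by rewrite addn1 exprSr mulrA.
Qed.

Lemma esign_cases k p : esign k p = 1 \/ esign k p = -1.
Proof. by rewrite /esign -signr_odd; case: (odd k); [right | left]. Qed.

Lemma level_inj k1 p1 k2 p2 : (p1 <= 2)%N -> (p2 <= 2)%N -> level k1 p1 = level k2 p2 ->
  (p1 == 1%N) = (p2 == 1%N) -> (p1 != 1%N -> esign k1 p1 = esign k2 p2) -> k1 = k2 /\ p1 = p2.
Proof.
rewrite /level /esign -!(signr_odd _ k1) -!(signr_odd _ k2).
case: p1 => [|[|[|p1]]] //; case: p2 => [|[|[|p2]]] // _ _; rewrite ?addn0 ?addn1.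
- by move=> -> _ _.
- by move=> -> _ /(_ isT) /=; case: (odd k2).
- by move=> -> _ _.
- by move=> <- _ /(_ isT) /=; case: (odd k1).
by move=> [->].
Qed.

Lemma double_pow h1 h2 : (h1 < h2)%N -> (2 * (2 ^ h1)%N%:Z <= (2 ^ h2)%N%:Z :> int).
Proof. by move=> lt; rewrite -PoszM lez_nat -expnS leq_exp2l. Qed.

(** Dimension of [sl_{2y}] for [p = 1], otherwise of [sp_{2y}] ([e = 1]) or [so_{2y}] ([e = -1]). *)
Definition dimval (y : int) (p : nat) (e : int) : int :=
  if p == 1%N then 4 * y ^+ 2 - 1 else 2 * y ^+ 2 + e * y.

Lemma dimval_lt y1 p1 e1 y2 p2 e2 : 1 <= y1 -> 2 * y1 <= y2 -> (e1 = 1 \/ e1 = -1) ->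
  (e2 = 1 \/ e2 = -1) -> dimval y1 p1 e1 < dimval y2 p2 e2.
Proof.
move=> h1 h2 c1 c2; rewrite /dimval.
(* Products of nonnegative factors, supplied as hints for the nonlinear arithmetic below. *)
have k1 : 0 <= (y2 - 2 * y1) * (2 * (y2 + 2 * y1) - 1) by apply: mulr_ge0; lia.
have k2 : 0 <= (y1 - 1) * y1 by apply: mulr_ge0; lia.
by case: ifP => _; case: ifP => _; case: c1 => c1; case: c2 => c2; rewrite ?c1 ?c2 ?mul1r ?mulN1r; nia.
Qed.

Lemma dimval_inj y p1 e1 p2 e2 : 2 <= y -> (e1 = 1 \/ e1 = -1) -> (e2 = 1 \/ e2 = -1) ->
  dimval y p1 e1 = dimval y p2 e2 -> (p1 == 1%N) = (p2 == 1%N) /\ (p1 != 1%N -> e1 = e2).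
Proof.
move=> h c1 c2; rewrite /dimval.
have k1 : 0 <= (y - 2) * (2 * y) by apply: mulr_ge0; lia.
by case: eqP => _; case: eqP => _; case: c1 => c1; case: c2 => c2; rewrite ?c1 ?c2 //; rewrite ?mul1r ?mulN1r => e; exfalso; move: e; nia.
Qed.

(** Twice the rank of the symmetric elements of an algebra of degree [z]: all [z^2] dimensions for
    the exchange involution ([p = 1]), otherwise [z (z + e) / 2]. *)
Definition nposval (z : int) (p : nat) (e : int) : int :=
  if p == 1%N then 2 * z ^+ 2 else z ^+ 2 + e * z.

Lemma nposval_lt y1 p1 e1 y2 p2 e2 : 2 <= y1 -> 2 * y1 <= y2 -> (e1 = 1 \/ e1 = -1) ->
  (e2 = 1 \/ e2 = -1) -> nposval y1 p1 e1 < nposval y2 p2 e2.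
Proof.
move=> h1 h2 c1 c2; rewrite /nposval.
have k1 : 0 <= (y2 - 2 * y1) * (y2 + 2 * y1 - 1) by apply: mulr_ge0; lia.
have k2 : 0 <= (y1 - 2) * y1 by apply: mulr_ge0; lia.
by case: ifP => _; case: ifP => _; case: c1 => c1; case: c2 => c2; rewrite ?c1 ?c2 ?mul1r ?mulN1r; nia.
Qed.

Lemma nposval_inj y p1 e1 p2 e2 : 2 <= y -> (e1 = 1 \/ e1 = -1) -> (e2 = 1 \/ e2 = -1) ->
  nposval y p1 e1 = nposval y p2 e2 -> (p1 == 1%N) = (p2 == 1%N) /\ (p1 != 1%N -> e1 = e2).
Proof.
move=> h c1 c2; rewrite /nposval.
have k1 : 0 <= (y - 2) * y by apply: mulr_ge0; lia.
by case: eqP => _; case: eqP => _; case: c1 => c1; case: c2 => c2; rewrite ?c1 ?c2 //; rewrite ?mul1r ?mulN1r => e; exfalso; move: e; nia.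
Qed.

Lemma npos_level k p : (p <= 2)%N ->
  (2 * npos k p)%:Z = nposval (2 ^ level k p)%N%:Z p (esign k p).
Proof.
move=> p2; rewrite npos_sum card_cosets_level // sum_sz_level // /nposval.
by case: ifP => _; rewrite ?addr0 // mul1r.
Qed.

Lemma dim_level r k p d : (p <= 2)%N ->
  (d + (p == 1%N) = #|cosets k p| * 'C(r + r, 2) + npos k p * (r + r))%N -> (0 < r)%N ->
  d%:Z = dimval (r * 2 ^ level k p)%N%:Z p (esign k p).
Proof.
move=> p2 e r0; have c2 : ('C(r + r, 2) = r * (2 * r - 1))%N.
  by rewrite bin2 addnn -mul2n -mulnA mul2n doubleK subn1.
have := npos_level k p2; have := card_cosets_level k p2.
move: e; rewrite c2 /dimval /nposval PoszM.
move: (#|cosets k p|) (npos k p) ((2 ^ level k p)%N) (esign k p) => C P z s.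
have : ((2 * r - 1)%N = 2 * r%:Z - 1 :> int) by move: r0; clear; lia.
move: (2 * r - 1)%N => w wE.
move=> /(congr1 Posz); rewrite !PoszD !PoszM wE => e Cz Pz.
have -> : d%:Z = C%:Z * (r%:Z * (2 * r%:Z - 1)) + P%:Z * (r%:Z + r%:Z) - (p == 1%N : nat)%:Z.
  by rewrite -e addrK.
have -> : P%:Z * (r%:Z + r%:Z) = r%:Z * (2 * P%:Z) by ring.
rewrite Pz Cz; case: (p == 1%N) => /=; ring.
Qed.

(** Common scheme for [dimval] and [nposval]: different levels differ by a factor of at least 2,
    which forces strict inequality of the values; at equal level the value determines the type, and
    the type with the level determines the pair. *)
Lemma data_inj k1 p1 k2 p2 (F : int -> nat -> int -> int) (c : int) : (p1 <= 2)%N -> (p2 <= 2)%N ->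
  0 < c -> (forall y1 y2 e1 e2, c * (2 ^ level k1 p1)%N%:Z <= y1 -> c * (2 ^ level k2 p2)%N%:Z <= y2 ->
     (e1 = 1 \/ e1 = -1) -> (e2 = 1 \/ e2 = -1) ->
     [/\ 2 * y1 <= y2 -> F y1 p1 e1 < F y2 p2 e2, 2 * y2 <= y1 -> F y2 p2 e2 < F y1 p1 e1 &
      y1 = y2 -> F y1 p1 e1 = F y2 p2 e2 -> (p1 == 1%N) = (p2 == 1%N) /\ (p1 != 1%N -> e1 = e2)]) ->
  F (c * (2 ^ level k1 p1)%N%:Z) p1 (esign k1 p1) = F (c * (2 ^ level k2 p2)%N%:Z) p2 (esign k2 p2) ->
  k1 = k2 /\ p1 = p2.
Proof.
move=> l1 l2 c0 hF e.
have [h1 h2 h3] := hF _ _ _ _ (lexx _) (lexx _) (esign_cases k1 p1) (esign_cases k2 p2).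
case: (ltngtP (level k1 p1) (level k2 p2)) => lv.
- by exfalso; move: h1; rewrite e ltxx => H; suff : false by []; apply: H; rewrite mulrCA ler_pM2l // double_pow.
- by exfalso; move: h2; rewrite e ltxx => H; suff : false by []; apply: H; rewrite mulrCA ler_pM2l // double_pow.
have [ep es] := h3 (congr1 (fun h => c * (2 ^ h)%N%:Z) lv) e.
exact: level_inj.
Qed.

Lemma level_ge1 r k p q : in_PC r k p q -> (r <= 2)%N -> (1 <= level k p)%N.
Proof. by move=> [_ p2 ex] /ex; rewrite /level; case: p p2 {ex} => [|[|[|p]]] //; case: k => [|k] //= _ []; auto. Qed.

(** The point is [r 2^level >= 2], which admissibility ensures; at the value 1 the dimensions of
    [sl_2] and [sp_2] coincide. *)
Lemma dim_inj r k1 p1 q1 k2 p2 q2 d : in_PC r k1 p1 q1 -> in_PC r k2 p2 q2 ->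
  (d + (p1 == 1%N) = #|cosets k1 p1| * 'C(r + r, 2) + npos k1 p1 * (r + r))%N ->
  (d + (p2 == 1%N) = #|cosets k2 p2| * 'C(r + r, 2) + npos k2 p2 * (r + r))%N ->
  k1 = k2 /\ p1 = p2.
Proof.
move=> i1 i2 e1 e2; have [r0 l1 _] := i1; have [_ l2 _] := i2.
have ge2 k p q : in_PC r k p q -> 2 <= r%:Z * (2 ^ level k p)%N%:Z.
  move=> ip; rewrite -PoszM lez_nat; case: (leqP r 2) => hr.
    have := level_ge1 ip hr; case: (level k p) => // h _; rewrite expnS mulnCA leq_pmulr //.
    by rewrite muln_gt0 r0 expn_gt0.
  by apply: leq_trans (ltnW hr) _; rewrite leq_pmulr // expn_gt0.
have d1 := dim_level l1 e1 r0; have d2 := dim_level l2 e2 r0.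
apply: (@data_inj k1 p1 k2 p2 dimval r%:Z) => //; last by rewrite -!PoszM -d1 -d2.
move=> y1 y2 s1 s2 h1 h2 c1 c2.
have {}h1 := le_trans (ge2 _ _ _ i1) h1; have {}h2 := le_trans (ge2 _ _ _ i2) h2.
split=> [h|h|<-].
- by apply: dimval_lt => //; apply: le_trans h1.
- by apply: dimval_lt => //; apply: le_trans h2.
exact: dimval_inj.
Qed.

Lemma npos_inj1 k1 p1 q1 k2 p2 q2 : in_PC 1 k1 p1 q1 -> in_PC 1 k2 p2 q2 ->
  npos k1 p1 = npos k2 p2 -> k1 = k2 /\ p1 = p2.
Proof.
move=> i1 i2 e; have [_ l1 _] := i1; have [_ l2 _] := i2.
have ge2 k p q : in_PC 1 k p q -> 2 <= 1 * (2 ^ level k p)%N%:Z.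
  move=> ip; rewrite mul1r lez_nat; have := level_ge1 ip isT; case: (level k p) => // h _.
  by rewrite expnS leq_pmulr // expn_gt0.
apply: (@data_inj k1 p1 k2 p2 nposval 1) => //; last by rewrite !mul1r -!npos_level ?e.
move=> y1 y2 s1 s2 h1 h2 c1 c2.
have {}h1 := le_trans (ge2 _ _ _ i1) h1; have {}h2 := le_trans (ge2 _ _ _ i2) h2.
split=> [h|h|<-].
- exact: nposval_lt.
- exact: nposval_lt.
exact: nposval_inj.
Qed.

(** The number of cosets gives [2 k0 + p], hence the parity of [p] and the level; the sum of signs
    then separates [(k0, 2)] from [(k0 + 1, 0)]. *)
Lemma npos_card_inj k1 p1 k2 p2 : (p1 <= 2)%N -> (p2 <= 2)%N ->
  #|cosets k1 p1| = #|cosets k2 p2| -> npos k1 p1 = npos k2 p2 -> k1 = k2 /\ p1 = p2.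
Proof.
move=> l1 l2 e1 e2.
have e2z := congr1 (fun x => (2 * x)%N%:Z) e2; rewrite /= !npos_sum e1 in e2z.
have {}e2z := addrI _ e2z; rewrite !sum_sz_level // in e2z.
have e1n : (2 ^ (2 * k1 + p1) = 2 ^ (2 * k2 + p2))%N.
  by move: e1; rewrite !card_cosets -[4%N]/(2 ^ 2)%N -!expnM -!expnD.
have {}e1n : (2 * k1 + p1 = 2 * k2 + p2)%N by apply: (@expnI 2).
have ep : (p1 == 1%N) = (p2 == 1%N).
  by move: e1n l1 l2; clear; case: p1 => [|[|[|p1]]]; case: p2 => [|[|[|p2]]] //; lia.
have lv : level k1 p1 = level k2 p2.
  by rewrite /level; move: e1n l1 l2; clear; case: p1 => [|[|[|p1]]]; case: p2 => [|[|[|p2]]] //=; lia.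
apply: level_inj => // np; move: e2z; rewrite -ep (negPf np) lv => /mulIf; apply.
by rewrite -lt0n expn_gt0.
Qed.

End Numerics.

(** Each shape supplies one alternative of [commuting_radical]: for [p = 1] the generator of [B_1],
    for [p = 2] the plane of [B_2]. For [p = 0] the exclusions leave [k0 >= 2], hence two planes
    [natural]. *)
Lemma in_PC_nonexcluded (k : fieldType) n r k0 p q : [pchar k] =i pred0 ->
  n = (2 * k0 + p + q)%N -> in_PC r k0 p q -> r = 1%N -> nonexcluded k n k0 p.
Proof.
move=> hchar nE [_ ple ex] r1 u _ comm; have {}ex : ~ _ := ex (ltnW (eq_leq (congr1 S r1))).
set k1 := pairs_of k0 p in comm *.
have k1n : (2 * k1 <= n)%N by rewrite nE /k1 /pairs_of; move: ple; case: (p =P 2) => [->|]; clear; lia.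
pose q1 (l : 'rV[int]_n) := odd (absz (qf k1 l l + lf k0 p l)).
pose b (l v : 'rV[int]_n) := odd (absz (qf k1 l v + qf k1 v l)).
have oD (y z : int) : odd (absz (y + z)) = odd (absz y) (+) odd (absz z) by clear; lia.
have epsE l v : (eps k k1 l v == eps k k1 v l) = ~~ b l v.
  rewrite /eps /b !sg_odd oD; case: (odd _); case: (odd _); rewrite ?eqxx //.
    by apply/eqP => /esym /(eq_opp_0 hchar) /eqP; rewrite oner_eq0.
  by apply/eqP => /(eq_opp_0 hchar) /eqP; rewrite oner_eq0.
apply/(radP hchar k1n) => l; apply/eqP; rewrite epsE; apply/negbT; move: l.
apply: (@commuting_radical _ q1 b).
- move=> y z; rewrite /q1 /b -!oD qfDl !qfDr lfD; congr (odd (absz _)); ring.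
- by move=> y z v; rewrite /b -oD qfDl qfDr; congr (odd (absz _)); ring.
- by move=> y z; rewrite /b addrC.
- move=> l ql; apply/negbTE; rewrite -epsE; apply/eqP/comm.
  by rewrite /ssgn sg_odd -/k1 -/(q1 l) ql.
have qE (i : 'I_n) : q1 (row i 1%:M) = (i < 2 * k0)%N || ((p == 1%N) && (i == 2 * k0 :> nat))%N.
  rewrite /q1 qf_delta lf_delta (_ : [&& _, _ & _] = false); last by case: (nat_of_ord i) => [|t] //=; rewrite eqn_leq ltnn andbF.
  by rewrite add0r; case: ifP.
have bE (i j : 'I_n) : b (row i 1%:M) (row j 1%:M) =
    [&& odd i, (j == i.-1 :> nat) & (i < 2 * k1)%N] (+) [&& odd j, (i == j.-1 :> nat) & (j < 2 * k1)%N].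
  by rewrite /b !qf_delta oD; case: ifP => _; case: ifP.
have E (i : 'I_n) a : ent (row i (1%:M : 'M[int]_n)) a = (i == a :> nat)%:R.
  rewrite /ent; case: insubP => [b' _ <-|] /=; first by rewrite !mxE.
  by case: eqP => // <-; rewrite ltn_ord.
move: ple ex nE; case: (p =P 0%N) => [p0|p0]; last case: (p =P 1%N) => [p1|p1].
- move=> _ ex nE; have k02 : (2 <= k0)%N.
    by move: ex; rewrite p0; case: (k0) => [|[|?]] //= []; auto.
  have k1E : k1 = k0 by rewrite /k1 p0 /pairs_of addn0.
  have lt i : (i < 4)%N -> (i < n)%N by move: nE k02; clear; lia.
  have h i : (i < 4)%N -> (i < 2 * k0)%N by move: k02; clear; lia.
  apply: Or33; exists (row (Ordinal (lt 0%N isT)) 1%:M), (row (Ordinal (lt 1%N isT)) 1%:M),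
    (row (Ordinal (lt 2 isT)) 1%:M), (row (Ordinal (lt 3 isT)) 1%:M).
  by rewrite !qE !bE /= k1E !h //; split.
- move=> _ _ nE; have lt : (2 * k0 < n)%N by rewrite nE p1; clear; lia.
  have k1E : k1 = k0 by rewrite /k1 p1 /pairs_of addn0.
  apply: Or31; exists (row (Ordinal lt) 1%:M); first by rewrite qE p1 /= eqxx orbT.
  move=> l; apply/negbTE; rewrite -epsE; apply/eqP/(radP hchar k1n).
  apply/forallP => a; have la : (a < k0)%N := leq_trans (ltn_ord a) (eq_leq k1E).
  rewrite !E /= (_ : (2 * k0 == 2 * a)%N = false); last by move: la; clear; lia.
  by rewrite (_ : (2 * k0 == (2 * a).+1)%N = false) //; move: la; clear; lia.
move=> ple _ nE; have p2 : p = 2 by move: ple p0 p1; case: (p) => [|[|[|]]].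
have lt1 : (2 * k0 < n)%N by rewrite nE p2; clear; lia.
have lt2 : ((2 * k0).+1 < n)%N by rewrite nE p2; clear; lia.
have k1E : k1 = k0.+1 by rewrite /k1 p2 /pairs_of addn1.
apply: Or32; exists (row (Ordinal lt1) 1%:M), (row (Ordinal lt2) 1%:M).
by split; rewrite ?qE ?bE /= ?k1E ?p2 /=; clear; lia.
Qed.

(** * Isomorphism of Lie tori *)

Lemma pred_ext (T : Type) (P Q : T -> Prop) : (forall t, P t <-> Q t) -> P = Q.
Proof. by move=> h; apply: functional_extensionality => t; apply: propositional_extensionality. Qed.

Lemma pairs_le n k0 p q : n = (2 * k0 + p + q)%N -> (2 * pairs_of k0 p <= n)%N.
Proof. by move=> ->; rewrite /pairs_of; case: (p =P 2) => [->|]; clear; lia. Qed.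

Section SymplecticTori.
Variable k : fieldType.
Hypothesis hchar : [pchar k] =i pred0.

Let tau2 : (-1) * (-1) = 1 :> k. Proof. by rewrite mulrNN mulr1. Qed.

(** Equality of predicates, and not just equivalence, so that isomorphisms and rank vectors of [ssp]
    can be rewritten into those of [Lx]. *)
Lemma ssp_data (A : algType k) n (x : 'rV[int]_n -> A) inv k0 p q :
  is_torus_inv x inv -> is_model x inv k0 p q -> (p <= 2)%N ->
  n = (2 * k0 + p + q)%N /\ exists X : torus_str n (pairs_of k0 p) A,
    forall r, @ssp k A r inv = @Lx k n k0 p A X r (-1).
Proof.
move=> tor mod p2; have [nE [X Xs]] := model_torus_str tor mod p2.
have [_ [il _ _ _]] := tor; split=> //; exists X => r; apply: pred_ext => M.
exact: (ssp_Lx hchar (pairs_le nE) (inv_tinv il Xs)).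
Qed.

Section OneTorus.
Variables (A : algType k) (n k0 p q r : nat) (X : torus_str n (pairs_of k0 p) A).
Hypothesis nE : n = (2 * k0 + p + q)%N.
Hypothesis iPC : in_PC r k0 p q.
Local Notation Lx := (@Lx k n k0 p A X r (-1)).

Lemma ssp_centroid c : centroid Lx c -> exists2 z, inZ X z & forall M, Lx M -> c M = z *: M.
Proof.
have [r0 _ _] := iPC.
exact: (symplectic_centroid hchar (pairs_le nE) r0 (in_PC_nonexcluded hchar nE iPC)).
Qed.

(** Free ranks over the centroid are unique, so the rank vector is a function of [r], [k0] and
    [p]. *)
Lemma ssp_rkvecP s : ssp_rkvec Lx s <->
  s = if r == 1%N then [:: npos k0 p] else [:: #|cosets k0 p|; npos k0 p].
Proof.
have [r0 p2 _] := iPC; have cen := ssp_centroid.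
have VL al : forall M, rootspace Lx al M -> Lx M by move=> M [].
have lg := @rank_long k n k0 p q A X hchar nE p2 r (-1) tau2 r0 cen erefl.
have un al := @free_rank_uniq k n k0 p A X hchar (pairs_le nE) r (-1) tau2 r0 cen _ _ _ (VL al).
rewrite /ssp_rkvec; case: (r =P 1%N) => r1.
  split=> [[a [-> ha]]|->]; first by rewrite (un _ _ _ ha lg).
  by exists (npos k0 p).
have r2 : (1 < r)%N by rewrite ltn_neqAle r0 eq_sym andbT; apply/eqP.
have sh := @rank_short k n k0 p q A X hchar nE p2 r (-1) tau2 r0 cen r2.
split=> [[a [b [-> [ha hb]]]]|->]; first by rewrite (un _ _ _ ha sh) (un _ _ _ hb lg).
by exists #|cosets k0 p|, (npos k0 p).
Qed.

End OneTorus.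

Lemma ssp_pair_inj (A B : algType k) n1 n2 k1 p1 q1 k2 p2 q2 r1 r2
    (X : torus_str n1 (pairs_of k1 p1) A) (Y : torus_str n2 (pairs_of k2 p2) B) f g :
  n1 = (2 * k1 + p1 + q1)%N -> n2 = (2 * k2 + p2 + q2)%N ->
  in_PC r1 k1 p1 q1 -> in_PC r2 k2 p2 q2 ->
  lie_pair (@Lx k n1 k1 p1 A X r1 (-1)) (@Lx k n2 k2 p2 B Y r2 (-1)) f g ->
  [/\ r1 = r2, k1 = k2, p1 = p2 & q1 = q2].
Proof.
move=> nE1 nE2 i1 i2 fg; have [r10 l1 _] := i1; have [r20 l2 _] := i2.
have h1 := pairs_le nE1; have h2 := pairs_le nE2.
have er : r1 = r2 by apply: (rank_invariant hchar h1 h2 r10 r20 fg).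
subst r2; have cen1 := @ssp_centroid _ _ _ _ _ _ X nE1 i1; have cen2 := @ssp_centroid _ _ _ _ _ _ Y nE2 i2.
have en : n1 = n2.
  apply/eqP; rewrite eqn_leq (centre_nullity_le hchar h1 h2 tau2 r20 cen1 cen2 fg) andbT.
  exact: (centre_nullity_le hchar h2 h1 tau2 r10 cen2 cen1 (lie_pair_sym fg)).
have [d1 f1 e1] := @rank_symplectic k n1 k1 p1 q1 A X hchar nE1 l1 r1 (-1) tau2 r10 cen1 erefl.
have [d2 f2 e2] := @rank_symplectic k n2 k2 p2 q2 B Y hchar nE2 l2 r1 (-1) tau2 r10 cen2 erefl.
have [[fL _ _] [gL _ _] _ _] := fg.
have f1' := free_rank_pair (Lx_sub r1 X hchar h1 tau2) (Lx_sub r1 Y hchar h2 tau2) fg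
  (fun _ h => h) (fun M h _ => fL M h) (fun _ h => h) (fun N h _ => gL N h) f1.
have ed := @free_rank_uniq k n2 k2 p2 B Y hchar h2 r1 (-1) tau2 r10 cen2 _ _ _ (fun _ h => h) f1' f2.
rewrite ed in e1; have [ek ep] := dim_inj i1 i2 e1 e2.
by split=> //; move: nE1; rewrite en nE2 ek ep => /addnI.
Qed.

Lemma ssp_iso_inj (A B : algType k) n1 n2 (x : 'rV[int]_n1 -> A) (y : 'rV[int]_n2 -> B) inv1 inv2
    k1 p1 q1 k2 p2 q2 r1 r2 :
  in_PC r1 k1 p1 q1 -> in_PC r2 k2 p2 q2 ->
  is_torus_inv x inv1 -> is_model x inv1 k1 p1 q1 -> is_torus_inv y inv2 -> is_model y inv2 k2 p2 q2 ->
  lie_iso (@ssp k A r1 inv1) (@ssp k B r2 inv2) -> [/\ r1 = r2, k1 = k2, p1 = p2 & q1 = q2].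
Proof.
move=> i1 i2 t1 m1 t2 m2; have [_ l1 _] := i1; have [_ l2 _] := i2.
have [nE1 [X ->]] := ssp_data t1 m1 l1; have [nE2 [Y ->]] := ssp_data t2 m2 l2.
have s1 := Lx_sub r1 X hchar (pairs_le nE1) tau2; have s2 := Lx_sub r2 Y hchar (pairs_le nE2) tau2.
by move=> /(lie_iso_pairP s1 s2) [f [g fg]]; apply: (ssp_pair_inj nE1 nE2 i1 i2 fg).
Qed.

Lemma ssp_model_iso (A B : algType k) n1 n2 (x : 'rV[int]_n1 -> A) (y : 'rV[int]_n2 -> B) inv1 inv2
    k0 p q r : (p <= 2)%N ->
  is_torus_inv x inv1 -> is_model x inv1 k0 p q -> is_torus_inv y inv2 -> is_model y inv2 k0 p q ->
  lie_iso (@ssp k A r inv1) (@ssp k B r inv2).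
Proof.
move=> p2 t1 m1 t2 m2.
have [nE1 [X ->]] := ssp_data t1 m1 p2; have [nE2 [Y ->]] := ssp_data t2 m2 p2.
have en : n1 = n2 by rewrite nE1 nE2.
have {t1 m1 t2 m2 x y} := I; move: nE1 X; rewrite en => nE1 X _.
have s1 := Lx_sub r X hchar (pairs_le nE1) tau2; have s2 := Lx_sub r Y hchar (pairs_le nE2) tau2.
by apply/(lie_iso_pairP s1 s2); eexists; eexists; apply: (tiso_pair r (-1) X Y).
Qed.

Lemma lie_iso_refl (A : algType k) m (L : 'M[A]_m -> Prop) : lie_iso L L.
Proof. by exists id; split=> // Y LY; exists Y. Qed.

(** The invariants of Lie algebras are turned back on tori: in rank 3 every pair [(k0, p)] is
    admissible, and the identity is an isomorphism between the algebras of the two presentations. *)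
Lemma model_unique (A : algType k) n (x : 'rV[int]_n -> A) inv k0 p q k0' p' q' :
  (p <= 2)%N -> (p' <= 2)%N -> is_torus_inv x inv ->
  is_model x inv k0 p q -> is_model x inv k0' p' q' -> k0 = k0' /\ p = p'.
Proof.
move=> l l' t m m'; have i : in_PC 3 k0 p q by split.
have i' : in_PC 3 k0' p' q' by split.
by have [] := ssp_iso_inj i i' t m t m' (lie_iso_refl _).
Qed.

Lemma model_admissible (A : algType k) n (x : 'rV[int]_n -> A) inv r k0 p q :
  in_PC r k0 p q -> is_torus_inv x inv -> is_model x inv k0 p q -> ssp_admissible r x inv.
Proof.
move=> [r0 p2 ex] t m; split=> // /ex ne q'.
by split=> m'; apply: ne;
  [have [] := @model_unique A n x inv k0 p q 0 0 q' p2 isT t m m'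
  |have [] := @model_unique A n x inv k0 p q 0 1 q' p2 isT t m m'
  |have [] := @model_unique A n x inv k0 p q 1 0 q' p2 isT t m m']; move=> -> ->; auto.
Qed.

Lemma admissible_model (A : algType k) n (x : 'rV[int]_n -> A) inv r :
  ssp_admissible r x inv -> exists k0 p q, in_PC r k0 p q /\ is_model x inv k0 p q.
Proof.
move=> [r0 t ex]; have [k0 [p [q [p2 m]]]] := torus_classification hchar t.
exists k0, p, q; split=> //; split=> // /ex /(_ q) [n00 n01 n10].
case=> [/andP[/eqP e1 /eqP e2]|[/andP[/eqP e1 /eqP e2]|/andP[/eqP e1 /eqP e2]]];
  by rewrite e1 e2 in m.
Qed.

Lemma ssp_type_inj r1 r2 : (0 < r1)%N -> (0 < r2)%N -> ssp_type r1 = ssp_type r2 -> r1 = r2.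
Proof.
by rewrite /ssp_type; do 2!case: (_ =P 1%N) => [->|_] //; do 2!case: (_ =P 2) => [->|_] //; move=> _ _ [].
Qed.

(** The type gives [r], the rank vector gives [(k0, p)], and the nullity [2 k0 + p + q] then gives
    [q]. In rank one the single entry [npos] suffices thanks to admissibility. *)
Lemma ssp_iso_iff (A B : algType k) n1 n2 (x : 'rV[int]_n1 -> A) (y : 'rV[int]_n2 -> B) inv1 inv2 r1 r2 :
  ssp_admissible r1 x inv1 -> ssp_admissible r2 y inv2 ->
  lie_iso (@ssp k A r1 inv1) (@ssp k B r2 inv2) <->
  [/\ ssp_type r1 = ssp_type r2, n1 = n2 &
    exists s, ssp_rkvec (@ssp k A r1 inv1) s /\ ssp_rkvec (@ssp k B r2 inv2) s].
Proof.
move=> a1 a2; have [r10 t1 _] := a1; have [r20 t2 _] := a2.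
have [k1 [p1 [q1 [i1 m1]]]] := admissible_model a1.
have [k2 [p2 [q2 [i2 m2]]]] := admissible_model a2.
have [_ l1 _] := i1; have [_ l2 _] := i2.
have [nE1 [X EX]] := ssp_data t1 m1 l1; have [nE2 [Y EY]] := ssp_data t2 m2 l2.
have rk1 s := ssp_rkvecP X nE1 i1 s; have rk2 s := ssp_rkvecP Y nE2 i2 s.
split=> [iso|[tp nn [s [h1 h2]]]].
  have [er ek ep eq_] := ssp_iso_inj i1 i2 t1 m1 t2 m2 iso.
  split; [by rewrite er | by rewrite nE1 nE2 ek ep eq_ |].
  exists (if r1 == 1%N then [:: npos k1 p1] else [:: #|cosets k1 p1|; npos k1 p1]).
  by rewrite EX EY; split; [apply/rk1 | apply/rk2; rewrite er ek ep].
have er := ssp_type_inj r10 r20 tp.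
rewrite EX in h1; rewrite EY in h2; move: h1 h2 => /rk1 -> /rk2.
have key : (if r1 == 1%N then [:: npos k1 p1] else [:: #|cosets k1 p1|; npos k1 p1]) =
    (if r2 == 1%N then [:: npos k2 p2] else [:: #|cosets k2 p2|; npos k2 p2]) -> k1 = k2 /\ p1 = p2.
  rewrite -er; case: (r1 =P 1%N) => r1E [].
    by rewrite -er r1E in i2; rewrite r1E in i1; apply: npos_inj1 i1 i2.
  exact: npos_card_inj.
move=> /key [ek ep].
have eq_ : q1 = q2 by move: nn; rewrite nE1 nE2 ek ep => /addnI.
rewrite -er; apply: (ssp_model_iso r1 l1 t1 m1 t2).
by rewrite ek ep eq_.
Qed.

End SymplecticTori.

Section OrthogonalTori.
Variable k : fieldType.
Hypothesis hchar : [pchar k] =i pred0.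

Let one2 : 1 * 1 = 1 :> k. Proof. exact: mulr1. Qed.

Lemma ssgn_laurent n (l : 'rV[int]_n) : ssgn k 0 0 l = 1.
Proof. by rewrite /ssgn /qf /lf big_ord0 big_ord0. Qed.

Lemma tinv_laurent n (A : algType k) (X : torus_str n (pairs_of 0 0) A) : id =1 tinv X.
Proof. by apply: inv_tinv => // l; rewrite ssgn_laurent scale1r. Qed.

Lemma laurent_exists n : exists (A : algType k) (x : 'rV[int]_n -> A), is_laurent x.
Proof.
have [X _] := qtorus_str k n (pairs_of 0 0); exists (qtorus k n (pairs_of 0 0)), (tx X).
have e : id = tinv X by apply: functional_extensionality; apply: tinv_laurent.
by rewrite /is_laurent e; split; [exact: tinv_torus_inv | exact: tinv_model].
Qed.

Lemma orth_data n (A : algType k) (x : 'rV[int]_n -> A) : is_laurent x ->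
  exists X : torus_str n (pairs_of 0 0) A, forall r, @orth k A r = @Lx k n 0 0 A X r 1.
Proof.
move=> [t m]; have [_ [X _]] := model_torus_str t m isT; exists X => r.
by apply: pred_ext => M; apply: (orth_Lx hchar) => a; rewrite -tinv_laurent.
Qed.

Let k2n n : (2 * pairs_of 0 0 <= n)%N. Proof. by []. Qed.

Lemma orth_rank n (A : algType k) (X : torus_str n (pairs_of 0 0) A) r : (2 < r)%N ->
  free_rank (@Lx k n 0 0 A X r 1) (@Lx k n 0 0 A X r 1) 'C(r + r, 2).
Proof.
move=> r2; have nE : n = (2 * 0 + 0 + n)%N by [].
have := @rank_Lx k n 0 0 n A X hchar nE isT r 1 (@orthogonal_centroid k n A X hchar r r2).
congr free_rank; rewrite (eq_bigr (fun=> 'C(r + r, 2))) => [|b _].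
  by rewrite sum_nat_const card_cosets mul1n.
have ds : \dim (skv r (1 : k) 1) = 'C(r + r, 2).
  rewrite (dim_skv r hchar one2 one2) mulr1 (_ : (1 == -1 :> k) = false) ?addn0 //.
  by apply/eqP => /(eq_opp_0 hchar)/eqP; rewrite oner_eq0.
by rewrite /Lsp ssgn_laurent (skv1_tr0 r hchar one2) if_same.
Qed.

(** The rank over the centroid is [r (2 r - 1)], which increases strictly with [r]. *)
Lemma orth_pair_inj n1 n2 (A B : algType k) (X : torus_str n1 (pairs_of 0 0) A)
    (Y : torus_str n2 (pairs_of 0 0) B) r1 r2 f g : (2 < r1)%N -> (2 < r2)%N ->
  lie_pair (@Lx k n1 0 0 A X r1 1) (@Lx k n2 0 0 B Y r2 1) f g -> r1 = r2 /\ n1 = n2.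
Proof.
move=> h1 h2 fg; have r10 := ltn_trans (isT : (0 < 2)%N) h1; have r20 := ltn_trans (isT : (0 < 2)%N) h2.
have cen1 := @orthogonal_centroid k n1 A X hchar r1 h1.
have cen2 := @orthogonal_centroid k n2 B Y hchar r2 h2.
have [[fL _ _] [gL _ _] _ _] := fg.
split; last first.
  apply/eqP; rewrite eqn_leq (centre_nullity_le hchar (k2n n1) (k2n n2) one2 r20 cen1 cen2 fg) andbT.
  exact: (centre_nullity_le hchar (k2n n2) (k2n n1) one2 r10 cen2 cen1 (lie_pair_sym fg)).
have f1 := free_rank_pair (Lx_sub r1 X hchar (k2n n1) one2) (Lx_sub r2 Y hchar (k2n n2) one2) fg
  (fun _ h => h) (fun M h _ => fL M h) (fun _ h => h) (fun N h _ => gL N h) (orth_rank X h1).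
have := @free_rank_uniq k n2 0 0 B Y hchar (k2n n2) r2 1 one2 r20 cen2 _ _ _ (fun _ h => h) f1 (orth_rank Y h2).
have bE r : ('C(r + r, 2) = r * (2 * r - 1))%N.
  by rewrite bin2 addnn -mul2n -mulnA mul2n doubleK subn1.
rewrite !bE => e; case: (ltngtP r1 r2) => // lt; exfalso.
  by have : (r1 * (2 * r1 - 1) < r2 * (2 * r2 - 1))%N by [apply: ltn_mul; move: lt; clear; lia]; rewrite e ltnn.
by have : (r2 * (2 * r2 - 1) < r1 * (2 * r1 - 1))%N by [apply: ltn_mul; move: lt; clear; lia]; rewrite e ltnn.
Qed.

Lemma orth_iso_inj n1 n2 (A B : algType k) (x : 'rV[int]_n1 -> A) (y : 'rV[int]_n2 -> B) r1 r2 :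
  (2 < r1)%N -> (2 < r2)%N -> is_laurent x -> is_laurent y ->
  lie_iso (@orth k A r1) (@orth k B r2) -> r1 = r2 /\ n1 = n2.
Proof.
move=> h1 h2 /orth_data[X ->] /orth_data[Y ->].
move=> /(lie_iso_pairP (Lx_sub r1 X hchar (k2n n1) one2) (Lx_sub r2 Y hchar (k2n n2) one2)) [f [g fg]].
exact: orth_pair_inj fg.
Qed.

Lemma orth_laurent_iso n (A B : algType k) (x : 'rV[int]_n -> A) (y : 'rV[int]_n -> B) r :
  is_laurent x -> is_laurent y -> lie_iso (@orth k A r) (@orth k B r).
Proof.
move=> /orth_data[X ->] /orth_data[Y ->].
apply/(lie_iso_pairP (Lx_sub r X hchar (k2n n) one2) (Lx_sub r Y hchar (k2n n) one2)).
by eexists; eexists; apply: (tiso_pair r 1 X Y).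
Qed.

End OrthogonalTori.

Theorem theorem10p2 (k : closedFieldType) (hchar : [pchar k] =i pred0) :
  (* (i) special symplectic Lie tori *)
  [/\
    (* the model (A_{k0,p,q},-) exists, and r with it is admissible *)
    (forall r k0 p q : nat, in_PC r k0 p q ->
       exists (A : algType k) (x : 'rV[int]_(2 * k0 + p + q) -> A) (inv : A -> A),
         is_torus_inv x inv /\ is_model x inv k0 p q) /\
    (forall r k0 p q : nat, in_PC r k0 p q ->
       forall (A : algType k) (n : nat) (x : 'rV[int]_n -> A) (inv : A -> A),
         is_torus_inv x inv -> is_model x inv k0 p q -> ssp_admissible r x inv),
    (* the map is well defined on isomorphism classes *)
    (forall r k0 p q : nat, in_PC r k0 p q ->
       forall (A1 : algType k) (n1 : nat) (x1 : 'rV[int]_n1 -> A1) (inv1 : A1 -> A1)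
              (A2 : algType k) (n2 : nat) (x2 : 'rV[int]_n2 -> A2) (inv2 : A2 -> A2),
         is_torus_inv x1 inv1 -> is_model x1 inv1 k0 p q ->
         is_torus_inv x2 inv2 -> is_model x2 inv2 k0 p q ->
         lie_iso (@ssp k A1 r inv1) (@ssp k A2 r inv2)),
    (* surjectivity *)
    (forall (r : nat) (A : algType k) (n : nat) (x : 'rV[int]_n -> A) (inv : A -> A),
       ssp_admissible r x inv ->
       exists r' k0 p q : nat, in_PC r' k0 p q /\
         exists (A' : algType k) (n' : nat) (x' : 'rV[int]_n' -> A') (inv' : A' -> A'),
           [/\ is_torus_inv x' inv', is_model x' inv' k0 p q &
               lie_iso (@ssp k A r inv) (@ssp k A' r' inv')]),
    (* injectivity *)
    (forall r1 k1 p1 q1 r2 k2 p2 q2 : nat, in_PC r1 k1 p1 q1 -> in_PC r2 k2 p2 q2 ->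
       forall (A1 : algType k) (n1 : nat) (x1 : 'rV[int]_n1 -> A1) (inv1 : A1 -> A1)
              (A2 : algType k) (n2 : nat) (x2 : 'rV[int]_n2 -> A2) (inv2 : A2 -> A2),
         is_torus_inv x1 inv1 -> is_model x1 inv1 k1 p1 q1 ->
         is_torus_inv x2 inv2 -> is_model x2 inv2 k2 p2 q2 ->
         lie_iso (@ssp k A1 r1 inv1) (@ssp k A2 r2 inv2) ->
         [/\ r1 = r2, k1 = k2, p1 = p2 & q1 = q2]) &
    (* isomorphism iff same type, nullity and root-space rank vector *)
    (forall (r1 : nat) (A1 : algType k) (n1 : nat) (x1 : 'rV[int]_n1 -> A1) (inv1 : A1 -> A1)
            (r2 : nat) (A2 : algType k) (n2 : nat) (x2 : 'rV[int]_n2 -> A2) (inv2 : A2 -> A2),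
       ssp_admissible r1 x1 inv1 -> ssp_admissible r2 x2 inv2 ->
       (lie_iso (@ssp k A1 r1 inv1) (@ssp k A2 r2 inv2) <->
        [/\ ssp_type r1 = ssp_type r2, n1 = n2 &
            exists s : seq nat, ssp_rkvec (@ssp k A1 r1 inv1) s /\
                                ssp_rkvec (@ssp k A2 r2 inv2) s]))]
  /\
  (* (ii) orthogonal Lie tori *)
  [/\
    (forall n : nat, exists (A : algType k) (x : 'rV[int]_n -> A), is_laurent x),
    (forall (r : nat) (A1 : algType k) (n : nat) (x1 : 'rV[int]_n -> A1)
            (A2 : algType k) (x2 : 'rV[int]_n -> A2),
       (4 <= r)%N -> is_laurent x1 -> is_laurent x2 ->
       lie_iso (@orth k A1 r) (@orth k A2 r)),
    (forall (r1 : nat) (A1 : algType k) (n1 : nat) (x1 : 'rV[int]_n1 -> A1)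
            (r2 : nat) (A2 : algType k) (n2 : nat) (x2 : 'rV[int]_n2 -> A2),
       (4 <= r1)%N -> (4 <= r2)%N -> is_laurent x1 -> is_laurent x2 ->
       lie_iso (@orth k A1 r1) (@orth k A2 r2) -> r1 = r2 /\ n1 = n2) &
    (forall (r1 : nat) (A1 : algType k) (n1 : nat) (x1 : 'rV[int]_n1 -> A1)
            (r2 : nat) (A2 : algType k) (n2 : nat) (x2 : 'rV[int]_n2 -> A2),
       (4 <= r1)%N -> (4 <= r2)%N -> is_laurent x1 -> is_laurent x2 ->
       (lie_iso (@orth k A1 r1) (@orth k A2 r2) <->
        orth_type r1 = orth_type r2 /\ n1 = n2))].
Proof.
split.
  split.
  - split=> [r k0 p q [_ p2 _]|r k0 p q i A n x inv]; last exact: model_admissible.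
    have [X _] := qtorus_str k (2 * k0 + p + q) (pairs_of k0 p).
    exists (qtorus k (2 * k0 + p + q) (pairs_of k0 p)), (tx X), (tinv X).
    by split; [exact: tinv_torus_inv | exact: tinv_model].
  - move=> r k0 p q [_ p2 _] A1 n1 x1 inv1 A2 n2 x2 inv2; exact: ssp_model_iso.
  (* The given torus is itself a model after a change of generators, so it serves as its own
     witness, with the identity as isomorphism. *)
  - move=> r A n x inv ad; have [k0 [p [q [i m]]]] := admissible_model hchar ad.
    have [_ t _] := ad; exists r, k0, p, q; split=> //.
    by exists A, n, x, inv; split=> //; apply: lie_iso_refl.
  - by move=> r1 k1 p1 q1 r2 k2 p2 q2 i1 i2 A1 n1 x1 inv1 A2 n2 x2 inv2; apply: ssp_iso_inj.
  by move=> r1 A1 n1 x1 inv1 r2 A2 n2 x2 inv2; apply: ssp_iso_iff.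
split.
- exact: laurent_exists.
- by move=> r A1 n x1 A2 x2 _; apply: orth_laurent_iso.
- move=> r1 A1 n1 x1 r2 A2 n2 x2 h1 h2; apply: orth_iso_inj => //; exact: leq_trans h1 || exact: leq_trans h2.
move=> r1 A1 n1 x1 r2 A2 n2 x2 h1 h2 l1 l2; split=> [iso|].
  have [-> ->] : r1 = r2 /\ n1 = n2 by apply: (orth_iso_inj hchar _ _ l1 l2 iso); [apply: leq_trans h1 | apply: leq_trans h2].
  by [].
case=> -[er] en; subst r2 n2; exact: (orth_laurent_iso hchar r1 l1 l2).
Qed.
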